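(* Let $\varphi\colon R\to S$ be a homomorphism of commutative Noetherian rings with $\operatorname{fd}_R(S)$ finite, and let $C$ be a homologically degreewise finite $R$-complex. If $C$ is $R$-semidualizing, then $C\otimes^{\mathbf L}_R S$ is $S$-semidualizing with $$\inf(C\otimes^{\mathbf L}_R S)\geq\inf(C) \qquad \text{and} \qquad \operatorname{amp}(C\otimes^{\mathbf L}_R S)\leq\operatorname{amp}(C).$$ Conversely, if $C\otimes^{\mathbf L}_R S$ is $S$-semidualizing and $\operatorname{Im}(\varphi^* )$ contains $\mathrm{m\text{-}Spec}(R)$, then $C$ is $R$-semidualizing and $\inf(C\otimes^{\mathbf L}_R S)=\inf(C)$.
   Context: Complexes are indexed homologically; $\mathsf D(R)$ is the derived category. $\inf(X)$ and $\sup(X)$ are the infimum and supremum of $\{i\mid\operatorname{H}_i(X)\neq0\}$, and $\operatorname{amp}(X)=\sup(X)-\inf(X)$. A complex is homologically finite (respectively, homologically degreewise finite) if its total homology (respectively, each homology module) is finitely generated. An $R$-complex $C$ is semidualizing if it is homologically finite and the homothety morphism $R\to\mathbf R\mathrm{Hom}_R(C,C)$ is an isomorphism in $\mathsf D(R)$. $\varphi^*\colon\operatorname{Spec}(S)\to\operatorname{Spec}(R)$ is the map induced by $\varphi$, and $\mathrm{m\text{-}Spec}(R)$ is the set of maximal ideals of $R$. *)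

(* Defs.v *)
From HB Require Import structures.
From mathcomp Require Import all_boot all_order all_algebra.
From mathcomp Require Import boolp classical_sets constructive_ereal.
From mathcomp Require Import ring.

Set Implicit Arguments.
Unset Strict Implicit.
Unset Printing Implicit Defensive.

Import Order.TTheory GRing.Theory Num.Theory.
Local Open Scope classical_set_scope.
Local Open Scope ring_scope.

Section MkLinear.
Variables (R : pzRingType) (U V : lmodType R) (f : U -> V) (Hf : linear f).
Definition lin_fun of linear f := f.
HB.instance Definition _ := GRing.isLinear.Build R U V *:%R (lin_fun Hf) Hf.
Definition mklin : {linear U -> V} := lin_fun Hf.
End MkLinear.

(** A type with operations satisfying the module axioms up to a congruence;
    its quotient is a module. *)
Record premod (R : pzRingType) := PreMod {
  pcar :> Type;
  peq : pcar -> pcar -> Prop;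
  p0 : pcar;
  padd : pcar -> pcar -> pcar;
  pscale : R -> pcar -> pcar;
  peq_refl : forall x, peq x x;
  peq_sym : forall x y, peq x y -> peq y x;
  peq_trans : forall x y z, peq x y -> peq y z -> peq x z;
  peq_add : forall x x' y y', peq x x' -> peq y y' -> peq (padd x y) (padd x' y');
  peq_scale : forall a x x', peq x x' -> peq (pscale a x) (pscale a x');
  paddA : forall x y z, peq (padd x (padd y z)) (padd (padd x y) z);
  paddC : forall x y, peq (padd x y) (padd y x);
  padd0 : forall x, peq (padd p0 x) x;
  paddN : forall x, peq (padd (pscale (-1) x) x) p0;
  pscaleA : forall a b x, peq (pscale a (pscale b x)) (pscale (a * b) x);
  pscale1 : forall x, peq (pscale 1 x) x;
  pscaleDr : forall a x y, peq (pscale a (padd x y)) (padd (pscale a x) (pscale a y));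
  pscaleDl : forall x a b, peq (pscale (a + b) x) (padd (pscale a x) (pscale b x))
}.

Section Quotient.
Variables (R : pzRingType) (T : premod R).

Definition pquot := {A : set T | exists x, A = peq x}.
Definition pcls (x : T) : pquot := exist _ (peq x) (ex_intro _ x erefl).
Definition prep (c : pquot) : T := projT1 (cid (svalP c)).

Lemma pclsP x y : pcls x = pcls y <-> peq x y.
Proof.
split=> [[e]|e]; first by rewrite e; exact: peq_refl.
apply: eq_exist; apply/funext => z; apply/propext; split => h.
  exact: peq_trans (peq_sym e) h.
exact: peq_trans e h.
Qed.

Lemma prepK c : pcls (prep c) = c.
Proof.
rewrite /prep; case: (cid _) => x /= e.
by case: c e => A hA /= e; apply: eq_exist; rewrite e.
Qed.

Lemma peq_prep x : peq (prep (pcls x)) x.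
Proof. by apply/pclsP; rewrite prepK. Qed.

HB.instance Definition _ := gen_eqMixin pquot.
HB.instance Definition _ := gen_choiceMixin pquot.

Definition quot_add (c d : pquot) := pcls (padd (prep c) (prep d)).
Definition quot_scale (a : R) (c : pquot) := pcls (pscale a (prep c)).

Lemma quot_addE x y : quot_add (pcls x) (pcls y) = pcls (padd x y).
Proof. by apply/pclsP/peq_add; exact: peq_prep. Qed.
Lemma quot_scaleE a x : quot_scale a (pcls x) = pcls (pscale a x).
Proof. by apply/pclsP/peq_scale; exact: peq_prep. Qed.

Let quot_addA : associative quot_add.
Proof.
move=> x y z; rewrite -(prepK x) -(prepK y) -(prepK z) !quot_addE.
exact/pclsP/paddA.
Qed.
Let quot_addC : commutative quot_add.
Proof.
by move=> x y; rewrite -(prepK x) -(prepK y) !quot_addE; apply/pclsP/paddC.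
Qed.
Let quot_add0 : left_id (pcls (p0 T)) quot_add.
Proof. by move=> x; rewrite -(prepK x) !quot_addE; apply/pclsP/padd0. Qed.
Let quot_addN : left_inverse (pcls (p0 T)) (quot_scale (-1)) quot_add.
Proof.
by move=> x; rewrite -(prepK x) quot_scaleE !quot_addE; apply/pclsP/paddN.
Qed.
HB.instance Definition _ :=
  GRing.isZmodule.Build pquot quot_addA quot_addC quot_add0 quot_addN.

Let quot_scaleA a b v : quot_scale a (quot_scale b v) = quot_scale (a * b) v.
Proof. by rewrite -(prepK v) !quot_scaleE; apply/pclsP/pscaleA. Qed.
Let quot_scale1 : left_id 1 quot_scale.
Proof. by move=> v; rewrite -(prepK v) !quot_scaleE; apply/pclsP/pscale1. Qed.
Let quot_scaleDr : right_distributive quot_scale +%R.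
Proof.
move=> a x y; rewrite -(prepK x) -(prepK y).
rewrite [X in quot_scale a X]quot_addE !quot_scaleE [RHS]quot_addE.
exact/pclsP/pscaleDr.
Qed.
Let quot_scaleDl v : {morph quot_scale^~ v : a b / a + b}.
Proof.
move=> a b /=; rewrite -(prepK v) !quot_scaleE [RHS]quot_addE.
exact/pclsP/pscaleDl.
Qed.
HB.instance Definition _ := GRing.Zmodule_isLmodule.Build R pquot
  quot_scaleA quot_scale1 quot_scaleDr quot_scaleDl.

Lemma pclsD x y : pcls (padd x y) = pcls x + pcls y.
Proof. by rewrite -quot_addE. Qed.
Lemma pclsZ a x : pcls (pscale a x) = a *: pcls x.
Proof. by rewrite -quot_scaleE. Qed.
Lemma pcls0 : pcls (p0 T) = 0.
Proof. by []. Qed.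
End Quotient.

Section Presentation.
Variables (R : pzRingType) (G : Type).

Inductive term := TGen of G | TZero | TAdd of term & term | TScale of R & term.

Variable rel : term -> term -> Prop.

Inductive teq : term -> term -> Prop :=
| teq_rel t u : rel t u -> teq t u
| teq_refl t : teq t t
| teq_sym t u : teq t u -> teq u t
| teq_trans t u v : teq t u -> teq u v -> teq t v
| teq_add t t' u u' : teq t t' -> teq u u' -> teq (TAdd t u) (TAdd t' u')
| teq_scale a t t' : teq t t' -> teq (TScale a t) (TScale a t')
| teq_addA t u v : teq (TAdd t (TAdd u v)) (TAdd (TAdd t u) v)
| teq_addC t u : teq (TAdd t u) (TAdd u t)
| teq_add0 t : teq (TAdd TZero t) t
| teq_addN t : teq (TAdd (TScale (-1) t) t) TZero
| teq_scaleA a b t : teq (TScale a (TScale b t)) (TScale (a * b) t)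
| teq_scale1 t : teq (TScale 1 t) t
| teq_scaleDr a t u : teq (TScale a (TAdd t u)) (TAdd (TScale a t) (TScale a u))
| teq_scaleDl t a b : teq (TScale (a + b) t) (TAdd (TScale a t) (TScale b t)).

Definition term_premod : premod R := PreMod teq_refl teq_sym teq_trans teq_add
  teq_scale teq_addA teq_addC teq_add0 teq_addN teq_scaleA teq_scale1
  teq_scaleDr teq_scaleDl.

Definition presented : lmodType R := pquot term_premod.
Definition tcls (t : term) : presented := @pcls R term_premod t.
Definition pgen (g : G) : presented := tcls (TGen g).

Section Lift.
Variables (N : lmodType R) (h : G -> N).

Fixpoint teval (t : term) : N :=
  match t with
  | TGen g => h g
  | TZero => 0
  | TAdd t u => teval t + teval u
  | TScale a t => a *: teval t
  end.

Hypothesis hrel : forall t u, rel t u -> teval t = teval u.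

Lemma teval_teq t u : teq t u -> teval t = teval u.
Proof.
elim=> {t u} //=.
- by move=> t u v _ -> _ ->.
- by move=> t t' u u' _ -> _ ->.
- by move=> a t t' _ ->.
- by move=> t u v; rewrite addrA.
- by move=> t u; rewrite addrC.
- by move=> t; rewrite add0r.
- by move=> t; rewrite scaleN1r addNr.
- by move=> a b t; rewrite scalerA.
- by move=> t; rewrite scale1r.
- by move=> a t u; rewrite scalerDr.
- by move=> t a b; rewrite scalerDl.
Qed.

Definition plift_fun (x : presented) : N := teval (prep x).

Lemma plift_tcls t : plift_fun (tcls t) = teval t.
Proof. exact/teval_teq/(@peq_prep R term_premod t). Qed.

Lemma plift_linear : linear plift_fun.
Proof.
move=> a x y; rewrite -(prepK x) -(prepK y) -pclsZ -pclsD.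
by rewrite !plift_tcls.
Qed.

Definition plift : {linear presented -> N} := mklin plift_linear.

Lemma pliftE g : plift (pgen g) = h g.
Proof. exact: plift_tcls. Qed.
End Lift.

Lemma plift_ext (N : lmodType R) (f f' : presented -> N) :
  linear f -> linear f' -> (forall g, f (pgen g) = f' (pgen g)) -> f =1 f'.
Proof.
move=> lf lf' e x; rewrite -(prepK x).
rewrite -[f]/(mklin lf : presented -> N) -[f']/(mklin lf' : presented -> N).
elim: (prep x : term) => [g| |t IHt u IHu|a t IHt].
- exact: e.
- by rewrite pcls0 !linear0.
- by rewrite (pclsD (t : term_premod) u) !linearD IHt IHu.
- by rewrite (pclsZ a (t : term_premod)) !linearZ IHt.
Qed.

Lemma tclsE t : tcls t = teval pgen t.
Proof.
elim: t => [g| |t IHt u IHu|a t IHt] //=.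
- by rewrite -IHt -IHu -[RHS](pclsD (t : term_premod) u).
- by rewrite -IHt -[RHS](pclsZ a (t : term_premod)).
Qed.
End Presentation.

Arguments TZero {R G}.

Section Modules.
Variable R : pzRingType.

Definition free (G : Type) : lmodType R := presented (fun _ _ : term R G => False).

Definition free_lift (G : Type) (N : lmodType R) (h : G -> N) :
    {linear free G -> N} :=
  @plift R G (fun _ _ => False) N h (fun _ _ F => match F with end).

Definition direct_sum (I : Type) (M : I -> lmodType R) : lmodType R :=
  presented (fun t u : term R {i : I & M i} =>
    exists i (a : R) (x y : M i),
      t = TGen R (existT _ i (a *: x + y)) /\
      u = TAdd (TScale a (TGen R (existT _ i x))) (TGen R (existT _ i y))).

Definition fg_module (M : lmodType R) : Prop :=
  exists s : seq M, forall x : M,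
    exists c : 'I_(size s) -> R, x = \sum_(i < size s) c i *: s`_i.

Definition zero_module (M : lmodType R) : Prop := forall x : M, x = 0.
End Modules.

(** [tens phi M N] is [M \otimes_R N] with the [S]-module structure of [N]. *)
Section Tensor.
Variables (R S : comPzRingType) (phi : {rmorphism R -> S}).

Definition tens_rel (M : lmodType R) (N : lmodType S) (t u : term S (M * N)) : Prop :=
  (exists (a : R) (x y : M) (n : N),
     t = TGen S (a *: x + y, n) /\
     u = TAdd (TScale (phi a) (TGen S (x, n))) (TGen S (y, n))) \/
  (exists (b : S) (x : M) (n p : N),
     t = TGen S (x, b *: n + p) /\
     u = TAdd (TScale b (TGen S (x, n))) (TGen S (x, p))).

Definition tens (M : lmodType R) (N : lmodType S) : lmodType S :=
  presented (@tens_rel M N).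

Definition tmk (M : lmodType R) (N : lmodType S) (x : M) (n : N) : tens M N :=
  pgen (@tens_rel M N) (x, n).

Lemma tmkPl (M : lmodType R) (N : lmodType S) a (x y : M) (n : N) :
  tmk (a *: x + y) n = phi a *: tmk x n + tmk y n.
Proof.
rewrite /tmk /pgen tclsE /=.
have -> : pgen (@tens_rel M N) (a *: x + y, n) =
  tcls (@tens_rel M N) (TAdd (TScale (phi a) (TGen S (x, n))) (TGen S (y, n))).
  by apply/pclsP; apply: teq_rel; left; exists a, x, y, n.
by rewrite tclsE.
Qed.

Lemma tmkPr (M : lmodType R) (N : lmodType S) b (x : M) (n p : N) :
  tmk x (b *: n + p) = b *: tmk x n + tmk x p.
Proof.
rewrite /tmk /pgen tclsE /=.
have -> : pgen (@tens_rel M N) (x, b *: n + p) =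
  tcls (@tens_rel M N) (TAdd (TScale b (TGen S (x, n))) (TGen S (x, p))).
  by apply/pclsP; apply: teq_rel; right; exists b, x, n, p.
by rewrite tclsE.
Qed.

Lemma tensl_subproof (M M' : lmodType R) (N : lmodType S) (f : {linear M -> M'})
    (t u : term S (M * N)) : tens_rel t u ->
  teval (fun g => tmk (f g.1) g.2) t = teval (fun g => tmk (f g.1) g.2) u.
Proof.
case=> [[a [x [y [n [-> ->]]]]]|[b [x [n [p [-> ->]]]]]] /=.
  by rewrite linearP tmkPl.
by rewrite tmkPr.
Qed.

Definition tensl (M M' : lmodType R) (N : lmodType S) (f : {linear M -> M'}) :
    {linear tens M N -> tens M' N} :=
  plift (tensl_subproof (N := N) f).

Lemma tenslE (M M' : lmodType R) (N : lmodType S) (f : {linear M -> M'}) x n :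
  tensl N f (tmk x n) = tmk (f x) n.
Proof. exact: pliftE. Qed.
End Tensor.

Definition flat (R : comPzRingType) (F : lmodType R) : Prop :=
  forall (A B : lmodType R) (f : {linear A -> B}),
    injective f -> injective (tensl (idfun : {rmorphism R -> R}) F f).

Section Restriction.
Variables (R S : pzRingType) (phi : {rmorphism R -> S}) (M : lmodType S).
Definition restr of {rmorphism R -> S} : Type := M.
HB.instance Definition _ := GRing.Zmodule.on (restr phi).
Definition restr_scale (a : R) (x : restr phi) : restr phi := phi a *: (x : M).
Let restr_scaleA a b v : restr_scale a (restr_scale b v) = restr_scale (a * b) v.
Proof. by rewrite /restr_scale scalerA rmorphM. Qed.
Let restr_scale1 : left_id 1 restr_scale.
Proof. by move=> v; rewrite /restr_scale rmorph1 scale1r. Qed.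
Let restr_scaleDr : right_distributive restr_scale +%R.
Proof. by move=> a x y; rewrite /restr_scale scalerDr. Qed.
Let restr_scaleDl v : {morph restr_scale^~ v : a b / a + b}.
Proof. by move=> a b; rewrite /restr_scale rmorphD scalerDl. Qed.
HB.instance Definition _ := GRing.Zmodule_isLmodule.Build R (restr phi)
  restr_scaleA restr_scale1 restr_scaleDr restr_scaleDl.
End Restriction.

(** Having a differential for each pair of degrees, zero unless [i = j + 1],
    avoids transports along equalities of degrees. *)
Record complex (R : pzRingType) := Complex {
  cmod :> int -> lmodType R;
  cdiff : forall i j, {linear cmod i -> cmod j};
  cdiff_shape : forall i j x, i != j + 1 -> cdiff i j x = 0;
  cdiffK : forall i j k x, cdiff j k (cdiff i j x) = 0
}.
Arguments cdiff {R} c i j : rename.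

Record chain_map (R : pzRingType) (X Y : complex R) := ChainMap {
  cfun :> forall i, {linear X i -> Y i};
  cfun_comm : forall i j x, cdiff Y i j (cfun i x) = cfun j (cdiff X i j x)
}.

Section Homology.
Variable R : pzRingType.

Section Degree.
Variables (X : complex R) (i : int).

Definition cycle := {x : X i | cdiff X i (i - 1) x = 0}.
Definition homologous (z w : cycle) : Prop :=
  exists y, sval z - sval w = cdiff X (i + 1) i y.

Let cyc0 : cycle := exist _ 0 (linear0 _).
Let cyc_add_subproof (z w : cycle) : cdiff X i (i - 1) (sval z + sval w) = 0.
Proof. by rewrite linearD (svalP z) (svalP w) addr0. Qed.
Let cyc_add (z w : cycle) : cycle := exist _ _ (cyc_add_subproof z w).
Let cyc_scale_subproof a (z : cycle) : cdiff X i (i - 1) (a *: sval z) = 0.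
Proof. by rewrite linearZ_LR (svalP z) scaler0. Qed.
Let cyc_scale a (z : cycle) : cycle := exist _ _ (cyc_scale_subproof a z).

Let heq (z w : cycle) : sval z = sval w -> homologous z w.
Proof. by move=> e; exists 0; rewrite e subrr linear0. Qed.
Let hrefl z : homologous z z. Proof. exact: heq. Qed.
Let hsym z w : homologous z w -> homologous w z.
Proof. by case=> y e; exists (- y); rewrite linearN -e opprB. Qed.
Let htrans z w v : homologous z w -> homologous w v -> homologous z v.
Proof.
by move=> [y e] [y' e']; exists (y + y'); rewrite linearD -e -e' addrA subrK.
Qed.
Let hadd z z' w w' :
  homologous z z' -> homologous w w' -> homologous (cyc_add z w) (cyc_add z' w').
Proof.
by move=> [y e] [y' e']; exists (y + y'); rewrite linearD -e -e' /= opprD addrACA.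
Qed.
Let hscale a z z' : homologous z z' -> homologous (cyc_scale a z) (cyc_scale a z').
Proof. by move=> [y e]; exists (a *: y); rewrite linearZ_LR -e /= scalerBr. Qed.

Definition homology_premod : premod R.
Proof.
refine (@PreMod R cycle homologous cyc0 cyc_add cyc_scale hrefl hsym htrans hadd
  hscale _ _ _ _ _ _ _ _); move=> *; apply: heq => /=.
- exact: addrA.
- exact: addrC.
- exact: add0r.
- by rewrite scaleN1r addNr.
- exact: scalerA.
- exact: scale1r.
- exact: scalerDr.
- exact: scalerDl.
Defined.

Definition homology : lmodType R := pquot homology_premod.
Definition hcls (z : cycle) : homology := @pcls R homology_premod z.
Definition hrep (c : homology) : cycle := @prep R homology_premod c.
End Degree.

Lemma hmap_subproof (X Y : complex R) (f : chain_map X Y) i (z : cycle X i) :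
  cdiff Y i (i - 1) (f i (sval z)) = 0.
Proof. by rewrite cfun_comm (svalP z) linear0. Qed.

Definition cycle_map (X Y : complex R) (f : chain_map X Y) i (z : cycle X i) :
  cycle Y i := exist _ _ (hmap_subproof f z).

Definition hmap (X Y : complex R) (f : chain_map X Y) i (c : homology X i) :
  homology Y i := hcls (cycle_map f (hrep c)).

Lemma hmapE (X Y : complex R) (f : chain_map X Y) i (z : cycle X i) :
  hmap f (hcls z) = hcls (cycle_map f z).
Proof.
apply/pclsP; have [y e] := @peq_prep _ (homology_premod X i) z.
by exists (f (i + 1) y); rewrite /= cfun_comm -e linearB.
Qed.

Definition quasi_iso (X Y : complex R) (f : chain_map X Y) : Prop :=
  forall i, bijective (@hmap X Y f i).

Definition acyclic (X : complex R) : Prop := forall i, zero_module (homology X i).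

Definition hfinite (X : complex R) : Prop := fg_module (direct_sum (homology X)).
Definition hdfinite (X : complex R) : Prop := forall i, fg_module (homology X i).

Definition hsupport (X : complex R) : set (\bar int) :=
  [set i%:E | i in [set i : int | ~ zero_module (homology X i)]].

(** [infimum] and [supremum] take as first argument their value at [set0]. *)
Definition cinf (X : complex R) : \bar int := infimum +oo%E (hsupport X).
Definition csup (X : complex R) : \bar int := supremum -oo%E (hsupport X).
Definition amp (X : complex R) : \bar int := (csup X - cinf X)%E.

Definition conc_mod (M : lmodType R) (i : int) : lmodType R :=
  match i with Posz 0 => M | _ => 'rV[R]_0 end.

Definition conc (M : lmodType R) : complex R.
Proof.
exact: (@Complex R (conc_mod M) (fun i j => \0 : {linear conc_mod M i -> conc_mod M j})).
Defined.
End Homology.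

Section Hom.
Variables (R : comPzRingType) (X Y : complex R).

(** Homogeneous maps of degree [n]; the component [X i -> Y j] is zero unless
    [j = i + n]. *)
Record hom (n : int) := MkHom {
  hfun : forall i j, X i -> Y j;
  hfun_linear : forall i j, linear (@hfun i j);
  hfun_shape : forall i j x, j != i + n -> @hfun i j x = 0
}.
Arguments hfun {n} h i j x : rename.

Lemma hom_ext n (f g : hom n) :
  (forall i j x, hfun f i j x = hfun g i j x) -> f = g.
Proof.
case: f g => [f fl fs] [g gl gs] /= e.
have ? : f = g.
  by apply: functional_extensionality_dep => i;
     apply: functional_extensionality_dep => j; apply/funext => x.
by subst g; f_equal; exact: Prop_irrelevance.
Qed.

Definition hlin n (f : hom n) i j : {linear X i -> Y j} := mklin (@hfun_linear n f i j).

Section Degree.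
Variable n : int.
HB.instance Definition _ := gen_eqMixin (hom n).
HB.instance Definition _ := gen_choiceMixin (hom n).

Definition hom0 : hom n.
Proof.
refine (@MkHom n (fun i j _ => 0) _ _) => [i j a x y|//].
by rewrite scaler0 addr0.
Defined.

Definition hom_add (f g : hom n) : hom n.
Proof.
refine (@MkHom n (fun i j x => hfun f i j x + hfun g i j x) _ _) => [i j a x y|i j x ne].
  by rewrite !hfun_linear scalerDr addrACA.
by rewrite !hfun_shape ?addr0.
Defined.

Definition hom_scale (b : R) (f : hom n) : hom n.
Proof.
refine (@MkHom n (fun i j x => b *: hfun f i j x) _ _) => [i j a x y|i j x ne].
  by rewrite hfun_linear scalerDr !scalerA mulrC.
by rewrite hfun_shape ?scaler0.
Defined.

Let hom_addA : associative hom_add.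
Proof. by move=> f g h; apply: hom_ext => i j x /=; rewrite addrA. Qed.
Let hom_addC : commutative hom_add.
Proof. by move=> f g; apply: hom_ext => i j x /=; rewrite addrC. Qed.
Let hom_add0 : left_id hom0 hom_add.
Proof. by move=> f; apply: hom_ext => i j x /=; rewrite add0r. Qed.
Let hom_addN : left_inverse hom0 (hom_scale (-1)) hom_add.
Proof. by move=> f; apply: hom_ext => i j x /=; rewrite scaleN1r addNr. Qed.
HB.instance Definition _ :=
  GRing.isZmodule.Build (hom n) hom_addA hom_addC hom_add0 hom_addN.

Let hom_scaleA a b v : hom_scale a (hom_scale b v) = hom_scale (a * b) v.
Proof. by apply: hom_ext => i j x /=; rewrite scalerA. Qed.
Let hom_scale1 : left_id 1 hom_scale.
Proof. by move=> f; apply: hom_ext => i j x /=; rewrite scale1r. Qed.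
Let hom_scaleDr : right_distributive hom_scale +%R.
Proof. by move=> a f g; apply: hom_ext => i j x /=; rewrite scalerDr. Qed.
Let hom_scaleDl v : {morph hom_scale^~ v : a b / a + b}.
Proof. by move=> a b; apply: hom_ext => i j x /=; rewrite scalerDl. Qed.
HB.instance Definition _ := GRing.Zmodule_isLmodule.Build R (hom n)
  hom_scaleA hom_scale1 hom_scaleDr hom_scaleDl.
End Degree.

(** [d f = d^Y f - (-1)^n f d^X] for [f] of degree [n]. *)
Definition hom_diff_fun n m (f : hom n) i j (x : X i) : Y j :=
  if n == m + 1 then
    cdiff Y (j + 1) j (hfun f i (j + 1) x)
      - (-1) ^+ `|n|%N *: hfun f (i - 1) j (cdiff X i (i - 1) x)
  else 0.

Lemma hom_diff_fun_linear n m (f : hom n) i j : linear (@hom_diff_fun n m f i j).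
Proof.
move=> a x y; rewrite /hom_diff_fun; case: ifP => _; last by rewrite scaler0 addr0.
rewrite (linearP (cdiff X i (i - 1))) !hfun_linear (linearP (cdiff Y (j + 1) j)).
by rewrite scalerBr !scalerDr !scalerA [_ * a]mulrC opprD addrACA.
Qed.

Lemma hom_diff_fun_shape n m (f : hom n) i j x :
  j != i + m -> @hom_diff_fun n m f i j x = 0.
Proof.
move=> ne; rewrite /hom_diff_fun; case: eqP => // e.
have ne1 : j + 1 != i + n by rewrite e addrA (inj_eq (addIr 1)).
have ne2 : j != i - 1 + n by rewrite e (addrC m) addrA subrK.
by rewrite (hfun_shape _ _ ne1) (hfun_shape _ _ ne2) linear0 scaler0 subr0.
Qed.

Definition hom_diff_map n m (f : hom n) : hom m :=
  MkHom (@hom_diff_fun_linear n m f) (@hom_diff_fun_shape n m f).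

Lemma hom_diff_linear n m : linear (@hom_diff_map n m).
Proof.
move=> a f g; apply: hom_ext => i j x /=; rewrite /hom_diff_fun.
case: ifP => _; last by rewrite scaler0 addr0.
rewrite /= linearP scalerBr scalerDr !scalerA [_ * a]mulrC.
by rewrite opprD addrACA.
Qed.

Definition hom_diff n m : {linear hom n -> hom m} := mklin (@hom_diff_linear n m).

Lemma hom_diff_shape n m f : n != m + 1 -> hom_diff n m f = 0.
Proof.
by move=> /negbTE ne; apply: hom_ext => i j x /=; rewrite /hom_diff_fun ne.
Qed.

Lemma sign_absz_succ (m : int) : (-1) ^+ `|(m + 1)%R|%N = - ((-1) ^+ `|m|%N) :> R.
Proof.
case: m => n; first by rewrite -PoszD absz_nat addn1 exprS mulN1r.
case: n => [|n]; first by rewrite /= expr1 opprK.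
have -> : Negz n.+1 + 1 = Negz n by rewrite !NegzE -[n.+2]addn1 PoszD opprD subrK.
by rewrite /= [in RHS]exprS mulN1r opprK.
Qed.

Lemma hom_diffK n m p f : hom_diff m p (hom_diff n m f) = 0.
Proof.
apply: hom_ext => i j x; rewrite /= /hom_diff_fun /=.
case: eqP => // em; rewrite /hom_diff_fun; case: eqP => en; last first.
  by rewrite linear0 scaler0 subr0.
rewrite (linearB (cdiff Y (j + 1) j)) cdiffK (linearZ_LR (cdiff Y (j + 1) j)) cdiffK.
rewrite [X in _ - _ *: (_ - _ *: X)](linear0 (hlin f (i - 1 - 1) j)).
have -> : (-1) ^+ `|n|%N = - ((-1) ^+ `|m|%N) :> R by rewrite en sign_absz_succ.
by rewrite scaler0 subr0 sub0r scaleNr opprK subrr.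
Qed.

Definition Hom : complex R := @Complex R hom hom_diff hom_diff_shape hom_diffK.
End Hom.
Arguments hfun {R X Y n} h i j x : rename.

Section CastDegree.
Variables (R : pzRingType) (X : int -> lmodType R).

(** [x] if [i = j], and zero otherwise. *)
Definition castdeg i j (x : X i) : X j :=
  match i =P j with
  | ReflectT e => eq_rect i X x j e
  | ReflectF _ => 0
  end.

Lemma castdeg_id i x : @castdeg i i x = x.
Proof. by rewrite /castdeg; case: eqP => // e; rewrite (eq_axiomK e). Qed.

Lemma castdeg_ne i j x : i != j -> @castdeg i j x = 0.
Proof. by rewrite /castdeg; case: eqP. Qed.

Lemma castdeg_linear i j : linear (@castdeg i j).
Proof.
move=> a x y; case: (eqVneq i j) => [e|ne]; first by subst j; rewrite !castdeg_id.
by rewrite !castdeg_ne // scaler0 addr0.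
Qed.
End CastDegree.
Arguments castdeg {R X i} j x.

Definition Kprojective (R : comPzRingType) (P : complex R) : Prop :=
  forall E : complex R, acyclic E -> acyclic (Hom P E).

(** The resolution [res C] of [C] is free on an inductively generated graded set.
    Given an element [p] of degree [i - 1] and [c : C i], the set contains a
    generator [e] of degree [i]; if [d p = 0] and [p] maps to [d c] in [C], then
    [d e = p] and [e] maps to [c], and otherwise [d e = 0] and [e] maps to [0]. *)
Section Resolution.
Variables (R : comPzRingType) (C : complex R).

Inductive rgen (i : int) : Type := RGen of term R (rgen (i - 1)) & C i.

Definition rmod (i : int) : lmodType R := free R (rgen i).

Fixpoint rgen_data i (g : rgen i) : rmod (i - 1) * C i :=
  match g with
  | RGen p c =>
    if pselect (teval (fun g => (rgen_data g).1) p = 0 /\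
                teval (fun g => (rgen_data g).2) p = cdiff C i (i - 1) c)
    then (tcls _ p, c) else (0, 0)
  end.

Definition rdiff1 i : {linear rmod i -> rmod (i - 1)} :=
  free_lift (fun g : rgen i => (rgen_data g).1).
Definition raug i : {linear rmod i -> C i} :=
  free_lift (fun g : rgen i => (rgen_data g).2).

Lemma free_liftE (G : Type) (N : lmodType R) (h : G -> N) t :
  free_lift h (tcls _ t) = teval h t.
Proof. exact: plift_tcls. Qed.

Lemma rdiff1_gen i (g : rgen i) : rdiff1 i (pgen _ g) = (rgen_data g).1.
Proof. exact: pliftE. Qed.
Lemma raug_gen i (g : rgen i) : raug i (pgen _ g) = (rgen_data g).2.
Proof. exact: pliftE. Qed.

Lemma rdiff1K i x : rdiff1 (i - 1) (rdiff1 i x) = 0.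
Proof.
apply: (plift_ext (f := fun x => rdiff1 (i - 1) (rdiff1 i x)) (f' := fun=> 0)).
- by move=> a y z; rewrite !linearP.
- by move=> a y z; rewrite scaler0 addr0.
- move=> [p c]; rewrite rdiff1_gen /=.
  case: pselect => [[h _]|_] /=; last exact: linear0.
  by rewrite free_liftE.
Qed.

Lemma raug_comm i x : cdiff C i (i - 1) (raug i x) = raug (i - 1) (rdiff1 i x).
Proof.
apply: (plift_ext (f := fun x => cdiff C i (i - 1) (raug i x))
  (f' := fun x => raug (i - 1) (rdiff1 i x))).
- by move=> a y z; rewrite !linearP.
- by move=> a y z; rewrite !linearP.
- move=> [p c]; rewrite rdiff1_gen raug_gen /=.
  case: pselect => [[_ h]|_] /=; last by rewrite !linear0.
  by rewrite free_liftE.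
Qed.

Lemma rdiff_linear i j : linear (fun x : rmod i => castdeg j (rdiff1 i x) : rmod j).
Proof. by move=> a x y; rewrite linearP castdeg_linear. Qed.

Definition rdiff i j : {linear rmod i -> rmod j} := mklin (@rdiff_linear i j).

Lemma rdiffE i x : rdiff i (i - 1) x = rdiff1 i x.
Proof. exact: castdeg_id. Qed.

Lemma rdiff_shape i j x : i != j + 1 -> rdiff i j x = 0.
Proof. by move=> ne; apply: castdeg_ne; rewrite subr_eq. Qed.

Lemma rdiffK i j k x : rdiff j k (rdiff i j x) = 0.
Proof.
have [e|ne] := eqVneq i (j + 1); last by rewrite [rdiff i j x]rdiff_shape // linear0.
have ej : j = i - 1 by rewrite e addrK.
subst j; have [e'|ne'] := eqVneq (i - 1) (k + 1); last exact: rdiff_shape.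
have ek : k = i - 1 - 1 by rewrite e' addrK.
by subst k; rewrite !rdiffE rdiff1K.
Qed.

Definition res : complex R := Complex rdiff_shape rdiffK.

Lemma res_map_comm i j x : cdiff C i j (raug i x) = raug j (cdiff res i j x).
Proof.
have [e|ne] := eqVneq i (j + 1); last by rewrite !cdiff_shape // linear0.
have ej : j = i - 1 by rewrite e addrK.
by subst j; rewrite [cdiff res _ _ _]rdiffE raug_comm.
Qed.

Definition res_map : chain_map res C := @ChainMap R res C raug res_map_comm.

Lemma rfill k (p : rmod (k - 1)) (y : C k) :
  rdiff1 (k - 1) p = 0 -> raug (k - 1) p = cdiff C k (k - 1) y ->
  exists w : rmod k, rdiff1 k w = p /\ raug k w = y.
Proof.
rewrite -(prepK p) => dp ap; exists (pgen _ (RGen (prep p) y)).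
rewrite rdiff1_gen raug_gen /=; case: pselect => [[? ?]|[]] //.
by split; [rewrite -dp|rewrite -ap]; rewrite free_liftE.
Qed.

Lemma res_quasi_iso : quasi_iso res_map.
Proof.
move=> i; have surj c : exists c', @hmap _ _ _ res_map i c' = c.
  have [z ez] : exists z : cycle C i, hcls z = c by exists (hrep c); exact: prepK.
  pose w : res i := pgen _ (RGen TZero (sval z)).
  have dw : cdiff res i (i - 1) w = 0.
    by rewrite [LHS]rdiffE rdiff1_gen /=; case: pselect.
  exists (hcls (exist _ w dw)); rewrite hmapE -ez; apply/pclsP; exists 0; rewrite linear0 /= raug_gen /=.
  by case: pselect => [?|[]]; [exact: subrr|split => //=; rewrite (svalP z)].
have inj : injective (@hmap _ _ _ res_map i).
  move=> c1 c2; rewrite -(prepK c1) -(prepK c2).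
  rewrite [hmap _ _](hmapE res_map (hrep c1)) [hmap _ (pcls _)](hmapE res_map (hrep c2)).
  move=> /pclsP [y /= e]; apply/pclsP; rewrite /= /homologous.
  move: (svalP (prep c1)) (svalP (prep c2)) e.
  move: (sval (prep c1)) (sval (prep c2)) => z1 z2 d1 d2; rewrite -linearB => e.
  have dz : cdiff res i (i - 1) (z1 - z2) = 0 by rewrite linearB d1 d2 subrr.
  move: (z1 - z2) e dz => z {z1 z2 d1 d2}.
  have [k ek] : exists k, k = i + 1 by exists (i + 1).
  have ei : i = k - 1 by rewrite ek addrK.
  move: y; rewrite -ek => y e dz; subst i; rewrite [LHS]rdiffE in dz.
  by have [w [<- _]] := rfill dz e; exists w; rewrite [RHS]rdiffE.
exists (fun c => projT1 (cid (surj c))) => c.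
  by apply: inj; case: (cid _).
by case: (cid _).
Qed.

Fixpoint tall (G : Type) (Q : G -> Prop) (t : term R G) : Prop :=
  match t with
  | TGen g => Q g
  | TZero => True
  | TAdd t u => tall Q t /\ tall Q u
  | TScale _ t => tall Q t
  end.

Lemma tall_free (G : Type) (N : lmodType R) (f f' : free R G -> N) t :
  linear f -> linear f' ->
  tall (fun g => f (pgen _ g) = f' (pgen _ g)) t -> f (tcls _ t) = f' (tcls _ t).
Proof.
move=> lf lf'.
rewrite -[f]/(mklin lf : free R G -> N) -[f']/(mklin lf' : free R G -> N).
elim: t => [g| |t IHt u IHu|a t IHt] //=.
- by rewrite [tcls _ _](@pcls0 _ (term_premod _)) !linear0.
- move=> [/IHt e /IHu e'].
  by rewrite [tcls _ _](pclsD (t : term_premod _) u) !linearD e e'.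
- move=> /IHt e.
  by rewrite [tcls _ _](pclsZ a (t : term_premod _)) !linearZ e.
Qed.

Lemma rgen_tall_ind (Q : forall i, rgen i -> Prop) :
  (forall i (p : term R (rgen (i - 1))) c, tall (@Q (i - 1)) p -> Q i (RGen p c)) ->
  forall i g, Q i g.
Proof.
move=> H; fix IH 2 => i [p c]; apply: H.
by elim: p => [g| |t IHt u IHu|a t IHt] //=.
Qed.

Section Contraction.
Variables (E : complex R) (n : int) (f : hom res E n).
Hypothesis E_exact : forall k j x, k = j + 1 ->
  cdiff E j (j - 1) x = 0 -> exists y, cdiff E k j y = x.
Let s : R := (-1) ^+ `|n|%N.
Hypothesis f_cycle : forall i k j x, k = j + 1 ->
  cdiff E k j (hfun f i k x) = s *: hfun f (i - 1) j (cdiff res i (i - 1) x).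

Fixpoint rcontr i (g : rgen i) (j : int) : E j :=
  match g with
  | RGen p c =>
    xget 0 [set y | cdiff E j (j - 1) y =
      hfun f i (j - 1) (pgen _ (RGen p c)) -
      s *: (if pselect (teval (fun g => (rgen_data g).1) p = 0 /\
                teval (fun g => (rgen_data g).2) p = cdiff C i (i - 1) c)
            then teval (fun g => rcontr g (j - 1)) p else 0)]
  end.

Definition rcontr_lin i j : {linear rmod i -> E j} :=
  free_lift (fun g : rgen i => rcontr g j).

Lemma rcontr_gen i j (g : rgen i) : rcontr_lin i j (pgen _ g) = rcontr g j.
Proof. exact: pliftE. Qed.

Lemma rcontrP i (g : rgen i) : forall j, j = i + n + 1 ->
  cdiff E j (j - 1) (rcontr_lin i j (pgen _ g)) =
  hfun f i (j - 1) (pgen _ g) -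
    s *: rcontr_lin (i - 1) (j - 1) (rdiff1 i (pgen _ g)).
Proof.
elim/rgen_tall_ind: i / g => i p c IH j ej; rewrite rcontr_gen.
have -> : rcontr_lin (i - 1) (j - 1) (rdiff1 i (pgen _ (RGen p c))) =
  if pselect (teval (fun g => (rgen_data g).1) p = 0 /\
              teval (fun g => (rgen_data g).2) p = cdiff C i (i - 1) c)
  then teval (fun g => rcontr g (j - 1)) p else 0.
  rewrite rdiff1_gen /=; case: pselect => _ /=; last exact: linear0.
  exact: free_liftE.
rewrite /=; set t := _ - s *: _.
have [y ey] : exists y, cdiff E j (j - 1) y = t.
  apply: E_exact; first by rewrite subrK.
  rewrite /t (linearB (cdiff E (j - 1) (j - 1 - 1))) (linearZ_LR (cdiff E (j - 1) (j - 1 - 1))).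
  rewrite f_cycle ?subrK // [cdiff res _ _ _]rdiffE rdiff1_gen /=.
  case: pselect => [[dp _]|_] /=; last first.
    by rewrite linear0 -[hfun _ _ _ _]/(hlin f _ _ _) linear0 subrr.
  apply/eqP; rewrite subr_eq0; apply/eqP; congr (_ *: _).
  have -> : teval (fun g => rcontr g (j - 1)) p = rcontr_lin (i - 1) (j - 1) (tcls _ p).
    by rewrite free_liftE.
  have e0 : rdiff1 (i - 1) (tcls _ p) = 0 by rewrite free_liftE.
  have := @tall_free _ (E (j - 1 - 1))
    (fun x => cdiff E (j - 1) (j - 1 - 1) (rcontr_lin (i - 1) (j - 1) x))
    (fun x => hfun f (i - 1) (j - 1 - 1) x -
       s *: rcontr_lin (i - 1 - 1) (j - 1 - 1) (rdiff1 (i - 1) x)) p.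
  move=> ->.
  - by rewrite e0 linear0 scaler0 subr0.
  - by move=> a x z; rewrite !linearP.
  - move=> a x z; rewrite hfun_linear linearP linearP scalerBr scalerDr !scalerA.
    by rewrite [_ * a]mulrC opprD addrACA.
  - elim: p IH {dp e0 t} => [g| |t IHt u IHu|a t IHt] //=.
      by apply; rewrite ej; ring.
    by move=> [/IHt ? /IHu ?].
by apply: (@xgetPex _ 0 [set y | cdiff E j (j - 1) y = t]); exists y.
Qed.

Lemma rcontr_linP i j x : j = i + n + 1 ->
  cdiff E j (j - 1) (rcontr_lin i j x) =
  hfun f i (j - 1) x - s *: rcontr_lin (i - 1) (j - 1) (rdiff1 i x).
Proof.
move=> ej; move: x.
apply: (plift_ext (f := fun x => cdiff E j (j - 1) (rcontr_lin i j x))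
  (f' := fun x => hfun f i (j - 1) x - s *: rcontr_lin (i - 1) (j - 1) (rdiff1 i x))).
- by move=> a x z; rewrite !linearP.
- move=> a x z; rewrite hfun_linear linearP linearP scalerBr scalerDr !scalerA.
  by rewrite [_ * a]mulrC opprD addrACA.
- by move=> g; exact: rcontrP.
Qed.

Definition rcontr_fun i j (x : res i) : E j :=
  if j == i + (n + 1) then rcontr_lin i j x else 0.
Lemma rcontr_fun_linear i j : linear (@rcontr_fun i j).
Proof.
by move=> a x y; rewrite /rcontr_fun; case: eqP => _; rewrite ?linearP ?scaler0 ?addr0.
Qed.
Lemma rcontr_fun_shape i j x : j != i + (n + 1) -> @rcontr_fun i j x = 0.
Proof. by rewrite /rcontr_fun => /negbTE ->. Qed.
Definition rcontr_hom : hom res E (n + 1) := MkHom rcontr_fun_linear rcontr_fun_shape.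

Lemma rcontr_homP : f = hom_diff res E (n + 1) n rcontr_hom.
Proof.
apply: hom_ext => i j x; rewrite /= /hom_diff_fun eqxx /= /rcontr_fun.
have -> : (j + 1 == i + (n + 1)) = (j == i + n) by rewrite addrA (inj_eq (addIr 1)).
have -> : (j == i - 1 + (n + 1)) = (j == i + n) by rewrite (addrC n) addrA subrK.
case: eqP => [ej|/eqP ne]; last by rewrite hfun_shape // linear0 scaler0 subr0.
have -> : (-1) ^+ `|(n + 1)%R|%N = - s by exact: sign_absz_succ.
rewrite scaleNr opprK rdiffE.
have [k ekj] : exists k, k = j + 1 by exists (j + 1).
have ek : k = i + n + 1 by rewrite ekj ej.
rewrite -ekj; have ejk : j = k - 1 by rewrite ekj addrK.
clear ej ekj; subst j; rewrite (rcontr_linP x ek).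
by rewrite subrK.
Qed.
End Contraction.

Lemma res_Kprojective : Kprojective res.
Proof.
move=> E acE n c; rewrite -(prepK c); move: (prep c : cycle (Hom res E) n) => -[f df].
apply/pclsP; rewrite /= /homologous /=.
have ex k j x : k = j + 1 -> cdiff E j (j - 1) x = 0 -> exists y, cdiff E k j y = x.
  move=> -> dx; have := acE j (hcls (exist _ x dx)) => /pclsP [y /=].
  by rewrite subr0 => ->; exists y.
have cy i k j x : k = j + 1 -> cdiff E k j (hfun f i k x) =
    (-1) ^+ `|n|%N *: hfun f (i - 1) j (cdiff res i (i - 1) x).
  move=> ->; have := congr1 (fun h : hom res E (n - 1) => hfun h i j x) df.
  by rewrite /= /hom_diff_fun subrK eqxx => /eqP; rewrite subr_eq0 => /eqP.
exists (rcontr_hom f); rewrite subr0; exact: (rcontr_homP ex cy).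
Qed.
End Resolution.

Section TensorComplex.
Variables (R S : comPzRingType) (phi : {rmorphism R -> S}).
Variables (X : complex R) (N : lmodType S).

Lemma tmk0l (M : lmodType R) n : tmk phi (0 : M) n = 0 :> tens phi M N.
Proof.
have := tmkPl phi 1 (0 : M) 0 n; rewrite scaler0 addr0 rmorph1 scale1r => e.
by apply: (addrI (tmk phi 0 n)); rewrite -e addr0.
Qed.

Lemma tens_shape i j x : i != j + 1 -> tensl phi N (cdiff X i j) x = 0.
Proof.
move=> ne; apply: (plift_ext (f := tensl phi N (cdiff X i j)) (f' := fun=> 0)).
- exact: linearP.
- by move=> a y z; rewrite scaler0 addr0.
- by move=> [m n]; rewrite [LHS]tenslE cdiff_shape // tmk0l.
Qed.

Lemma tens_diffK i j k x : tensl phi N (cdiff X j k) (tensl phi N (cdiff X i j) x) = 0.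
Proof.
apply: (plift_ext (f := fun x => tensl phi N (cdiff X j k) (tensl phi N (cdiff X i j) x))
  (f' := fun=> 0)).
- by move=> a y z; rewrite !linearP.
- by move=> a y z; rewrite scaler0 addr0.
- move=> [m n]; rewrite [tensl phi N (cdiff X i j) _]tenslE.
  by rewrite [LHS]tenslE cdiffK tmk0l.
Qed.

Definition tens_complex : complex S :=
  @Complex S (fun i => tens phi (X i) N) (fun i j => tensl phi N (cdiff X i j))
    tens_shape tens_diffK.
End TensorComplex.

(** K-projective complexes are K-flat, so the resolution [res X] computes both
    the derived functors of [Hom(X, -)] and of [X \otimes -]. *)
Definition RHom (R : comPzRingType) (X Y : complex R) : complex R := Hom (res X) Y.

Definition Ltensor (R S : comPzRingType) (phi : {rmorphism R -> S}) (X : complex R) :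
  complex S := tens_complex phi (res X) S^o.

Section Homothety.
Variable R : comPzRingType.

Section ChainMapHom.
Variables (X Y : complex R) (f : chain_map X Y).

Lemma chain_map_hom_linear i j : linear (fun x : X i => castdeg j (f i x) : Y j).
Proof. by move=> a x y; rewrite linearP castdeg_linear. Qed.
Lemma chain_map_hom_shape i j (x : X i) : j != i + 0 -> castdeg j (f i x) = 0 :> Y j.
Proof. by rewrite addr0 eq_sym => ne; exact: castdeg_ne. Qed.

Definition chain_map_hom : hom X Y 0 := MkHom chain_map_hom_linear chain_map_hom_shape.

Lemma chain_map_hom_cycle j : hom_diff X Y 0 j chain_map_hom = 0.
Proof.
apply: hom_ext => i k x; rewrite /= /hom_diff_fun; case: eqP => // _ /=.
rewrite scale1r; have [e|ne] := eqVneq i (k + 1).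
  by subst i; rewrite addrK !castdeg_id cfun_comm subrr.
have ne' : i - 1 != k by rewrite subr_eq.
by rewrite (castdeg_ne _ ne) (castdeg_ne _ ne') linear0 subrr.
Qed.
End ChainMapHom.

Variable C : complex R.

Definition homothety_fun (i : int) : conc R^o i -> RHom C C i :=
  match i return conc R^o i -> RHom C C i with
  | Posz 0 => fun a => (a : R) *: chain_map_hom (res_map C)
  | _ => fun _ => 0
  end.

Lemma homothety_linear i : linear (@homothety_fun i).
Proof.
by case: i => [[|i]|i] a x y /=; rewrite ?scaler0 ?addr0 // scalerDl scalerA.
Qed.

Lemma homothety_comm i j x :
  cdiff (RHom C C) i j (mklin (@homothety_linear i) x) =
  mklin (@homothety_linear j) (cdiff (conc R^o) i j x).
Proof.
rewrite [cdiff (conc _) _ _ _]/= linear0.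
case: i x => [[|i]|i] x; [|exact: linear0..].
apply: etrans (linearZ_LR (hom_diff (res C) C 0 j) (x : R) _) _.
by rewrite chain_map_hom_cycle scaler0.
Qed.

(** [R -> RHom_R(C, C)], mapping [a] to [a] times the augmentation [res C -> C]. *)
Definition homothety : chain_map (conc R^o) (RHom C C) :=
  @ChainMap R (conc R^o) (RHom C C) (fun i => mklin (@homothety_linear i)) homothety_comm.

(** The derived category is the localization at the quasi-isomorphisms, so the
    homothety morphism is invertible there iff it is a quasi-isomorphism. *)
Definition semidualizing : Prop := hfinite C /\ quasi_iso homothety.
End Homothety.

Definition finite_flat_dim (R : comPzRingType) (M : lmodType R) : Prop :=
  exists (n : nat) (F : complex R) (e : chain_map F (conc M)),
    [/\ quasi_iso e,
        forall i, flat (F i)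
      & forall i, ~~ (0 <= i <= n%:Z) -> zero_module (F i)].

Section Ideals.
Variable R : comPzRingType.

Definition is_ideal (I : set R) : Prop :=
  I 0 /\ forall a x y, I x -> I y -> I (a * x + y).

Definition noetherian : Prop :=
  forall I : set R, is_ideal I -> exists s : seq R, forall x : R,
    I x <-> exists c : 'I_(size s) -> R, x = \sum_(i < size s) c i * s`_i.

Definition Spec : set (set R) :=
  [set P | [/\ is_ideal P, ~ P 1 & forall a b, P (a * b) -> P a \/ P b]].

Definition mSpec : set (set R) :=
  [set P | [/\ is_ideal P, ~ P 1 &
    forall J : set R, is_ideal J -> ~ J 1 -> P `<=` J -> J = P]].
End Ideals.
Arguments Spec R : clear implicits.
Arguments mSpec R : clear implicits.

Definition Spec_map (R S : comPzRingType) (phi : {rmorphism R -> S}) (Q : set S) :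
  set R := phi @^-1` Q.

(* Main.v *)
Require Import Defs.
From mathcomp Require Import all_boot all_order all_algebra.
From mathcomp Require Import boolp classical_sets constructive_ereal.
From mathcomp Require Import perm ring zify.

Set Implicit Arguments.
Unset Strict Implicit.
Unset Printing Implicit Defensive.

Import Order.TTheory GRing.Theory Num.Theory.
Local Open Scope classical_set_scope.
Local Open Scope ring_scope.

(** Let [P] be a bounded below resolution of [C] by finite projective modules, and let [X_N] be
    the fiber of the homothety map [R -> Hom(P_{<= N}, P)], again a bounded below complex of
    finite projective modules. If [P] is exact above degree [t], obstruction theory shows that
    [R -> Hom(P, P)] is a quasi-isomorphism iff, for each [n], [H_n(X_N) = 0] for large [N], and
    then [X_N] is exact in the degrees [>= t - N]. The complex of [P \otimes_R S] is
    [X_N \otimes_R S]. Ascent follows, because base change to a module of flat dimension [d]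
    moves the upper bound of exactness by at most [d].

    Descent takes place at a maximal ideal [m], the preimage of a prime [Q] of [S]. As the residue
    field of [R] at [m] is an [R]-summand of [S / Q], the unit [X -> X \otimes_R S] is split
    injective modulo [m]. Up to Koszul complexes on generators of [m], a map that vanishes in
    homology with coefficients in [R / m] is nilpotent in a uniform sense (devissage of the
    modules [R / I]). Applied to a map that is null-homotopic on a truncation, this bounds
    [C] below; applied to a tower of fibers of units, it shows that [X_m] is exact above degree
    [t + c] if [X \otimes_R S] is exact above [t], where [c] depends only on [m].

    The bounds for [P] at the various [m] are made uniform by a support argument. If [z] in
    [H_u(P)] has the prime annihilator [q], [H_j(P)_q = 0] for [j > u], and [i < u] is the lowest
    degree with [H_i(P)_q <> 0], a functional on [P_i] that is zero modulo [q] on boundaries but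
    not on cycles, multiplied by [z], extends to a class of degree [u - i > 0] in
    [H(Hom(P, P)_q)] that is not zero. This contradicts [H(Hom(P, P)) = R]. So the homology at
    [q] is concentrated in degree [u], hence so is the homology at each prime contained in [q],
    where it does not vanish; and there is a finite list of primes such that each prime contains
    one of them. The same argument over [S] gives [sup(C \otimes_R S) <= sup(C)]. *)

(** * Commutative algebra *)

(** The truncation makes base change possible: the modules of [Hom(P, P)] are infinite products, in
    general unbounded in both directions, while each degree of [X_N] involves finitely many degrees
    of [P].

    In descent the homology of [X \otimes_R S] is finite over [S], not over [R], so Nakayama's lemma
    over [S] says nothing about [X]. What is left is the [R]-linear splitting of residue fields,
    which sees [X] only modulo [m]. The devissage turns this into a statement on [X] itself, at the
    price of a nilpotency exponent [k]. The fiber of the unit is taken [k] times, each time losing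
    [n] degrees for a flat resolution of length [n], and the Koszul complex loses one degree per
    generator of [m]; this is [c = k * n + size xs]. Since [k] depends on [m] and there may be
    infinitely many [m], the supports are what gives one bound for [P].

    The target [X \otimes_R S] of the unit is neither free nor finite over [R]. It is replaced by a
    free resolution of infinite rank, so the towers carry [lfree] instead of finite projectivity. *)

Section AbelianGroupExpressions.
(** Syntax for reflection: both sides of an identity between module elements become integer
    combinations of common atoms, whose coefficients are compared by computation. *)
Inductive zexp := ZVar of nat | ZZero | ZAdd of zexp & zexp | ZOpp of zexp.
Variable V : zmodType.
Fixpoint zeval (s : seq V) (e : zexp) : V :=
  match e with
  | ZVar i => s`_i
  | ZZero => 0
  | ZAdd e e' => zeval s e + zeval s e'
  | ZOpp e => - zeval s e
  end.
Fixpoint zcoef (e : zexp) (k : nat) : int :=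
  match e with
  | ZVar i => (k == i)%:Z
  | ZZero => 0
  | ZAdd e e' => zcoef e k + zcoef e' k
  | ZOpp e => - zcoef e k
  end.
Lemma zevalE s e : zeval s e = \sum_(k < size s) s`_k *~ zcoef e k.
Proof.
elim: e => [i| |e IH e' IH'|e IH] /=.
- have [lt|ge] := ltnP i (size s); last first.
    rewrite nth_default // big1 // => k _.
    by rewrite (ltn_eqF (leq_trans (ltn_ord k) ge)).
  rewrite (bigD1 (Ordinal lt)) //= eqxx big1 ?addr0 // => k /negbTE ne.
  by rewrite -[nat_of_ord k == i]/(k == Ordinal lt) ne.
- by rewrite big1.
- by rewrite IH IH' -big_split /=; apply: eq_bigr => k _; rewrite mulrzDr.
- by rewrite IH -sumrN; apply: eq_bigr => k _; rewrite mulrNz.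
Qed.
Lemma zeval_eq s n e e' : size s = n -> all (fun k => zcoef e k == zcoef e' k) (iota 0 n) ->
  zeval s e = zeval s e'.
Proof.
move=> <- /allP => h; rewrite !zevalE; apply: eq_bigr => k _; congr (_ *~ _).
by apply/eqP/h; rewrite mem_iota /=.
Qed.
End AbelianGroupExpressions.

Ltac zindex x s :=
  match s with
  | x :: _ => constr:(O)
  | _ :: ?s' => let i := zindex x s' in constr:(S i)
  | ?y :: _ => let _ := match goal with _ => unify x y end in constr:(O)
  end.
Ltac zinsert x s :=
  match s with
  | _ => let _ := zindex x s in s
  | _ => constr:(x :: s)
  end.
Ltac zatoms e s :=
  lazymatch e with
  | ?a + ?b => let s' := zatoms a s in zatoms b s'
  | - ?a => zatoms a s
  | 0 => s
  | _ => zinsert e s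
  end.
Ltac zreify e s :=
  lazymatch e with
  | ?a + ?b => let a' := zreify a s in let b' := zreify b s in constr:(ZAdd a' b')
  | - ?a => let a' := zreify a s in constr:(ZOpp a')
  | 0 => constr:(ZZero)
  | _ => let i := zindex e s in constr:(ZVar i)
  end.
(** Decides equalities that hold in every abelian group. *)
Ltac zmodule :=
  lazymatch goal with
  | |- @eq ?T ?a ?b =>
    let s0 := constr:(@nil T) in
    let s1 := zatoms a s0 in let s := zatoms b s1 in
    let a' := zreify a s in let b' := zreify b s in
    apply: (@zeval_eq _ s _ a' b'); [reflexivity|vm_compute; reflexivity]
  end.

Section Submodules.
Variable R : comPzRingType.

Definition submod (M : lmodType R) (N : M -> Prop) : Prop :=
  N 0 /\ forall a x y, N x -> N y -> N (a *: x + y).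

Definition fgsub (M : lmodType R) (N : M -> Prop) : Prop :=
  exists (J : finType) (s : J -> M), (forall j, N (s j)) /\
    forall x, N x -> exists c : J -> R, x = \sum_j c j *: s j.

Definition noethmod (M : lmodType R) : Prop := forall N : M -> Prop, submod N -> fgsub N.

(** [M] has a finite dual basis, that is, [M] is finitely generated projective. *)
Definition fgp (M : lmodType R) : Prop :=
  exists (J : finType) (e : J -> M) (p : J -> {linear M -> R^o}),
    forall x, x = \sum_j (p j x : R) *: e j.

Section Closure.
Variables (M : lmodType R) (N : M -> Prop) (hN : submod N).
Lemma submod0 : N 0. Proof. by case: hN. Qed.
Lemma submodZ a x : N x -> N (a *: x).
Proof. by case: hN => h0 h Nx; rewrite -[_ *: _]addr0; exact: h. Qed.
Lemma submodD x y : N x -> N y -> N (x + y).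
Proof. by case: hN => h0 h Nx Ny; rewrite -[x]scale1r; exact: h. Qed.
Lemma submodN x : N x -> N (- x).
Proof. by rewrite -scaleN1r; exact: submodZ. Qed.
Lemma submodB x y : N x -> N y -> N (x - y).
Proof. by move=> Nx /submodN; exact: submodD. Qed.
Lemma submod_sum (J : Type) (r : seq J) (P : pred J) (F : J -> M) :
  (forall j, P j -> N (F j)) -> N (\sum_(j <- r | P j) F j).
Proof. by move=> h; apply: big_ind => //; [exact: submod0|exact: submodD]. Qed.
End Closure.

Lemma noeth_ideal (I : R -> Prop) : noetherian R -> is_ideal I -> fgsub (M := R^o) I.
Proof.
move=> hR hI; have [s hs] := hR _ hI.
exists 'I_(size s), (fun i : 'I_(size s) => s`_i : R^o); split=> [j|x /hs [c ->]]; last by exists c.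
apply/hs; exists (fun i => (i == j)%:R); rewrite (bigD1 j) //= eqxx mul1r big1 ?addr0 //.
by move=> i /negbTE ->; rewrite mul0r.
Qed.

(** Induction on the list of dual coordinates that may be nonzero on [N]. The values of one
    coordinate on [N] form a finitely generated ideal; lifts of its generators, together with
    generators of the kernel of that coordinate, generate [N]. *)
Lemma fgp_noeth (M : lmodType R) : noetherian R -> fgp M -> noethmod M.
Proof.
move=> hR [J [e [p hp]]] N hN.
have h x : (forall j, j \in enum J -> p j x = 0) -> x = 0.
  move=> h; rewrite [x]hp big1 // => j _; rewrite h ?mem_enum ?scale0r //.
move: (enum J) (fun x (_ : N x) => h x) => s {h}.
elim: s N hN => [|j s IH] N hN h.
  exists void, (of_void M); split=> [[]|x Nx].
  by exists (of_void R); rewrite [LHS]h // big1 //; case.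
have [|K [c [hc gc]]] := @noeth_ideal (fun a => exists2 x, N x & p j x = a) hR.
  split; first by exists 0; [exact: submod0|exact: linear0].
  move=> a _ _ [x Nx <-] [y Ny <-]; exists (a *: x + y); last by rewrite linearP.
  by case: hN => _; exact.
pose xs k := s2val (cid2 (hc k)); have Nxs k : N (xs k) by rewrite /xs; case: cid2.
have pxs k : p j (xs k) = c k by rewrite /xs; case: cid2.
have [||L [y [hy gy]]] := IH (fun x => N x /\ p j x = 0).
- split; first by split; [exact: submod0|exact: linear0].
  move=> a x y [Nx ex] [Ny ey]; split; first by case: hN => _; exact.
  by rewrite linearP ex ey scaler0 addr0.
- by move=> x [Nx ex] h'; apply: h => // k; rewrite inE => /predU1P[->//|]; exact: h'.
exists (K + L)%type, (fun kl => match kl with inl k => xs k | inr l => y l end); split.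
  by case=> [k|l] //; case: (hy l).
move=> x Nx; have [a ea] := gc _ (ex_intro2 _ _ x Nx erefl).
have [|b eb] := gy (x - \sum_k a k *: xs k).
  split; first by apply: submodB => //; apply: submod_sum => // k _; exact: submodZ.
  rewrite linearB linear_sum ea; apply/eqP; rewrite subr_eq0; apply/eqP.
  by apply: eq_bigr => k _; rewrite linearZ_LR pxs.
exists (fun kl => match kl with inl k => a k | inr l => b l end).
by rewrite big_sumType /= -eb addrC subrK.
Qed.

(** The empty set is adjoined to the family because [Zorn_bigcup] also takes the union of the empty
    chain. In the last hypothesis the union of a nonempty chain is already known to be a submodule,
    so only the other conditions of [F] are left to check. *)
Lemma submod_zorn (M : lmodType R) (F : set (set M)) :
  (forall N, F N -> submod N) -> (exists N, F N) ->
  (forall G, G `<=` F -> total_on G subset -> G !=set0 ->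
     submod (\bigcup_(X in G) X) -> F (\bigcup_(X in G) X)) ->
  exists N, F N /\ forall N', F N' -> N `<=` N' -> N' `<=` N.
Proof.
move=> hF [N0 FN0] hU.
have [G Gs Gt|A [PA mA]] := @Zorn_bigcup M [set A | A = set0 \/ F A].
  have [[A [GA FA]]|none] := pselect (exists A, G A /\ F A); last first.
    left; rewrite -subset0 => x [A GA Ax]; have [e|FA] := Gs _ GA; first by rewrite e in Ax.
    by apply: none; exists A.
  right; have -> : \bigcup_(X in G) X = \bigcup_(X in G `&` F) X.
    apply/seteqP; split=> x [B]; last by case=> GB _ Bx; exists B.
    by move=> GB Bx; exists B => //; split=> //; case: (Gs _ GB) => // e; rewrite e in Bx.
  apply: hU; [by move=> B []| |by exists A|].
    by move=> B C [GB _] [GC _]; exact: Gt.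
  split; first by exists A => //; exact: (submod0 (hF _ FA)).
  move=> a x y [B [GB FB] Bx] [C [GC FC] Cy]; have [BC|CB] := Gt _ _ GB GC.
    by exists C => //; case: (hF _ FC) => _; apply => //; exact: BC.
  by exists B => //; case: (hF _ FB) => _; apply => //; exact: CB.
have FA : F A.
  case: PA => // e; exfalso; apply: (mA N0); last by right.
  by rewrite e; split=> [x []|/(_ 0 (submod0 (hF _ FN0)))].
exists A; split=> // N' FN' AN' x N'x; apply: contrapT => nA.
by apply: (mA N'); [split=> // s; apply: nA; exact: s|right].
Qed.

(** The union of a chain is finitely generated, and its generators already lie in one member of the
    chain. *)
Lemma noeth_max (M : lmodType R) (F : set (set M)) : noethmod M ->
  (forall N, F N -> submod N) -> (exists N, F N) ->
  exists N, F N /\ forall N', F N' -> N `<=` N' -> N' `<=` N.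
Proof.
move=> hM hF nF; apply: submod_zorn => // G GF Gt [A GA] hU.
have [J [s [hs gs]]] := hM _ hU.
suff [B GB hB] : exists2 B, G B & forall j, j \in enum J -> B (s j).
  suff -> : \bigcup_(X in G) X = B by exact: GF.
  apply/seteqP; split=> [x /gs [c ->]|x Bx]; last by exists B.
  have sB := hF _ (GF _ GB).
  by apply: submod_sum => // j _; apply: submodZ => //; apply: hB; rewrite mem_enum.
elim: (enum J) => [|j e [B GB hB]]; first by exists A.
have [C GC Cj] := hs j; have [BC|CB] := Gt _ _ GB GC.
  by exists C => // k; rewrite inE => /predU1P[->//|/hB]; exact: BC.
by exists B => // k; rewrite inE => /predU1P[->|/hB//]; exact: CB.
Qed.

(** Cramer's rule modulo [B]: the relations are multiplied by the adjugate of [A]. *)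
Lemma det_kill (M : lmodType R) (B : M -> Prop) n (s : 'I_n -> M) (A : 'M[R]_n) :
  submod B -> (forall k, B (\sum_l A k l *: s l)) -> forall l, B (\det A *: s l).
Proof.
move=> hB h l.
have -> : \det A *: s l = \sum_k \adj A l k *: \sum_i A k i *: s i.
  transitivity (\sum_i (\adj A *m A) l i *: s i).
    rewrite mul_adj_mx (bigD1 l) //= mxE eqxx mulr1n big1 ?addr0 // => i ne.
    by rewrite mxE eq_sym (negbTE ne) scale0r.
  rewrite (eq_bigr (fun i => \sum_k (\adj A l k * A k i) *: s i)); last first.
    by move=> i _; rewrite mxE scaler_suml.
  rewrite exchange_big /=; apply: eq_bigr => k _; rewrite scaler_sumr.
  by apply: eq_bigr => i _; rewrite scalerA.
by apply: submod_sum => // k _; exact: submodZ.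
Qed.
End Submodules.

Section Ideals.
Variable R : comPzRingType.
Implicit Types I J m p : set R.

Lemma ideal_submod I : is_ideal I -> submod (M := R^o) I. Proof. by []. Qed.
Lemma idealZ I a x : is_ideal I -> I x -> I (a * x).
Proof. by move=> hI; exact: (submodZ (ideal_submod hI)). Qed.
Lemma idealD I x y : is_ideal I -> I x -> I y -> I (x + y).
Proof. by move=> hI; exact: (submodD (ideal_submod hI)). Qed.
Lemma idealB I x y : is_ideal I -> I x -> I y -> I (x - y).
Proof. by move=> hI; exact: (submodB (ideal_submod hI)). Qed.

Definition addI I (a : R) : set R := fun x => exists y c, I y /\ x = y + c * a.
Definition colonI I (a : R) : set R := fun x => I (a * x).

Lemma addI_ideal I a : is_ideal I -> is_ideal (addI I a).
Proof.
move=> hI; split; first by exists 0, 0; split; [case: hI|ring].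
move=> b _ _ [y [c [Iy ->]]] [y' [c' [Iy' ->]]].
by exists (b * y + y'), (b * c + c'); split; [case: hI => _; exact|ring].
Qed.
Lemma sub_addI I a : I `<=` addI I a.
Proof. by move=> x Ix; exists x, 0; split=> //; ring. Qed.
Lemma addI_gen I a : is_ideal I -> addI I a a.
Proof. by move=> hI; exists 0, 1; split; [case: hI|ring]. Qed.
Lemma colonI_ideal I a : is_ideal I -> is_ideal (colonI I a).
Proof.
move=> hI; split; first by rewrite /colonI mulr0; case: hI.
by move=> b x y Ix Iy; rewrite /colonI mulrDr mulrCA; case: hI => _; exact.
Qed.
Lemma sub_colonI I a : is_ideal I -> I `<=` colonI I a.
Proof. by move=> hI x; exact: idealZ. Qed.
Lemma zero_ideal : is_ideal ([set 0] : set R).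
Proof. by split=> // a x y -> ->; rewrite mulr0 addr0. Qed.

Lemma mSpec_prime m : mSpec R m -> Spec R m.
Proof.
case=> hm m1 mmax; split=> // a b mab; apply: contrapT => /not_orP [na nb].
have [[y [c [my e]]]|n1] := pselect (addI m a 1).
  apply: nb; rewrite -[b]mul1r e mulrDl -mulrA [y * b]mulrC.
  by apply: idealD => //; exact: idealZ.
by apply: na; rewrite -(mmax _ (addI_ideal a hm) n1 (@sub_addI _ a)); exact: addI_gen.
Qed.

Lemma mSpec_inv m c : mSpec R m -> ~ m c -> exists c', m (1 - c' * c).
Proof.
move=> [hm m1 mmax] nc; have [[y [c' [my e]]]|n1] := pselect (addI m c 1).
  by exists c'; rewrite e addrK.
by case: nc; rewrite -(mmax _ (addI_ideal c hm) n1 (@sub_addI _ c)); exact: addI_gen.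
Qed.

Hypothesis hR : noetherian R.

Lemma noeth_self : noethmod R^o.
Proof. by move=> N hN; exact: noeth_ideal. Qed.

Lemma ideal_ind (Pr : set R -> Prop) :
  (forall I, is_ideal I ->
     (forall J, is_ideal J -> I `<=` J -> ~ (J `<=` I) -> Pr J) -> Pr I) ->
  forall I, is_ideal I -> Pr I.
Proof.
move=> h I hI; apply: contrapT => nI.
have [||J [[hJ nJ] mJ]] := @noeth_max _ R^o [set I | is_ideal I /\ ~ Pr I] noeth_self.
- by move=> N [].
- by exists I.
apply: nJ; apply: h => // K hK JK nKJ; apply: contrapT => nK.
by apply: nKJ; apply: mJ.
Qed.

Lemma max_above I : is_ideal I -> ~ I 1 -> exists2 m, mSpec R m & I `<=` m.
Proof.
move=> hI n1.
have [||J [[hJ [nJ IJ]] mJ]] :=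
  @noeth_max _ R^o [set J | is_ideal J /\ ~ J 1 /\ I `<=` J] noeth_self.
- by move=> N [].
- by exists I; split=> //; split.
exists J => //; split=> // K hK nK JK; apply/seteqP; split=> //.
by apply: mJ => //; split=> //; split=> // x /IJ /JK.
Qed.

(** Noetherian induction on [R / I], ending with the residue field at [m]. *)
Lemma devissage (m : set R) (xs : seq R) (Pr : set R -> Prop) : mSpec R m ->
  (forall p, is_ideal p -> (forall x, x \in xs -> p x) -> m `<=` p) ->
  (forall I, is_ideal I -> I 1 -> Pr I) -> Pr m ->
  (forall I a, is_ideal I -> Pr (colonI I a) -> Pr (addI I a) -> Pr I) ->
  (forall p x, Spec R p -> x \in xs -> ~ p x -> Pr (addI p x) -> Pr p) ->
  forall I, is_ideal I -> Pr I.
Proof.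
move=> [hm m1 mmax] gen h1 Pm hext hprime; apply: ideal_ind => I hI IH.
have [I1|n1] := pselect (I 1); first exact: h1.
have [mI|nmI] := pselect (m `<=` I); first by rewrite (mmax I).
(* If [I] is not prime, [b] shows that [I : a] is strictly larger than [I], and [a] shows it for
   [I + R a]. *)
have [[a [b [Iab na nb]]]|pr] := pselect (exists a b, [/\ I (a * b), ~ I a & ~ I b]).
  apply: (hext I a) => //; apply: IH.
  - exact: colonI_ideal.
  - exact: sub_colonI.
  - by move/(_ b Iab).
  - exact: addI_ideal.
  - exact: sub_addI.
  - by move/(_ a (addI_gen a hI)).
have [[x xin nx]|all] := pselect (exists2 x, x \in xs & ~ I x); last first.
  case: nmI; apply: gen => // x xin; apply: contrapT => nx; apply: all; by exists x.
apply: (hprime I x) => //.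
  split=> // a b Iab; apply: contrapT => /not_orP [na nb]; apply: pr; by exists a, b.
apply: IH; [exact: addI_ideal|exact: sub_addI|].
by move/(_ x (addI_gen x hI)).
Qed.

(** Noetherian induction on [I]: if [a * b] is in [I], a prime above [I] lies above [I + R a] or
    [I + R b]; a proper ideal without such a pair of elements outside it is prime and is its own
    list. *)
Lemma finite_primes : exists ps : seq (set R), (forall p, List.In p ps -> Spec R p) /\
  forall q, Spec R q -> exists2 p, List.In p ps & p `<=` q.
Proof.
suff h : forall I, is_ideal I ->
    exists ps : seq (set R), (forall p, List.In p ps -> Spec R p) /\
      forall q, Spec R q -> I `<=` q -> exists2 p, List.In p ps & p `<=` q.
  have [ps [h1 h2]] := h _ zero_ideal; exists ps; split=> // q hq.
  by apply: h2 => // _ ->; case: hq => -[].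
apply: ideal_ind => I hI IH.
have [I1|n1] := pselect (I 1).
  by exists nil; split=> // q [_ n1 _] /(_ _ I1).
have [[a [b [Iab na nb]]]|pr] := pselect (exists a b, [/\ I (a * b), ~ I a & ~ I b]).
  have [||ps [hps cps]] := IH _ (addI_ideal a hI).
  - exact: sub_addI.
  - by move/(_ a (addI_gen a hI)).
  have [||qs [hqs cqs]] := IH _ (addI_ideal b hI).
  - exact: sub_addI.
  - by move/(_ b (addI_gen b hI)).
  exists (ps ++ qs); split=> [p /(@List.in_app_or _ _ _ _) [/hps|/hqs]//|q hq Iq].
  have add c : q c -> addI I c `<=` q.
    move=> qc _ [y [d [Iy ->]]]; case: hq => hq _ _.
    by apply: idealD => //; [exact: Iq|exact: idealZ].
  have [/add /cps|/add /cqs] := (let: And3 _ _ h := hq in h) _ _ (Iq _ Iab).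
    by case=> // p pin pq; exists p => //; apply: List.in_or_app; left.
  by case=> // p pin pq; exists p => //; apply: List.in_or_app; right.
exists [:: I]; split=> [p [<-|//]|q hq Iq]; last by exists I => //; left.
split=> // a b Iab; apply: contrapT => /not_orP [na nb]; apply: pr; by exists a, b.
Qed.
End Ideals.

(** * Coefficients in [R / I] and finite dual bases *)

Section IdealMultiples.
Variable R : comPzRingType.

(** Membership in [I M]. Coefficients in [R / I] are expressed by congruences modulo [I M], without
    forming the quotient. *)
Definition inI (I : set R) (M : lmodType R) (w : M) : Prop :=
  exists (J : finType) (c : J -> R) (v : J -> M),
    (forall j, I (c j)) /\ w = \sum_j c j *: v j.

Lemma inI_submod (I : set R) (M : lmodType R) : is_ideal I -> submod (@inI I M).
Proof.
move=> hI; split; first by exists void, (of_void R), (of_void M); split; [case|rewrite big1 //; case].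
move=> a _ _ [J [c [v [hc ->]]]] [K [d [w [hd ->]]]].
exists (J + K)%type, (fun jk => match jk with inl j => a * c j | inr k => d k end),
  (fun jk => match jk with inl j => v j | inr k => w k end); split.
  by case=> [j|k] //; exact: idealZ.
by rewrite big_sumType scaler_sumr /=; congr (_ + _); apply: eq_bigr => j _; rewrite scalerA.
Qed.

Lemma inIZ (I : set R) (M : lmodType R) c (v : M) : I c -> inI I (c *: v).
Proof.
move=> Ic; exists unit, (fun=> c), (fun=> v); split=> //.
by rewrite (big_pred1 tt) // => -[].
Qed.

Lemma inI_linear (I : set R) (M N : lmodType R) (f : {linear M -> N}) w : inI I w -> inI I (f w).
Proof.
move=> [J [c [v [hc ->]]]]; exists J, c, (fun j => f (v j)); split=> //.
by rewrite linear_sum; apply: eq_bigr => j _; rewrite linearZ_LR.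
Qed.

Lemma inI_sub (I I' : set R) (M : lmodType R) (w : M) : I `<=` I' -> inI I w -> inI I' w.
Proof. by move=> s [J [c [v [hc ->]]]]; exists J, c, v; split=> // j; exact: s. Qed.

Lemma inI1 (I : set R) (M : lmodType R) (w : M) : I 1 -> inI I w.
Proof. by move=> I1; rewrite -[w]scale1r; exact: inIZ. Qed.

Lemma inI_zero (M : lmodType R) (w : M) : inI [set 0] w -> w = 0.
Proof. by move=> [J [c [v [hc ->]]]]; rewrite big1 // => j _; rewrite hc scale0r. Qed.

Lemma inI_addI (I : set R) a (M : lmodType R) (w : M) :
  inI (addI I a) w -> exists w' v, inI I w' /\ w = w' + a *: v.
Proof.
move=> [J [c [v [hc ->]]]].
have hc' j : exists yd : R * R, I yd.1 /\ c j = yd.1 + yd.2 * a.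
  by have [y [d [Iy e]]] := hc j; exists (y, d).
pose y j := projT1 (cid (hc' j)).
have hy j : I (y j).1 /\ c j = (y j).1 + (y j).2 * a by rewrite /y; case: cid.
exists (\sum_j (y j).1 *: v j), (\sum_j (y j).2 *: v j); split.
  by exists J, (fun j => (y j).1), v; split=> // j; case: (hy j).
rewrite scaler_sumr -big_split /=; apply: eq_bigr => j _.
by case: (hy j) => _ ->; rewrite scalerDl scalerA [a * _]mulrC.
Qed.

Lemma inI_colonI (I : set R) a (M : lmodType R) (w : M) : inI (colonI I a) w -> inI I (a *: w).
Proof.
move=> [J [c [v [hc ->]]]]; exists J, (fun j => a * c j), v; split=> //.
by rewrite scaler_sumr; apply: eq_bigr => j _; rewrite scalerA.
Qed.

(** The consequence of flatness used in the devissage: for a flat module [M],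
    multiplication by [a] identifies [M / (I : a) M] with a submodule of [M / I M]. *)
Definition sep (M : lmodType R) : Prop := forall (I : set R) a (x : M), is_ideal I ->
  inI I (a *: x) -> inI (colonI I a) x.

(** A common dual basis for any finitely many elements. Free modules of any rank and finite
    projective modules both have it, and it passes to binary products, hence to fibers. *)
Definition lfree (M : lmodType R) : Prop := forall s : seq M,
  exists (J : finType) (e : J -> M) (p : J -> {linear M -> R^o}),
    forall x, x \in s -> x = \sum_j (p j x : R) *: e j.

Lemma fgp_lfree (M : lmodType R) : fgp M -> lfree M.
Proof. by move=> [J [e [p h]]] s; exists J, e, p => x _; exact: h. Qed.

(** Coordinatewise: [a * p j x = p j (a *: x)] lies in [I]. *)
Lemma lfree_sep (M : lmodType R) : lfree M -> sep M.
Proof.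
move=> hM I a x hI [K [c [v [hc eax]]]].
have [J [e [p hp]]] := hM [:: x]; rewrite [x]hp ?mem_head //.
apply: submod_sum => [|j _]; first exact/inI_submod/colonI_ideal.
apply: inIZ; rewrite /colonI.
have -> : a * p j x = p j (a *: x) by rewrite linearZ_LR.
rewrite eax linear_sum; apply: (submod_sum (ideal_submod hI)) => k _.
by rewrite linearZ_LR -[_ *: _]/(c k * (p j (v k) : R)) mulrC; exact: idealZ.
Qed.

(** The dual basis consists of the generators that occur in chosen terms representing the elements
    of [s]; classical equality on [G] makes their list a finite type. *)
Lemma lfree_free (G : Type) : lfree (Defs.free R G).
Proof.
pose tin := fix tin (t : term R G) : seq {classic G} := match t with
  | TGen g => [:: g : {classic G}] | TZero => [::] | TAdd t u => tin t ++ tin u | TScale _ t => tin t end.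
pose rep (x : Defs.free R G) : term R G := @prep R (term_premod (fun _ _ => False)) x.
move=> s; pose l := undup (flatten [seq tin (rep x) | x <- s]).
pose p (g : seq_sub l) : {linear Defs.free R G -> R^o} :=
  free_lift (N := R^o) (fun g' : G => ((g' : {classic G}) == val g)%:R).
have pE h g : p h (pgen _ g) = ((g : {classic G}) == val h)%:R by exact: pliftE.
move: p pE => p pE.
pose L (y : Defs.free R G) : Defs.free R G := \sum_(h : seq_sub l) (p h y : R) *: pgen _ (val h).
have LP a y z : L (a *: y + z) = a *: L y + L z.
  rewrite /L scaler_sumr -big_split; apply: eq_bigr => h _.
  by rewrite linearP scalerDl scalerA.
have gens g : g \in l -> pgen _ g = L (pgen _ g).
  move=> gl; rewrite /L (bigD1 (SeqSub gl)) // pE eqxx scale1r big1 => [|h ne]; first exact/esym/addr0.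
  rewrite pE; case: eqP => [e|_]; last by rewrite scale0r.
  by case/eqP: ne; apply: val_inj.
exists (seq_sub l), (fun g => pgen _ (val g)), p => x xs; rewrite -/(L x).
rewrite -(prepK x) -/(rep x); have : {subset tin (rep x) <= l}.
  by move=> g gin; rewrite mem_undup; apply/flattenP; exists (tin (rep x)) => //; exact: map_f.
have L0 : L 0 = 0 by have := LP (-1) 0 0; rewrite scaler0 addr0 scaleN1r addNr.
elim: (rep x) => [g| |t IHt u IHu|a t IHt] sub.
- by apply: gens; apply: sub; rewrite mem_head.
- by rewrite pcls0 L0.
- rewrite (pclsD (t : term_premod _) u) -[X in L (X + _)]scale1r LP scale1r -IHt -?IHu //.
    by move=> g gt; apply: sub; rewrite mem_cat gt orbT.
  by move=> g gt; apply: sub; rewrite mem_cat gt.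
- by rewrite (pclsZ a (t : term_premod _)) -[X in L X]addr0 LP L0 addr0 -IHt.
Qed.
End IdealMultiples.

Section ResidueSplitting.
Variables (R S : comPzRingType) (phi : {rmorphism R -> S}) (Q : set S).

(** The inclusion of the residue field of [R] at [phi^-1 Q] in [S / Q] splits over [R]. *)
Lemma residue_split : is_ideal Q -> ~ Q 1 -> mSpec R (Spec_map phi Q) ->
  exists W : set S, [/\ submod (M := restr S^o phi) W, Q `<=` W, ~ W 1
    & forall s, exists c, W (s - phi c)].
Proof.
move=> hQ n1 hm.
have hQ' : submod (M := restr S^o phi) Q.
  by split; [case: hQ|move=> a x y Qx Qy; case: hQ => _; exact].
have [||G GF Gt [A GA] hU|W [[hW QW W1] mW]] := @submod_zorn R (restr S^o phi)
  [set N | [/\ submod (M := restr S^o phi) N, Q `<=` (N : set S) & ~ (N : set S) 1]].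
- by move=> N [].
- by exists Q; split.
- split=> // [x Qx|[B /GF [_ _ nB]] //]; exists A => //; by have [_ + _] := GF _ GA; exact.
exists W; split=> // s; have [Ws|nWs] := pselect (W s); first by exists 0; rewrite rmorph0 subr0.
(* By maximality [W + R s] contains 1, say [1 = w + phi c * s]. Then [c] is not in [m], since
   otherwise 1 would lie in [W], and an inverse of [c] modulo [m] represents [s] modulo [W]. *)
pose W' : set (restr S^o phi) := fun x => exists w (c : R), W w /\ x = w + phi c * s.
have [[w [c [Ww e]]]|n1'] := pselect (W' 1); last first.
  case: nWs; apply: (mW W').
  - split=> //; last by move=> x /QW Wx; exists x, 0; rewrite rmorph0 mul0r addr0.
    split; first by exists 0, 0; rewrite rmorph0 mul0r addr0; split=> //; case: hW.
    move=> a _ _ [w [c [Ww ->]]] [w' [c' [Ww' ->]]].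
    exists (phi a * w + w'), (a * c + c'); split; first by case: hW => _; exact.
    by rewrite -[a *: _]/(phi a * _) rmorphD rmorphM; ring.
  - by move=> x Wx; exists x, 0; rewrite rmorph0 mul0r addr0.
  - by exists 0, 1; rewrite rmorph1 mul1r add0r; split=> //; case: hW.
have nc : ~ Spec_map phi Q c.
  move=> Qc; apply: W1; rewrite e; apply: (submodD hW) => //; apply: QW.
  by rewrite mulrC; exact: idealZ.
have [c' mc'] := mSpec_inv hm nc; exists c'.
have -> : s - phi c' = s * phi (1 - c' * c) - phi c' * w.
  have e' : phi c' = phi c' * (w + phi c * s) by rewrite -e mulr1.
  by rewrite rmorphB rmorph1 rmorphM {1}e'; ring.
apply: (submodB hW); first by apply: QW; exact: idealZ.
exact: (submodZ hW).
Qed.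
End ResidueSplitting.

(** * Complexes and fibers *)

Section Cycles.
Variable R : comPzRingType.
Implicit Types X Y : complex R.

(** Quantifying over all degrees is harmless, as differentials between nonadjacent degrees vanish,
    and it avoids casts between [i] and [i - 1 + 1]. *)
Definition cyc X i (x : X i) : Prop := forall j, cdiff X i j x = 0.
Definition bd X i (x : X i) : Prop := exists k y, cdiff X k i y = x.
Definition ex X i : Prop := forall x : X i, cyc x -> bd x.
(** Exactness of the localization at the multiplicative set [D]. *)
Definition exS (D : set R) X i : Prop :=
  forall x : X i, cyc x -> exists s, D s /\ bd (s *: x).

Lemma cyc_bd X i (x : X i) : bd x -> cyc x.
Proof. by move=> [k [y <-]] j; rewrite cdiffK. Qed.
Lemma bd_diff X i j (x : X i) : bd (cdiff X i j x). Proof. by exists i, x. Qed.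
Lemma cyc_diff X i j (x : X i) : cyc (cdiff X i j x). Proof. exact/cyc_bd/bd_diff. Qed.

Lemma bd_succ X i (x : X i) (k : int) : bd x -> k = i + 1 -> exists y : X k, cdiff X k i y = x.
Proof.
move=> [k' [y <-]] ek; have [ek'|ne] := eqVneq k' (i + 1).
  by move: y; rewrite ek' -ek => y; exists y.
by exists 0; rewrite linear0 cdiff_shape.
Qed.

Lemma cycP X i j (x : X i) : i = j + 1 -> cdiff X i j x = 0 -> cyc x.
Proof.
move=> ei dx k; have [ek|ne] := eqVneq i (k + 1); last exact: cdiff_shape.
by have -> : k = j by apply: (addIr 1); rewrite -ek.
Qed.

Lemma cyc_submod X i : submod (@cyc X i).
Proof.
split=> [j|a x y cx cy j]; first exact: linear0.
by rewrite linearP cx cy scaler0 addr0.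
Qed.

Lemma bd_submod X i : submod (@bd X i).
Proof.
split; first by exists i, 0; exact: linear0.
move=> a x y bx by'; have [x' <-] := bd_succ bx erefl; have [y' <-] := bd_succ by' erefl.
by exists (i + 1), (a *: x' + y'); rewrite linearP.
Qed.

Lemma cfun_cyc X Y (f : chain_map X Y) i (x : X i) : cyc x -> cyc (f i x).
Proof. by move=> cx j; rewrite cfun_comm cx linear0. Qed.
Lemma cfun_bd X Y (f : chain_map X Y) i (x : X i) : bd x -> bd (f i x).
Proof. by move=> [k [y <-]]; exists k, (f k y); rewrite cfun_comm. Qed.

Lemma degP (i : int) : exists j : int, i = j + 1. Proof. by exists (i - 1); rewrite subrK. Qed.

Lemma exS1 X i : exS [set 1] X i <-> ex X i.
Proof.
split=> h x cx; first by have [s [-> ]] := h x cx; rewrite scale1r.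
by exists 1; rewrite scale1r; split=> //; exact: h.
Qed.

Definition id_chain X : chain_map X X :=
  @ChainMap R X X (fun i => idfun) (fun i j x => erefl).

Lemma comp_chain_subproof X Y Z (g : chain_map Y Z) (f : chain_map X Y) i j x :
  cdiff Z i j ((g i \o f i) x) = (g j \o f j) (cdiff X i j x).
Proof. by rewrite /= !cfun_comm. Qed.
Definition comp_chain X Y Z (g : chain_map Y Z) (f : chain_map X Y) : chain_map X Z :=
  @ChainMap R X Z (fun i => g i \o f i) (comp_chain_subproof g f).

Lemma scale_chain_linear X (a : R) i : linear (fun x : X i => a *: x).
Proof. by move=> b x y; rewrite scalerDr !scalerA mulrC. Qed.
Lemma scale_chain_comm X (a : R) i j x :
  cdiff X i j (mklin (@scale_chain_linear X a i) x) =
  mklin (@scale_chain_linear X a j) (cdiff X i j x).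
Proof. exact: linearZ_LR. Qed.
Definition scale_chain X (a : R) : chain_map X X :=
  @ChainMap R X X (fun i => mklin (@scale_chain_linear X a i)) (@scale_chain_comm X a).
End Cycles.

Section Fiber.
Variables (R : comPzRingType) (X Y : complex R) (f : chain_map X Y).

(** The homotopy fiber, that is, the mapping cone shifted by one. The cast in the differential below
    is the identity when [i = j + 1] and zero otherwise. *)
Definition fib_mod (i : int) : lmodType R := (X i * Y (i + 1)%R)%type.
Definition fib_fun i j (z : fib_mod i) : fib_mod j :=
  (cdiff X i j z.1, castdeg (j + 1) (f i z.1) - cdiff Y (i + 1) (j + 1) z.2).

Lemma fib_linear i j : linear (@fib_fun i j).
Proof.
move=> a x y; rewrite /fib_fun; congr (_, _) => /=; first by rewrite linearP.
rewrite !linearP castdeg_linear.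
by rewrite addrACA -scalerDr.
Qed.
Definition fib_diff i j : {linear fib_mod i -> fib_mod j} := mklin (@fib_linear i j).

Lemma castdeg0 (Z : int -> lmodType R) i j : castdeg j (0 : Z i) = 0.
Proof.
by case: (eqVneq i j) => [e|ne]; [subst j; exact: castdeg_id|exact: castdeg_ne].
Qed.

Lemma fib_shape i j x : i != j + 1 -> fib_diff i j x = 0.
Proof.
move=> ne; rewrite /= /lin_fun /fib_fun cdiff_shape // castdeg_ne // cdiff_shape ?subr0 //.
by rewrite (inj_eq (addIr 1)).
Qed.

Lemma fib_diffK i j k x : fib_diff j k (fib_diff i j x) = 0.
Proof.
rewrite /= /lin_fun /fib_fun /=; congr (_, _); first exact: cdiffK.
have [ei|ne] := eqVneq i (j + 1); last first.
  rewrite [cdiff X i j _]cdiff_shape // linear0 castdeg0 castdeg_ne //.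
  by rewrite !sub0r [cdiff Y (i + 1) _ _]cdiff_shape ?(inj_eq (addIr 1)) // oppr0 linear0 oppr0.
subst i; rewrite castdeg_id linearB cdiffK subr0 -cfun_comm.
have [ej|ne] := eqVneq j (k + 1); last first.
  by rewrite castdeg_ne // cdiff_shape ?subr0 // (inj_eq (addIr 1)).
by subst j; rewrite castdeg_id subrr.
Qed.

Definition fib : complex R := @Complex R fib_mod fib_diff fib_shape fib_diffK.

Lemma fib_diffE j (z : fib (j + 1)) : cdiff fib (j + 1) j z =
  (cdiff X (j + 1) j z.1, f (j + 1) z.1 - cdiff Y (j + 1 + 1) (j + 1) z.2).
Proof. by rewrite /= /lin_fun /fib_fun castdeg_id. Qed.

Lemma fib_cycP i (z : fib i) : cyc z <-> cyc z.1 /\ f i z.1 = cdiff Y (i + 1) i z.2.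
Proof.
split=> [cz|[cx e]].
  split; first by move=> j; exact: (congr1 fst (cz j)).
  have [j ej] := degP i; subst i; have := congr1 snd (cz j); rewrite fib_diffE => /eqP.
  by rewrite subr_eq0 => /eqP.
have [j ej] := degP i; subst i; apply: (cycP erefl); rewrite fib_diffE cx e subrr //.
Qed.

Lemma fib_bdP i (z : fib i) :
  bd z <-> exists x : X (i + 1), z.1 = cdiff X (i + 1) i x /\ bd (f (i + 1) x - z.2).
Proof.
split=> [bz|].
  have [y <-] := bd_succ bz erefl; exists y.1; rewrite fib_diffE; split=> //=.
  by rewrite subKr; exact: bd_diff.
case: z => z1 z2 [x [/= -> b]]; have [y ey] := bd_succ b erefl.
exists (i + 1), (x, y); rewrite fib_diffE /= ey; congr (_, _).
by rewrite subKr.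
Qed.

Definition fib_fst : chain_map fib X :=
  @ChainMap R fib X (fun i => fst : {linear (X i * Y (i + 1)%R)%type -> X i}) (fun i j x => erefl).
End Fiber.

Section FiberMap.
Variables (R : comPzRingType) (X Y X' Y' : complex R).
Variables (f : chain_map X Y) (f' : chain_map X' Y') (g : chain_map X X') (h : chain_map Y Y').
Hypothesis fgh : forall i x, f' i (g i x) = h i (f i x).

Definition fib_map_fun i (z : fib f i) : fib f' i := (g i z.1, h (i + 1) z.2).
Lemma fib_map_linear i : linear (@fib_map_fun i).
Proof. by move=> a x y; rewrite /fib_map_fun !linearP. Qed.
Lemma fib_map_comm i j x : cdiff (fib f') i j (mklin (@fib_map_linear i) x) =
  mklin (@fib_map_linear j) (cdiff (fib f) i j x).
Proof.
have [e|ne] := eqVneq i (j + 1); last by rewrite !cdiff_shape // linear0.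
subst i; rewrite !fib_diffE /= /lin_fun /fib_map_fun /= cfun_comm linearB fgh.
by rewrite cfun_comm.
Qed.
Definition fib_map : chain_map (fib f) (fib f') :=
  @ChainMap R (fib f) (fib f') (fun i => mklin (@fib_map_linear i)) fib_map_comm.
End FiberMap.

Section DualBases.
Variable R : comPzRingType.

Definition prodfst (M N : lmodType R) : {linear (M * N)%type -> M} := fst.
Definition prodsnd (M N : lmodType R) : {linear (M * N)%type -> N} := snd.
Definition lcomp (M N P : lmodType R) (g : {linear N -> P}) (f : {linear M -> N}) :
  {linear M -> P} := g \o f.
Lemma inl_linear (M N : lmodType R) : linear (fun x : M => (x, 0) : (M * N)%type).
Proof. by move=> a x y; congr (_, _) => /=; rewrite scaler0 addr0. Qed.
Lemma inr_linear (M N : lmodType R) : linear (fun x : N => (0, x) : (M * N)%type).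
Proof. by move=> a x y; congr (_, _) => /=; rewrite scaler0 addr0. Qed.
Definition prodinl (M N : lmodType R) : {linear M -> (M * N)%type} := mklin (@inl_linear M N).
Definition prodinr (M N : lmodType R) : {linear N -> (M * N)%type} := mklin (@inr_linear M N).

Lemma prod_split (M N : lmodType R) (z : (M * N)%type) :
  z = prodinl M N (prodfst M N z) + prodinr M N (prodsnd M N z).
Proof. by case: z => x y; congr (_, _) => /=; rewrite ?addr0 ?add0r. Qed.

Lemma lfree_prod (M N : lmodType R) : lfree M -> lfree N -> lfree (M * N)%type.
Proof.
move=> hM hN s; have [J [e [p hp]]] := hM [seq z.1 | z <- s].
have [K [e' [q hq]]] := hN [seq z.2 | z <- s].
exists (J + K)%type,
  (fun jk => match jk with inl j => prodinl M N (e j) | inr k => prodinr M N (e' k) end),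
  (fun jk => match jk with inl j => lcomp (p j) (prodfst M N) | inr k => lcomp (q k) (prodsnd M N) end).
move=> z zs; rewrite big_sumType /= {1}[z]prod_split.
rewrite {1}[prodfst M N z]hp; last exact: map_f.
rewrite {1}[prodsnd M N z]hq; last exact: map_f.
by rewrite !linear_sum; congr (_ + _); apply: eq_bigr => j _; rewrite linearZ_LR.
Qed.

Lemma fgp_prod (M N : lmodType R) : fgp M -> fgp N -> fgp (M * N)%type.
Proof.
move=> [J [e [p hp]]] [K [e' [q hq]]].
exists (J + K)%type,
  (fun jk => match jk with inl j => prodinl M N (e j) | inr k => prodinr M N (e' k) end),
  (fun jk => match jk with inl j => lcomp (p j) (prodfst M N) | inr k => lcomp (q k) (prodsnd M N) end).
move=> z; rewrite big_sumType /= {1}[z]prod_split {1}[prodfst M N z]hp {1}[prodsnd M N z]hq.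
by rewrite !linear_sum; congr (_ + _); apply: eq_bigr => j _; rewrite linearZ_LR.
Qed.

Lemma ffun_eval_linear (J : finType) (M : lmodType R) j : linear (fun x : {ffun J -> M} => x j).
Proof. by move=> a x y; rewrite !ffunE. Qed.
Definition ffun_eval (J : finType) (M : lmodType R) j : {linear {ffun J -> M} -> M} :=
  mklin (@ffun_eval_linear J M j).

Lemma fgp_ffun (J : finType) : fgp {ffun J -> R^o}.
Proof.
exists J, (fun j => [ffun k => (j == k)%:R]), (@ffun_eval J R^o) => x.
apply/ffunP => k; rewrite sum_ffunE (bigD1 k) //= !ffunE eqxx big1 => [|j /negbTE ne].
  by rewrite addr0 -[_ *: _]/(x k * 1) mulr1.
by rewrite !ffunE ne -[_ *: _]/(_ * 0) mulr0.
Qed.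
End DualBases.

(** * Devissage of coefficients *)

Section Devissage.
Variables (R : comPzRingType) (hR : noetherian R) (m : set R) (xs : seq R).
Hypothesis hm : mSpec R m.
Hypothesis gen : forall p, is_ideal p -> (forall x, x \in xs -> p x) -> m `<=` p.

Definition nullhom (x : R) (X : complex R) : Prop :=
  exists h : forall i j, {linear X i -> X j}, forall (i i' k : int) (y : X i), i = i' + 1 -> k = i + 1 ->
    x *: y = cdiff X k i (h i k y) + h i' i (cdiff X i i' y).

Definition nice (X : complex R) : Prop :=
  (forall i, sep (X i)) /\ forall x, x \in xs -> nullhom x X.

(** [f] vanishes on [H_i] with coefficients in [R / I]. *)
Definition kills (I : set R) i (X Y : complex R) (f : chain_map X Y) : Prop :=
  forall w : X i, (forall j, inI I (cdiff X i j w)) -> exists k y, inI I (f i w - cdiff Y k i y).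

(** In degree [i] the map factors through [n] successive maps that vanish in homology with
    coefficients in [R / m]; the leg after them is arbitrary. *)
Fixpoint mchain i (n : nat) (X Y : complex R) (f : chain_map X Y) : Prop :=
  if n is n'.+1 then exists (Z : complex R) (g : chain_map X Z) (h : chain_map Z Y),
    [/\ kills m i g, nice Z, mchain i n' h & forall x, f i x = h i (g i x)]
  else True.

Lemma mchain_cat i a b X Y f : nice X -> @mchain i (a + b) X Y f ->
  exists (Z : complex R) (g : chain_map X Z) (h : chain_map Z Y),
    [/\ mchain i a g, nice Z, mchain i b h & forall x, f i x = h i (g i x)].
Proof.
elim: a X f => [|a IH] X f nX; first by exists X, (id_chain X), f.
move=> [Z [g [h [kg nZ hc e]]]]; have [Z' [g' [h' [c1 nZ' c2 e']]]] := IH _ h nZ hc.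
exists Z', (comp_chain g' g), h'; split=> // [|x]; first by exists Z, g, g'.
by rewrite e e'.
Qed.

(** The devissage proves, for each ideal [I], that some number [n] of maps suffices to kill homology
    with coefficients in [R / I]; the claim is the case [I = 0]. The number depends on [I], [m] and
    [xs], not on the complexes, the maps or the degree. *)
Lemma nilpotent_kills : exists n, forall i X Y (f : chain_map X Y), nice X -> nice Y ->
  mchain i n f -> forall x : X i, cyc x -> bd (f i x).
Proof.
have [||||n hn] := @devissage R hR m xs (fun I => exists n, forall i X Y (f : chain_map X Y),
  nice X -> nice Y -> mchain i n f -> kills I i f) hm gen _ _ _ _ [set 0] (@zero_ideal R).
- move=> I hI I1; exists 0%N => i X Y f _ _ _ w _; exists i, 0; exact: inI1.
- exists 1%N => i X Y f nX nY [Z [g [h [kg _ _ e]]]] w dw.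
  have [k [y hy]] := kg w dw; exists k, (h k y); rewrite e cfun_comm -linearB.
  exact: inI_linear.
(* The first [n2] maps make [w] a boundary up to [a *: v] modulo [I]. By [sep], [v] is a cycle
   modulo [I : a], and the other [n1] maps kill it. *)
- move=> I a hI [n1 h1] [n2 h2]; exists (n2 + n1)%N => i X Y f nX nY c w dw.
  have [Z [g [h [cg nZ ch e]]]] := mchain_cat nX c.
  have [|k [y hy]] := h2 _ _ _ _ nX nZ cg w.
    by move=> j; apply: inI_sub (dw j); exact: sub_addI.
  have [v' [v [Iv' ev]]] := inI_addI hy.
  have [|k' [y' hy']] := h1 _ _ _ _ nZ nY ch v.
    move=> j; apply: nZ.1 => //; rewrite -linearZ_LR.
    have -> : a *: v = g i w - cdiff Z k i y - v' by rewrite ev addrC addKr.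
    rewrite !linearB cdiffK subr0 cfun_comm.
    by apply: submodB; [exact: inI_submod|exact: inI_linear|exact: inI_linear].
  have [x' ex'] := bd_succ (bd_diff i (h k y)) erefl.
  have [y'' ey''] := bd_succ (bd_diff i y') erefl.
  exists (i + 1), (x' + a *: y''); rewrite linearD linearZ_LR ex' ey''.
  have -> : f i w - (cdiff Y k i (h k y) + a *: cdiff Y k' i y') =
      h i v' + a *: (h i v - cdiff Y k' i y').
    rewrite e cfun_comm opprD addrA -linearB ev linearD linearZ_LR scalerBr.
    by rewrite addrA.
  apply: submodD; [exact: inI_submod|exact: inI_linear|exact: inI_colonI].
(* No further map is used: [x] acts null-homotopically, so [x *: v] is a boundary up to [h (d v)],
   and [d v] is zero modulo [p] because [x *: d v] is and [x] is not in [p]. *)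
- move=> p x [hp p1 pr] xin nx [n hn]; exists n => i X Y f nX nY c w dw.
  have [|k [y hy]] := hn _ _ _ _ nX nY c w.
    by move=> j; apply: inI_sub (dw j); exact: sub_addI.
  have [v' [v [Iv' ev]]] := inI_addI hy.
  have [h hh] := nY.2 x xin.
  have [i' ei] := degP i; have := hh i i' (i + 1) v ei erefl.
  set u := h i (i + 1) v => exv.
  have [y' ey'] := bd_succ (bd_diff i y) erefl.
  exists (i + 1), (y' + u); rewrite linearD ey' opprD addrA ev exv addrA addrAC addrK.
  apply: submodD => //; first exact: inI_submod.
  apply: inI_linear; apply: (@inI_sub _ (colonI p x)).
    by move=> b /pr [].
  apply: nY.1 => //; rewrite -linearZ_LR.
  have -> : x *: v = f i w - cdiff Y k i y - v' by rewrite ev addrC addKr.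
  rewrite !linearB cdiffK subr0 cfun_comm.
  by apply: submodB; [exact: inI_submod|exact: inI_linear|exact: inI_linear].
exists n => i X Y f nX nY c x cx.
have [|k [y /inI_zero/eqP]] := hn _ _ _ _ nX nY c x.
  by move=> j; rewrite cx; exact: submod0 (inI_submod _ (@zero_ideal R)).
by rewrite subr_eq0 => /eqP ->; exact: bd_diff.
Qed.
End Devissage.

(** * Koszul complexes *)

Section Koszul.
Variable R : comPzRingType.
Implicit Types X Y : complex R.

(** The Koszul complex of [xs] with coefficients in [X], up to shift. *)
Fixpoint KK (xs : seq R) X : complex R :=
  if xs is x :: xs' then fib (scale_chain (KK xs' X) x) else X.

Definition scale_map X Y (f : chain_map X Y) (x : R) :
    chain_map (fib (scale_chain X x)) (fib (scale_chain Y x)) :=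
  @fib_map R X X Y Y (scale_chain X x) (scale_chain Y x) f f
    (fun i y => esym (linearZ_LR (f i) x y)).

Fixpoint KKmap (xs : seq R) X Y (f : chain_map X Y) : chain_map (KK xs X) (KK xs Y) :=
  if xs is x :: xs' then scale_map (KKmap xs' f) x else f.

Lemma KKmap_id xs X i x : KKmap xs (id_chain X) i x = x.
Proof.
elim: xs i x => [//|a xs IH] i [x y] /=.
by rewrite /lin_fun /fib_map_fun /= !IH.
Qed.

(** The homotopy is [(y, z) -> (z, 0)]. *)
Lemma nullhom_fib x X : nullhom x (fib (scale_chain X x)).
Proof.
have hl i j : linear (fun z : fib (scale_chain X x) i =>
    (castdeg j z.2, 0) : fib (scale_chain X x) j).
  move=> a y z; congr (_, _) => /=; last by rewrite scaler0 addr0.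
  by rewrite castdeg_linear.
exists (fun i j => mklin (hl i j)) => i i' k y ei ek; subst i k;
  rewrite fib_diffE /= /lin_fun /fib_fun /= !castdeg_id.
case: y => y1 y2; congr (_, _) => /=; first by rewrite subrKC.
by rewrite linear0 subr0 addr0.
Qed.

Lemma fib_nullhom x a X : nullhom x X -> nullhom x (fib (scale_chain X a)).
Proof.
move=> [h hh].
have hl i j : linear (fun z : fib (scale_chain X a) i =>
    (h i j z.1, - h (i + 1) (j + 1) z.2) : fib (scale_chain X a) j).
  move=> b y z; congr (_, _) => /=; first by rewrite linearP.
  by rewrite linearP opprD scalerN.
exists (fun i j => mklin (hl i j)) => i i' k y ei ek; subst i k;
  rewrite fib_diffE /= /lin_fun /fib_fun /= castdeg_id.
case: y => y1 y2; congr (_, _) => /=; first exact: hh.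
rewrite (hh _ (i' + 1) (i' + 1 + 1 + 1) y2) // linearB linearZ_LR linearN opprK.
by rewrite /lin_fun; zmodule.
Qed.

Lemma KK_nullhom xs X x : x \in xs -> nullhom x (KK xs X).
Proof.
elim: xs => [//|a xs IH] /=; rewrite inE => /predU1P[->|/IH]; first exact: nullhom_fib.
exact: fib_nullhom.
Qed.

Lemma KK_lfree xs X : (forall i, lfree (X i)) -> forall i, lfree (KK xs X i).
Proof. by move=> h; elim: xs => [//|x xs IH] i; exact: lfree_prod. Qed.

Lemma KK_nice xs X : (forall i, lfree (X i)) -> nice xs (KK xs X).
Proof.
by move=> h; split=> [i|x]; [exact/lfree_sep/KK_lfree|exact: KK_nullhom].
Qed.

(** As [x] is in [m], modulo [m] the fiber is the direct sum of [X] and a shift of [X]; hence the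
    conditions in the degrees [i] and [i + 1]. *)
Lemma fib_kills (m : set R) x i X Y (f : chain_map X Y) : is_ideal m -> m x ->
  kills m i f -> kills m (i + 1) f -> kills m i (scale_map f x).
Proof.
move=> hm mx k0 k1 [w1 w2] dw; have sm M := @inI_submod R m M hm.
have [|k [y hy]] := k0 w1; first by move=> j; exact: (inI_linear (prodfst _ _) (dw j)).
have dw2 : forall j, inI m (cdiff X (i + 1) j w2).
  move=> j; have [e|ne] := eqVneq i j; last first.
    by rewrite cdiff_shape ?(inj_eq (addIr 1)) //; exact: submod0.
  subst j; have [j ej] := degP i; subst i; have := inI_linear (prodsnd _ _) (dw j).
  rewrite fib_diffE /= /lin_fun => h.
  rewrite -[cdiff _ _ _ _]opprK -[X in - X](addKr (x *: w1)) opprD opprK.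
  by apply: submodB => //; exact: inIZ.
have [k' [y' hy']] := k1 w2 dw2.
have [v ev] := bd_succ (bd_diff i y) erefl.
have [v' ev'] := bd_succ (bd_diff (i + 1) y') erefl.
exists (i + 1), (v, - v'); rewrite fib_diffE /= /lin_fun /fib_map_fun /= linearN opprK ev ev'.
rewrite [X in inI m X](_ : _ = prodinl _ _ (f i w1 - cdiff Y k i y) +
  prodinr _ _ ((f (i + 1) w2 - cdiff Y k' (i + 1) y') - x *: v)); last first.
  by congr (_, _) => /=; rewrite ?addr0 ?add0r // opprD [- (x *: v) - _]addrC addrA.
apply: submodD => //; apply: inI_linear => //; apply: submodB => //; exact: inIZ.
Qed.

Lemma KK_kills (m : set R) xs X Y (f : chain_map X Y) : is_ideal m ->
  (forall x, x \in xs -> m x) -> forall i : int, (forall j : int, j <= i + (size xs)%:Z -> kills m j f) ->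
  kills m i (KKmap xs f).
Proof.
move=> hm; elim: xs => [_ i h|x xs IH mxs i h]; first by apply: h; rewrite addr0.
have mxs' y : y \in xs -> m y by move=> yin; apply: mxs; rewrite inE yin orbT.
apply: fib_kills => //; first by apply: mxs; rewrite mem_head.
  by apply: IH => // j hj; apply: h; apply: le_trans hj _; rewrite lerD2l lez_nat leqnSn.
by apply: IH => // j hj; apply: h; rewrite -addrA -PoszD add1n in hj.
Qed.

(** Acyclicity of the kernel of a surjection, in degree [i - 1]. *)
Definition lifts i X Y (f : chain_map X Y) : Prop :=
  forall (i' : int) (z : Y i) (w : X i'), i = i' + 1 -> cyc w -> f i' w = cdiff Y i i' z ->
  exists z', f i z' = z /\ cdiff X i i' z' = w.

Lemma fib_lifts x i X Y (f : chain_map X Y) : lifts i f -> lifts (i + 1) f ->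
  lifts i (scale_map f x).
Proof.
move=> l0 l1 i' [z1 z2] [w1 w2] ei cw; subst i; rewrite fib_diffE /= /lin_fun => e.
have e1 : f i' w1 = cdiff Y (i' + 1) i' z1 := congr1 fst e.
have e2 : f (i' + 1) w2 = x *: z1 - cdiff Y (i' + 1 + 1) (i' + 1) z2 := congr1 snd e.
have [cw1 /= xw1] := (fib_cycP _).1 cw; rewrite /lin_fun in xw1.
have [y1 [fy1 dy1]] := l0 _ _ _ erefl cw1 e1.
have [||y2 [fy2 dy2]] := l1 (i' + 1) z2 (x *: y1 - w2) erefl.
- by apply: (cycP erefl); rewrite linearB linearZ_LR dy1 -xw1 subrr.
- by rewrite linearB linearZ_LR fy1 e2 subKr.
exists (y1, y2); split; first by rewrite /= /lin_fun /fib_map_fun /= fy1 fy2.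
by rewrite [LHS]fib_diffE /= /lin_fun dy1 dy2 subKr.
Qed.

Lemma KK_lifts xs X Y (f : chain_map X Y) t : (forall i : int, t < i -> lifts i f) ->
  forall i : int, t < i -> lifts i (KKmap xs f).
Proof.
move=> h; elim: xs => [//|x xs IH] i hi; apply: fib_lifts; apply: IH => //; lia.
Qed.

(** The kernel of [fib f -> X] is [Y] shifted by one. *)
Lemma fib_fst_lifts X Y (f : chain_map X Y) i : ex Y i -> lifts i (fib_fst f).
Proof.
move=> hY i' z [w1 w2] ei cw /= e; subst i w1.
have [_ /= e] := (fib_cycP _).1 cw.
have [|y ey] := bd_succ (hY (f (i' + 1) z - w2) _) erefl.
  by apply: (cycP erefl); rewrite linearB -e cfun_comm subrr.
by exists (z, y); split=> //; rewrite [LHS]fib_diffE /= ey subKr.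
Qed.

Lemma lifts_comp X Y Z i (f : chain_map X Y) (g : chain_map Y Z) :
  (forall i', i = i' + 1 -> lifts i g /\ lifts i f) -> lifts i (comp_chain g f).
Proof.
move=> h i' z w ei cw e; have [lg lf] := h i' ei.
have [y [gy dy]] := lg _ _ _ ei (cfun_cyc f cw) e.
have [x [fx dx]] := lf _ _ _ ei cw (esym dy).
by exists x; rewrite /= fx.
Qed.
End Koszul.

(** * Finite homology and Nakayama's lemma for Koszul complexes *)

Section Nakayama.
Variable R : comPzRingType.
Implicit Types X Y : complex R.

Definition hfg X i : Prop := exists n (s : 'I_n -> X i), (forall j, cyc (s j)) /\
  forall x, cyc x -> exists c : 'I_n -> R, bd (x - \sum_j c j *: s j).

Lemma fgsub_ord (M : lmodType R) (N : M -> Prop) : fgsub N ->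
  exists n (s : 'I_n -> M), (forall j, N (s j)) /\
    forall x, N x -> exists c : 'I_n -> R, x = \sum_j c j *: s j.
Proof.
move=> [J [s [hs gs]]]; exists #|J|, (fun i => s (enum_val i)); split=> [j|x /gs [c ->]] //.
exists (fun i => c (enum_val i)).
by rewrite (reindex (fun i : 'I_#|J| => enum_val i)) //=; apply: onW_bij; exact: enum_val_bij.
Qed.

Lemma fgp_hfg X i : noetherian R -> fgp (X i) -> hfg X i.
Proof.
move=> hR hX; have [n [s [hs gs]]] := fgsub_ord (fgp_noeth hR hX (@cyc_submod R X i)).
exists n, s; split=> // x /gs [c ->]; exists c; rewrite subrr; exact: submod0 (bd_submod _ _).
Qed.

(** Homology of the fiber is generated by the kernel of [x] on [H_i(X)] and by [H_(i+1)(X)]. The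
    kernel is reached through the combinations [c] of the generators [s] whose multiple by [x] is a
    boundary: they form a submodule of a free module of finite rank. *)
Lemma fib_hfg (hR : noetherian R) x X i : hfg X i -> hfg X (i + 1) ->
  hfg (fib (scale_chain X x)) i.
Proof.
move=> [n [s [hs gs]]] [n' [t [ht gt]]].
have hb := bd_submod X i.
pose lc (c : {ffun 'I_n -> R^o}) := \sum_j (c j : R) *: s j.
have lcP a c d : lc (a *: c + d) = a *: lc c + lc d.
  rewrite /lc scaler_sumr -big_split /=; apply: eq_bigr => j _.
  by rewrite !ffunE scalerDl scalerA.
have [|r [c [hc gc]]] := @fgsub_ord {ffun 'I_n -> R^o} (fun c => bd (x *: lc c)).
  have hN := fgp_noeth hR (fgp_ffun R 'I_n); apply: hN; split.
    by rewrite /lc big1 ?scaler0 => [|j _]; [exact: submod0|rewrite ffunE scale0r].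
  by move=> a c d bc bd'; rewrite lcP scalerDr scalerA mulrC -scalerA; exact: hb.2.
have hy k : exists y : X (i + 1), cdiff X (i + 1) i y = x *: lc (c k).
  by have [y ey] := bd_succ (hc k) erefl; exists y.
pose y k := projT1 (cid (hy k)); have ey k : cdiff X (i + 1) i (y k) = x *: lc (c k).
  by rewrite /y; case: cid.
have clc d : cyc (lc d).
  by apply: submod_sum => [|j _]; [exact: cyc_submod|apply: (submodZ (@cyc_submod R X i)); exact: hs].
exists (r + n')%N, (fun j => match split j with inl k => (lc (c k), y k) | inr l => (0, t l) end).
split=> [j|[z1 z2] cz].
  case: split => k; apply/fib_cycP; split=> //=.
  - exact: submod0 (cyc_submod _ _).
  - by rewrite /lin_fun scaler0 ht.
have [/= cz1 xz1] := (fib_cycP _).1 cz; rewrite /lin_fun in xz1.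
have [a ba] := gs z1 cz1; pose a' := [ffun j => a j] : {ffun 'I_n -> R^o}.
have ela : lc a' = \sum_j a j *: s j by apply: eq_bigr => j _; rewrite ffunE.
have [w ew] := bd_succ ba erefl; rewrite -ela in ew.
have [e ee] : exists e : 'I_r -> R, a' = \sum_k e k *: c k.
  apply: gc; have -> : x *: lc a' = cdiff X (i + 1) i (z2 - x *: w).
    by rewrite linearB linearZ_LR ew -xz1 scalerBr subKr.
  exact: bd_diff.
have lce : lc a' = \sum_k e k *: lc (c k).
  rewrite ee; pose L : {linear {ffun 'I_n -> R^o} -> X i} := mklin lcP.
  by rewrite -[lc _]/(L _) linear_sum; apply: eq_bigr => k _; rewrite linearZ_LR.
(* What is left in [X (i + 1)]: [y k] belongs to the lifted generators, and [x *: w] compensates for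
   replacing [z1] by the homologous [lc a']. *)
have [|f bf] := gt (z2 - \sum_k e k *: y k - x *: w).
  apply: (cycP erefl); rewrite !linearB -xz1 linear_sum /=.
  rewrite [X in _ - X - _](_ : _ = x *: lc a'); last first.
    rewrite lce scaler_sumr; apply: eq_bigr => k _.
    by rewrite linearZ_LR ey !scalerA mulrC.
  by rewrite [cdiff _ _ _ (x *: w)]linearZ_LR ew -!scalerBr subrr scaler0.
exists (fun j => match split j with inl k => e k | inr l => f l end).
have sumE (I : finType) (F : I -> (X i * X (i + 1)%R)%type) :
    \sum_j F j = (\sum_j (F j).1, \sum_j (F j).2).
  rewrite [LHS]surjective_pairing; congr (_, _).
    exact: (linear_sum (prodfst (X i) (X (i + 1)))).
  exact: (linear_sum (prodsnd (X i) (X (i + 1)))).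
rewrite [X in bd (_ - X)](_ : _ = (lc a', \sum_k e k *: y k + \sum_l f l *: t l)); last first.
  pose F (j : 'I_(r + n')) : (X i * X (i + 1)%R)%type :=
    (match split j with inl k => e k | inr l => f l end) *:
    (match split j with inl k => (lc (c k), y k) | inr l => (0, t l) end).
  transitivity (\sum_(k < r) F (lshift n' k) + \sum_(l < n') F (rshift r l)).
    exact: big_split_ord.
  have e1 : \sum_(k < r) F (lshift n' k) = (lc a', \sum_k e k *: y k).
    rewrite lce (eq_bigr (fun k => e k *: (lc (c k), y k))) => [|k _]; first exact: sumE.
    by rewrite /F (unsplitK (inl k)).
  have e2 : \sum_(l < n') F (rshift r l) = (0, \sum_l f l *: t l).
    rewrite (eq_bigr (fun k => f k *: ((0, t k) : X i * X (i + 1)%R)%type)) => [|k _].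
      by rewrite sumE /= big1 // => l _; rewrite scaler0.
    by rewrite /F (unsplitK (inr k)).
  by apply: etrans (f_equal2 +%R e1 e2) _; congr (_, _); rewrite /= addr0.
apply/fib_bdP => /=; exists w; split; first by rewrite ew.
have -> : scale_chain X x (i + 1) w - (z2 - (\sum_k e k *: y k + \sum_l f l *: t l)) =
    - (z2 - \sum_k e k *: y k - x *: w - \sum_l f l *: t l).
  rewrite /= /lin_fun; zmodule.
exact: submodN (bd_submod _ _) _ bf.
Qed.

(** Modulo [q] only the identity permutation contributes to the determinant. *)
Lemma det_notin n (q : set R) (A : 'M[R]_n) : Spec R q ->
  (forall k, ~ q (A k k)) -> (forall k l, k != l -> q (A k l)) -> ~ q (\det A).
Proof.
move=> [hq q1 qpr] dg off; rewrite /determinant (bigD1 (1%g : 'S_n)) //= => qd.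
have : q (\prod_i A i i).
  rewrite odd_perm1 expr0 mul1r in qd; under eq_bigr do rewrite -[X in A _ X]perm1.
  rewrite -[X in q X](addrK (\sum_(s : 'S_n | s != 1%g :> 'S_n) (-1) ^+ s * \prod_i A i (s i))).
  apply: idealB => //; apply: (submod_sum (ideal_submod hq)) => s ns; apply: idealZ => //.
  have [i ni] : exists i, i != s i.
    apply/existsP; rewrite -negb_forall; apply: contra ns => /forallP h.
    by apply/eqP/permP => i; rewrite perm1; apply/esym/eqP.
  by rewrite (bigD1 i) //= mulrC; apply: idealZ => //; exact: off.
by apply: (big_ind (fun x => ~ q x)) => // x y nx ny /qpr [].
Qed.

(** [H_(i+1)(X) / x] embeds in the homology of the fiber, so at [q] every generator is a multiple of
    [x]: [f *: s k] is homologous to [x] times a combination of the [s j], with [f] outside [q]. The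
    determinant of this system is outside [q] and kills [H_(i+1)(X)]. *)
Lemma fib_nakayama (q : set R) x X i : Spec R q -> q x -> hfg X (i + 1) ->
  exS (~` q) (fib (scale_chain X x)) i -> exS (~` q) X (i + 1).
Proof.
move=> hq qx [n [s [hs gs]]] hK; have hb := bd_submod X (i + 1).
have [qi q1 qpr] := hq.
have key (y : X (i + 1)) : cyc y -> exists f (w : X (i + 1)), ~ q f /\ cyc w /\ bd (f *: y - x *: w).
  move=> cy; have [|f [nf /fib_bdP /= [w [e b]]]] := hK (0, y).
    apply/fib_cycP; split=> /=; first exact: submod0 (cyc_submod _ _).
    by rewrite /lin_fun cy scaler0.
  exists f, w; split=> //; split; first by apply: (cycP erefl); rewrite -e scaler0.
  by rewrite -opprB; exact: submodN b.
have key' k : exists fc : R * ('I_n -> R), ~ q fc.1 /\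
    bd (fc.1 *: s k - x *: \sum_j fc.2 j *: s j).
  have [f [w [nf [cw b]]]] := key _ (hs k); have [c bc] := gs w cw.
  exists (f, c); split=> //=.
  rewrite -[f *: _](subrK (x *: w)) -addrA -scalerBr.
  by apply: (submodD hb) => //; exact: submodZ.
pose fc k := projT1 (cid (key' k)).
have hfc k : ~ q (fc k).1 /\ bd ((fc k).1 *: s k - x *: \sum_j (fc k).2 j *: s j).
  by rewrite /fc; case: cid.
pose A : 'M[R]_n := \matrix_(k, l) ((fc k).1 *+ (k == l) - x * (fc k).2 l).
have hd l : bd (\det A *: s l).
  apply: det_kill => // k; have [_] := hfc k.
  rewrite scaler_sumr [X in bd X -> _](_ : _ = \sum_l A k l *: s l) //.
  under [RHS]eq_bigr => j _ do rewrite mxE scalerBl -scalerA.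
  rewrite sumrB; congr (_ - _); rewrite (bigD1 k) //= eqxx big1 ?addr0 // => j ne.
  by rewrite eq_sym (negbTE ne) scale0r.
move=> x0 cx0; exists (\det A); split; last first.
  have [c bc] := gs x0 cx0; rewrite -[x0](subrK (\sum_j c j *: s j)) scalerDr.
  apply: (submodD hb); first exact: submodZ.
  rewrite scaler_sumr; apply: submod_sum => // j _.
  by rewrite scalerA mulrC -scalerA; exact: submodZ.
apply: det_notin => // [k|k l ne]; rewrite mxE.
  rewrite eqxx mulr1n => h; case: (hfc k) => + _; apply.
  rewrite -[(fc k).1](subrK (x * (fc k).2 k)); apply: idealD => //.
  by rewrite mulrC; exact: idealZ.
by rewrite (negbTE ne) mulr0n sub0r -mulrN mulrC; exact: idealZ.
Qed.

Lemma KK_hfg (hR : noetherian R) xs X : (forall i, hfg X i) -> forall i, hfg (KK xs X) i.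
Proof. by move=> h; elim: xs => [//|x xs IH] i; exact: fib_hfg. Qed.

Lemma KK_nakayama (hR : noetherian R) (q : set R) xs X : Spec R q ->
  (forall x, x \in xs -> q x) -> (forall i, hfg X i) ->
  forall i, ex (KK xs X) i -> exS (~` q) X (i + (size xs)%:Z).
Proof.
move=> hq qxs hX i hi; have : exS (~` q) (KK xs X) i.
  move=> x cx; exists 1; rewrite scale1r; split; last exact: hi.
  by case: hq.
move: i {hi}; elim: xs qxs => [|x xs IH] qxs i; first by rewrite addr0.
move/(fib_nakayama hq (qxs x (mem_head _ _)) (KK_hfg hR xs hX (i + 1))).
move/IH => h; rewrite -[(size _)%:Z]/(1 + size xs)%:Z PoszD addrA.
by apply: h => y yin; apply: qxs; rewrite inE yin orbT.
Qed.
End Nakayama.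

(** * Tensor products *)

Section QuotientModules.
Variables (R : comPzRingType) (M : lmodType R) (N : M -> Prop) (hN : submod N).

Definition quo_premod : premod R.
Proof.
refine (@PreMod R M (fun x y => N (x - y)) 0 +%R *:%R _ _ _ _ _ _ _ _ _ _ _ _ _).
- by move=> x; rewrite subrr; exact: submod0 hN.
- by move=> x y h; rewrite -opprB; exact: submodN hN _ h.
- by move=> x y z h h'; rewrite -(subrKA y); exact: submodD hN _ _ h h'.
- by move=> x x' y y' h h'; rewrite opprD addrACA; exact: submodD hN _ _ h h'.
- by move=> a x x' h; rewrite -scalerBr; exact: submodZ hN _ _ h.
- by move=> x y z; rewrite addrA subrr; exact: submod0 hN.
- by move=> x y; rewrite [y + x]addrC subrr; exact: submod0 hN.
- by move=> x; rewrite add0r subrr; exact: submod0 hN.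
- by move=> x; rewrite scaleN1r addNr subrr; exact: submod0 hN.
- by move=> a b x; rewrite scalerA subrr; exact: submod0 hN.
- by move=> x; rewrite scale1r subrr; exact: submod0 hN.
- by move=> a x y; rewrite scalerDr subrr; exact: submod0 hN.
- by move=> x a b; rewrite scalerDl subrr; exact: submod0 hN.
Defined.

Definition quo : lmodType R := pquot quo_premod.
Definition qcls_fun (x : M) : quo := @pcls R quo_premod x.
Lemma qcls_linear : linear qcls_fun.
Proof. by move=> a x y; rewrite /qcls_fun -pclsZ -pclsD. Qed.
Definition qcls : {linear M -> quo} := mklin qcls_linear.
Lemma qclsP x y : qcls x = qcls y <-> N (x - y). Proof. exact: pclsP. Qed.
Lemma qcls0 x : qcls x = 0 <-> N x.
Proof. by have := qclsP x 0; rewrite subr0 linear0. Qed.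
Lemma qcls_surj c : exists x, qcls x = c. Proof. by exists (prep c); exact: prepK. Qed.

Section Lift.
Variables (A : lmodType R) (f : {linear M -> A}) (hf : forall x, N x -> f x = 0).
Definition qlift_fun (c : quo) : A := f (prep c).
Lemma qlift_cls x : qlift_fun (qcls x) = f x.
Proof.
apply/eqP; rewrite -subr_eq0 -linearB; apply/eqP/hf; exact: (@peq_prep R quo_premod x).
Qed.
Lemma qlift_linear : linear qlift_fun.
Proof.
move=> a x y; have [x' <-] := qcls_surj x; have [y' <-] := qcls_surj y.
by rewrite -linearP !qlift_cls linearP.
Qed.
Definition qlift : {linear quo -> A} := mklin qlift_linear.
Lemma qliftE x : qlift (qcls x) = f x. Proof. exact: qlift_cls. Qed.
End Lift.
End QuotientModules.

Section TensorBasics.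
Variables (R S : comPzRingType) (phi : {rmorphism R -> S}).

Lemma tmkDl (M : lmodType R) (N : lmodType S) x y (n : N) :
  tmk phi (x + y : M) n = tmk phi x n + tmk phi y n.
Proof. by rewrite -[x in LHS]scale1r tmkPl rmorph1 scale1r. Qed.
Lemma tmkDr (M : lmodType R) (N : lmodType S) (x : M) (n p : N) :
  tmk phi x (n + p) = tmk phi x n + tmk phi x p.
Proof. by rewrite -[n in LHS]scale1r tmkPr scale1r. Qed.
Lemma tmk0r (M : lmodType R) (N : lmodType S) (x : M) : tmk phi x (0 : N) = 0.
Proof. by apply: (addrI (tmk phi x 0)); rewrite -tmkDr !addr0. Qed.
Lemma tmkZl (M : lmodType R) (N : lmodType S) a (x : M) (n : N) :
  tmk phi (a *: x) n = phi a *: tmk phi x n.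
Proof. by rewrite -[_ *: x]addr0 tmkPl tmk0l addr0. Qed.
Lemma tmkZr (M : lmodType R) (N : lmodType S) b (x : M) (n : N) :
  tmk phi x (b *: n) = b *: tmk phi x n.
Proof. by rewrite -[_ *: n]addr0 tmkPr tmk0r addr0. Qed.
Lemma tmk_suml (M : lmodType R) (N : lmodType S) (J : Type) (r : seq J) (F : J -> M) (n : N) :
  tmk phi (\sum_(j <- r) F j) n = \sum_(j <- r) tmk phi (F j) n.
Proof. by elim/big_rec2: _ => [|j y x _ <-]; [exact: tmk0l|exact: tmkDl]. Qed.

Lemma tens_ind (M : lmodType R) (N : lmodType S) (P : tens phi M N -> Prop) :
  P 0 -> (forall z w, P z -> P w -> P (z + w)) -> (forall x n, P (tmk phi x n)) -> forall z, P z.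
Proof.
move=> P0 PD Pm z; rewrite -(prepK z) -[pcls _]scale1r; move: (1 : S).
elim: (prep z : term S (M * N)) => [[x n]| |t IHt u IHu|a t IHt] s.
- by rewrite -[pcls _]/(tmk phi x n) -tmkZr.
- by rewrite pcls0 scaler0.
- by rewrite (pclsD (t : term_premod _) u) scalerDr; apply: PD.
- by rewrite (pclsZ a (t : term_premod _)) scalerA.
Qed.

(** Scalars are absorbed by the right factor, so every tensor is a sum of pure ones and additivity
    is enough. This covers maps that are only [R]-linear. *)
Lemma tens_ext_add (M : lmodType R) (N : lmodType S) (A : zmodType) (f g : tens phi M N -> A) :
  (forall z w, f (z + w) = f z + f w) -> (forall z w, g (z + w) = g z + g w) ->
  (forall x n, f (tmk phi x n) = g (tmk phi x n)) -> f =1 g.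
Proof.
move=> fD gD h; have f0 : f 0 = 0 by apply: (addrI (f 0)); rewrite -fD !addr0.
have g0 : g 0 = 0 by apply: (addrI (g 0)); rewrite -gD !addr0.
by apply: tens_ind => [|z w hz hw|x n]; [rewrite f0 g0|rewrite fD gD hz hw|exact: h].
Qed.

Lemma tens_ext (M : lmodType R) (N A : lmodType S) (f g : {linear tens phi M N -> A}) :
  (forall x n, f (tmk phi x n) = g (tmk phi x n)) -> f =1 g.
Proof.
move=> h; apply: tens_ind => [|z w hz hw|x n]; [by rewrite !linear0| |exact: h].
by rewrite !linearD hz hw.
Qed.

Lemma tenslD (M M' : lmodType R) (N : lmodType S) (f : {linear M -> M'}) z w :
  tensl phi N f (z + w) = tensl phi N f z + tensl phi N f w.
Proof. exact: linearD. Qed.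

Lemma tensl_comp (M M' M'' : lmodType R) (N : lmodType S) (f : {linear M -> M'})
  (g : {linear M' -> M''}) z : tensl phi N g (tensl phi N f z) = tensl phi N (lcomp g f) z.
Proof.
apply: (tens_ext (f := lcomp (tensl phi N g) (tensl phi N f)) (g := tensl phi N (lcomp g f))).
by move=> x n; rewrite [LHS]/= !tenslE.
Qed.

Lemma tensl_id (M : lmodType R) (N : lmodType S) (f : {linear M -> M}) z :
  f =1 id -> tensl phi N f z = z.
Proof.
move=> h; apply: (tens_ext (f := tensl phi N f) (g := idfun)) => x n.
by rewrite /= tenslE h.
Qed.

Lemma tensl_eq (M M' : lmodType R) (N : lmodType S) (f g : {linear M -> M'}) z :
  f =1 g -> tensl phi N f z = tensl phi N g z.
Proof.
move=> h; apply: (tens_ext (f := tensl phi N f) (g := tensl phi N g)) => x n.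
by rewrite !tenslE h.
Qed.

Lemma tensl_lin (M M' : lmodType R) (N : lmodType S) (f g h : {linear M -> M'}) a z :
  (forall x, f x = a *: g x + h x) ->
  tensl phi N f z = phi a *: tensl phi N g z + tensl phi N h z.
Proof.
move=> e; move: z; apply: tens_ind => [|z w hz hw|x n].
- by rewrite !linear0 addr0.
- rewrite (linearD (tensl phi N f)) (linearD (tensl phi N g)) (linearD (tensl phi N h)) hz hw.
  by rewrite scalerDr; zmodule.
- by rewrite !tenslE e tmkPl.
Qed.

Section RLift.
Variables (M A : lmodType R) (b : M -> S -> A).
Hypothesis bl : forall a x y s, b (a *: x + y) s = a *: b x s + b y s.
Hypothesis br : forall a x s t, b x (phi a * s + t) = a *: b x s + b x t.

Let brD x s t : b x (s + t) = b x s + b x t.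
Proof. by have := br 1 x s t; rewrite rmorph1 mul1r scale1r. Qed.
Let br0 x : b x 0 = 0.
Proof. by apply: (addrI (b x 0)); rewrite -brD !addr0. Qed.
Let brZ a x s : b x (phi a * s) = a *: b x s.
Proof. by rewrite -[_ * _]addr0 br br0 addr0. Qed.

(** [plift] yields [S]-linear maps, but [A] is only an [R]-module. The second argument collects the
    scalars of [S] met on the way down, so [rl_eval t s] is the value at [s *: t]. *)
Fixpoint rl_eval (t : term S (M * (S^o : lmodType S))) (s : S) : A :=
  match t with
  | TGen g => b g.1 (s * g.2)
  | TZero => 0
  | TAdd t u => rl_eval t s + rl_eval u s
  | TScale c t => rl_eval t (s * c)
  end.

Lemma rl_eval_lin t a s s' : rl_eval t (phi a * s + s') = a *: rl_eval t s + rl_eval t s'.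
Proof.
elim: t s s' => [g| |t IHt u IHu|c t IHt] s s' /=.
- by rewrite mulrDl -mulrA br.
- by rewrite scaler0 addr0.
- by rewrite IHt IHu scalerDr; zmodule.
- by rewrite mulrDl -mulrA IHt.
Qed.

Lemma rl_evalP t u : teq (@tens_rel R S phi M S^o) t u -> forall s, rl_eval t s = rl_eval u s.
Proof.
have evD v s s' : rl_eval v (s + s') = rl_eval v s + rl_eval v s'.
  by have := rl_eval_lin v 1 s s'; rewrite rmorph1 mul1r scale1r.
elim=> {t u} /=.
- move=> _ _ [[a [x [y [n [-> ->]]]]]|[c [x [n [p [-> ->]]]]]] s /=.
    by rewrite bl mulrAC -brZ mulrC.
  by rewrite -brD -mulrA -mulrDr.
- by [].
- by move=> t u _ h s.
- by move=> t u v _ h _ h' s; rewrite h h'.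
- by move=> t t' u u' _ h _ h' s; rewrite h h'.
- by move=> a t t' _ h s; rewrite h.
- by move=> t u v s; rewrite addrA.
- by move=> t u s; rewrite addrC.
- by move=> t s; rewrite add0r.
- move=> t s; have := rl_eval_lin t (-1) s 0; rewrite rmorphN1 mulN1r addr0 mulrN1 => ->.
  have -> : rl_eval t 0 = 0 by apply: (addrI (rl_eval t 0)); rewrite -evD !addr0.
  by rewrite scaleN1r addr0 addNr.
- by move=> a c t s; rewrite mulrA.
- by move=> t s; rewrite mulr1.
- by [].
- by move=> t a c s; rewrite mulrDr evD.
Qed.

Lemma rl_evalZ t a : rl_eval t (phi a) = a *: rl_eval t 1.
Proof.
have e0 : rl_eval t 0 = 0.
  have := rl_eval_lin t 1 0 0; rewrite rmorph1 mul1r addr0 scale1r => e.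
  by apply: (addrI (rl_eval t 0)); rewrite -e addr0.
by have := rl_eval_lin t a 1 0; rewrite mulr1 e0 !addr0.
Qed.

Definition rlift_fun (z : restr (tens phi M S^o) phi) : A :=
  rl_eval (@prep S (term_premod (@tens_rel R S phi M S^o)) z) 1.
Lemma rlift_tcls t : rlift_fun (tcls _ t) = rl_eval t 1.
Proof. exact/rl_evalP/(@peq_prep S (term_premod _) t). Qed.
Lemma rlift_linear : linear rlift_fun.
Proof.
move=> a x y; rewrite -[a *: x]/(phi a *: (x : tens phi M S^o)).
rewrite -(prepK x) -(prepK y) -pclsZ -pclsD !rlift_tcls /=.
by rewrite mul1r rl_evalZ.
Qed.
Definition rlift : {linear restr (tens phi M S^o) phi -> A} := mklin rlift_linear.
Lemma rliftE x s : rlift (tmk phi x (s : S^o)) = b x s.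
Proof. by rewrite /= /lin_fun rlift_tcls /= mul1r. Qed.
End RLift.
End TensorBasics.

Section TensorOverR.
Variable R : comPzRingType.
Notation rid := (idfun : {rmorphism R -> R}).

Lemma tensr_subproof (W A B : lmodType R) (f : {linear A -> B}) t u :
  @tens_rel R R rid W A t u ->
  teval (fun g => tmk rid g.1 (f g.2)) t = teval (fun g => tmk rid g.1 (f g.2)) u.
Proof.
case=> [[a [x [y [n [-> ->]]]]]|[b [x [n [p [-> ->]]]]]] /=; first by rewrite tmkPl.
by rewrite linearP tmkPr.
Qed.
Definition tensr (W A B : lmodType R) (f : {linear A -> B}) :
  {linear tens rid W A -> tens rid W B} := plift (@tensr_subproof W A B f).
Lemma tensrE (W A B : lmodType R) (f : {linear A -> B}) x n :
  tensr W f (tmk rid x n) = tmk rid x (f n).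
Proof. exact: pliftE. Qed.

Lemma tens_swap (W W' A B : lmodType R) (f : {linear A -> B}) (g : {linear W -> W'}) z :
  tensl rid B g (tensr W f z) = tensr W' f (tensl rid A g z).
Proof.
apply: (tens_ext (f := lcomp (tensl rid B g) (tensr W f))
                 (g := lcomp (tensr W' f) (tensl rid A g))).
by move=> x n; rewrite /= !tensrE !tenslE tensrE.
Qed.

Lemma tensr_comp0 (W A B C : lmodType R) (f : {linear A -> B}) (g : {linear B -> C}) z :
  (forall a, g (f a) = 0) -> tensr W g (tensr W f z) = 0.
Proof.
move=> h; move: z; apply: tens_ind => [|z w hz hw|x n]; first by rewrite !linear0.
  by rewrite !linearD hz hw addr0.
by rewrite !tensrE h tmk0r.
Qed.

Lemma tensr_surj (W A B : lmodType R) (f : {linear A -> B}) :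
  (forall b, exists a, f a = b) -> forall z, exists y, tensr W f y = z.
Proof.
move=> h; apply: tens_ind => [|_ _ [z <-] [w <-]|x b]; first by exists 0; exact: linear0.
  by exists (z + w); rewrite linearD.
by have [a <-] := h b; exists (tmk rid x a); rewrite tensrE.
Qed.

Lemma slant_subproof (W A : lmodType R) (p : {linear W -> R^o}) t u :
  @tens_rel R R rid W A t u ->
  teval (fun g => (p g.1 : R) *: g.2) t = teval (fun g => (p g.1 : R) *: g.2) u.
Proof.
case=> [[a [x [y [n [-> ->]]]]]|[b [x [n [q [-> ->]]]]]] /=.
  by rewrite linearP scalerDl scalerA.
by rewrite scalerDr !scalerA mulrC.
Qed.
Definition slant (W A : lmodType R) (p : {linear W -> R^o}) : {linear tens rid W A -> A} :=
  plift (@slant_subproof W A p).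
Lemma slantE (W A : lmodType R) (p : {linear W -> R^o}) x n :
  slant A p (tmk rid x n) = (p x : R) *: n.
Proof. exact: pliftE. Qed.

(** The list is read off from [z] before any dual basis is chosen, which is the order of choices
    that [lfree] allows. *)
Lemma tens_dual_basis (W A : lmodType R) (z : tens rid W A) : exists s : seq W,
  forall (J : finType) (e : J -> W) (p : J -> {linear W -> R^o}),
    (forall x, x \in s -> x = \sum_j (p j x : R) *: e j) ->
    z = \sum_j tmk rid (e j) (slant A (p j) z).
Proof.
move: z; apply: tens_ind => [|z w [s hs] [t ht]|x n].
- exists [::] => J e p _; rewrite big1 // => j _; by rewrite linear0 tmk0r.
- exists (s ++ t) => J e p h; rewrite {1}(hs J e p); last first.
    by move=> x xs; apply: h; rewrite mem_cat xs.
  rewrite {1}(ht J e p); last by move=> x xs; apply: h; rewrite mem_cat xs orbT.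
  by rewrite -big_split /=; apply: eq_bigr => j _; rewrite linearD tmkDr.
- exists [:: x] => J e p h; rewrite {1}(h x (mem_head _ _)) tmk_suml.
  by apply: eq_bigr => j _; rewrite slantE tmkZl tmkZr.
Qed.

Lemma slant_nat (W A B : lmodType R) (p : {linear W -> R^o}) (g : {linear A -> B}) z :
  slant B p (tensr W g z) = g (slant A p z).
Proof.
apply: (tens_ext (f := lcomp (slant B p) (tensr W g)) (g := lcomp g (slant A p))).
by move=> x n; rewrite /= tensrE !slantE linearZ_LR.
Qed.

(** Each coordinate of [z] along the dual basis lies in the kernel of [g], so it can be lifted
    separately. *)
Lemma lfree_exact (W A B C : lmodType R) (f : {linear A -> B}) (g : {linear B -> C}) :
  lfree W -> (forall b, g b = 0 -> exists a, f a = b) ->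
  forall z, tensr W g z = 0 -> exists y, tensr W f y = z.
Proof.
move=> hW h z gz; have [s hs] := tens_dual_basis z; have [J [e [p hp]]] := hW s.
have hb j : exists a, f a = slant B (p j) z by apply: h; rewrite -slant_nat gz linear0.
exists (\sum_j tmk rid (e j) (projT1 (cid (hb j)))); rewrite linear_sum [RHS](hs _ _ _ hp).
by apply: eq_bigr => j _; rewrite tensrE; case: cid => a /= ->.
Qed.

(** Flatness is given for injections only. It applies to the injection of [X (j + 1)] modulo
    boundaries into [X j]; right exactness of the tensor product is then used to return to
    boundaries. *)
Lemma flat_exact (F : lmodType R) (X : complex R) (i : int) : flat F -> ex X i ->
  ex (tens_complex rid X F) i.
Proof.
move=> hF hX z cz; have [j ej] := degP i; subst i.
pose B := bd_submod X (j + 1).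
have [d0 ed0] : exists d0 : {linear quo B -> X j}, forall x, d0 (qcls B x) = cdiff X (j + 1) j x.
  have h x : bd x -> cdiff X (j + 1) j x = 0 by move=> /cyc_bd.
  by exists (qlift B h) => x; exact: qliftE.
have inj : injective (tensl rid F d0).
  apply: hF => x y; have [x' <-] := qcls_surj x; have [y' <-] := qcls_surj y.
  rewrite !ed0 => /eqP; rewrite -subr_eq0 -linearB => /eqP e; apply/qclsP/hX.
  exact: (cycP erefl).
have e0 : tensl rid F (qcls B) z = 0.
  apply: inj; rewrite tensl_comp linear0 -[RHS](cz j); apply: tensl_eq => x; exact: ed0.
(* Right exactness: [X \otimes F] modulo its boundaries receives a map from [(X / B) \otimes F],
   where [z] has become zero. *)
pose im : tens rid (X (j + 1)) F -> Prop := @bd _ (tens_complex rid X F) (j + 1).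
have him : submod im := bd_submod (tens_complex rid X F) (j + 1).
have hb n : forall x, bd x -> lcomp (qcls him) (mklin (fun a x y => tmkPl rid a x y n)) x = 0.
  move=> x [k [y <-]] /=; apply/qcls0; exists k, (tmk rid y n); exact: tenslE.
have rel t u : @tens_rel R R rid (quo B) F t u ->
  teval (fun g => qlift B (hb g.2) g.1) t = teval (fun g => qlift B (hb g.2) g.1) u.
  case=> [[a [x [y [n [-> ->]]]]]|[b [x [n [q [-> ->]]]]]] /=.
    by rewrite -[LHS]/(qlift B (hb n) (a *: x + y)) linearP.
  have [x' <-] := qcls_surj x.
  have E m : qlift B (hb m) (qcls B x') = qcls him (tmk rid x' m) by exact: qliftE.
  change (qlift B (hb (b *: n + q)) (qcls B x') =
    b *: qlift B (hb n) (qcls B x') + qlift B (hb q) (qcls B x')).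
  by rewrite !E tmkPr linearP.
apply/(qcls0 him); rewrite -[RHS](linear0 (plift rel)) -e0.
apply: (tens_ext (f := qcls him) (g := lcomp (plift rel) (tensl rid F (qcls B)))) => x n.
by rewrite /= tenslE pliftE /=; exact/esym/(qliftE B (hb n) x).
Qed.
End TensorOverR.

(** * Quasi-isomorphisms and flat base change *)

Section QuasiIso.
Variable R : comPzRingType.

Definition qi (X Y : complex R) (f : chain_map X Y) : Prop :=
  (forall i (x : X i), cyc x -> bd (f i x) -> bd x) /\
  (forall i (y : Y i), cyc y -> exists x, cyc x /\ bd (f i x - y)).

Lemma cycle_cyc (X : complex R) i (z : Defs.cycle X i) : cyc (sval z).
Proof. by apply: (@cycP R X i (i - 1)); [rewrite subrK|exact: (svalP z)]. Qed.

Lemma hcls_eq (X : complex R) i (z w : Defs.cycle X i) :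
  hcls z = hcls w <-> bd (sval z - sval w).
Proof.
split=> [/pclsP [y ->]|b]; first exact: bd_diff.
by apply/pclsP; have [y ey] := bd_succ b erefl; exists y.
Qed.

Lemma hcls_surj (X : complex R) i (c : homology X i) : exists z : Defs.cycle X i, hcls z = c.
Proof. by exists (hrep c); exact: prepK. Qed.

Lemma qiP (X Y : complex R) (f : chain_map X Y) : quasi_iso f <-> qi f.
Proof.
split=> [qf|[inj surj] i].
  split=> i x cx; have [g fK gK] := qf i.
    have dx : cdiff X i (i - 1) x = 0 by [].
    have d0 : cdiff X i (i - 1) 0 = 0 by exact: linear0.
    move=> bx; have := (hcls_eq (exist _ x dx) (exist _ 0 d0)).1; rewrite /= subr0; apply.
    apply: (can_inj fK); rewrite !hmapE; apply/hcls_eq => /=.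
    by rewrite linear0 subr0.
  have dx : cdiff Y i (i - 1) x = 0 by [].
  have [z ez] := hcls_surj (g (hcls (exist _ x dx))).
  exists (sval z); split; first exact: cycle_cyc.
  suff e : hcls (Defs.cycle_map f z) = hcls (exist _ x dx) by have := (hcls_eq _ _).1 e.
  by rewrite -hmapE ez gK.
have surj' c : exists c', @hmap _ _ _ f i c' = c.
  have [z <-] := hcls_surj c; have [x [cx bx]] := surj i _ (cycle_cyc z).
  have dx : cdiff X i (i - 1) x = 0 by [].
  by exists (hcls (exist _ x dx)); rewrite hmapE; apply/hcls_eq.
have inj' : injective (@hmap _ _ _ f i).
  move=> c c'; have [z <-] := hcls_surj c; have [z' <-] := hcls_surj c'.
  rewrite !hmapE => /hcls_eq /= b; apply/hcls_eq; apply: inj; last by rewrite linearB.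
  by apply: submodB (cyc_submod _ _) _ _ _ _; exact: cycle_cyc.
exists (fun c => projT1 (cid (surj' c))) => c; last by case: cid.
by apply: inj'; case: cid.
Qed.

Lemma acyclic_ex (X : complex R) i : zero_module (homology X i) <-> ex X i.
Proof.
split=> [h x cx|h c].
  have dx : cdiff X i (i - 1) x = 0 by [].
  have d0 : cdiff X i (i - 1) 0 = 0 by exact: linear0.
  have := (hcls_eq (exist _ x dx) (exist _ 0 d0)).1; rewrite /= subr0; apply.
  by rewrite [LHS]h [RHS]h.
have [z <-] := hcls_surj c; rewrite -[RHS](prepK 0); apply/hcls_eq/h.
by apply: submodB (cyc_submod _ _) _ _ _ _; exact: cycle_cyc.
Qed.
End QuasiIso.

Lemma conc_zero (R : comPzRingType) (M : lmodType R) (j : int) (y : conc M j) : j != 0 -> y = 0.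
Proof. by case: j y => [[|j]|j] //= y _; apply/matrixP => ? []. Qed.

(** * Base change to a ring of finite flat dimension *)

Section FlatDimension.
Variables (R S : comPzRingType) (phi : {rmorphism R -> S}).
Notation rid := (idfun : {rmorphism R -> R}).

Section Compare.
Variable W : lmodType R.

Lemma tens_restrl a (x y : W) (s : S) : tmk rid (a *: x + y) (s : restr S^o phi) =
  a *: tmk rid x (s : restr S^o phi) + tmk rid y (s : restr S^o phi).
Proof. exact: tmkPl. Qed.
Lemma tens_restrr a (x : W) (s t : S) : tmk rid x (phi a * s + t : restr S^o phi) =
  a *: tmk rid x (s : restr S^o phi) + tmk rid x (t : restr S^o phi).
Proof. exact: (tmkPr rid a x (s : restr S^o phi) t). Qed.
(** [tens phi W S^o], seen over [R], is compared with the tensor product over [R], which is where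
    flatness is defined. *)
Definition to_restr : {linear restr (tens phi W S^o) phi -> tens rid W (restr S^o phi)} :=
  rlift tens_restrl tens_restrr.

Lemma of_restr_subproof t u : @tens_rel R R rid W (restr S^o phi) t u ->
  teval (fun g => tmk phi g.1 (g.2 : S^o) : restr (tens phi W S^o) phi) t =
  teval (fun g => tmk phi g.1 (g.2 : S^o) : restr (tens phi W S^o) phi) u.
Proof.
case=> [[a [x [y [n [-> ->]]]]]|[b [x [n [q [-> ->]]]]]] /=; first exact: tmkPl.
exact: (tmkPr phi (phi b) x (n : S^o) q).
Qed.
Definition of_restr : {linear tens rid W (restr S^o phi) -> restr (tens phi W S^o) phi} :=
  plift of_restr_subproof.

Lemma to_restrD (z w : tens phi W S^o) : to_restr (z + w) = to_restr z + to_restr w.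
Proof. exact: (linearD to_restr z w). Qed.
Lemma to_restrE x (s : S) : to_restr (tmk phi x (s : S^o)) = tmk rid x (s : restr S^o phi).
Proof. exact: rliftE. Qed.
Lemma of_restrE x (s : S) :
  of_restr (tmk rid x (s : restr S^o phi)) = tmk phi x (s : S^o).
Proof. exact: (pliftE of_restr_subproof). Qed.
Lemma of_restrD z w : of_restr (z + w) = (of_restr z : tens phi W S^o) + of_restr w.
Proof. exact: (linearD of_restr z w). Qed.

Lemma of_restrK (z : tens phi W S^o) : of_restr (to_restr z) = z.
Proof.
move: z; apply: (tens_ext_add (g := id)) => [z w|//|x n]; first by rewrite to_restrD of_restrD.
by rewrite to_restrE of_restrE.
Qed.
End Compare.

Lemma to_restr_nat (W W' : lmodType R) (g : {linear W -> W'}) (z : tens phi W S^o) :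
  to_restr W' (tensl phi S^o g z) = tensl rid _ g (to_restr W z).
Proof.
move: z; apply: tens_ext_add => [z w|z w|x n].
- by rewrite tenslD to_restrD.
- by rewrite to_restrD tenslD.
- by rewrite tenslE !to_restrE tenslE.
Qed.

Lemma of_restr_nat (W W' : lmodType R) (g : {linear W -> W'}) z :
  of_restr W' (tensl rid _ g z) = tensl phi S^o g (of_restr W z).
Proof.
move: z; apply: tens_ext_add => [z w|z w|x n].
- by rewrite tenslD of_restrD.
- by rewrite of_restrD tenslD.
- by rewrite tenslE !of_restrE tenslE.
Qed.

Lemma restr_ex (W : complex R) i : ex (tens_complex rid W (restr S^o phi)) i ->
  ex (tens_complex phi W S^o) i.
Proof.
move=> h z cz; have [|y ey] := bd_succ (h (to_restr (W i) z) _) erefl.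
  by move=> j; rewrite -[LHS]to_restr_nat (cz j) linear0.
exists (i + 1), (of_restr _ y); rewrite -[LHS]of_restr_nat -[RHS]of_restrK; congr (of_restr _ _).
exact: ey.
Qed.

(** Chase in the double complex [W \otimes F], where [F] is a flat resolution of [S]. *)
Lemma flat_dim_ex : finite_flat_dim (restr S^o phi) -> exists n : nat,
  forall W : complex R, (forall i, lfree (W i)) -> forall c : int,
    (forall i : int, c <= i -> ex W i) ->
    forall i : int, c + n%:Z <= i -> ex (tens_complex phi W S^o) i.
Proof.
move=> [n [F [e [/qiP [einj esurj] Fflat Fzero]]]]; exists n => W Wfree c Wex.
pose d i i' j := tensl rid (F j) (cdiff W i i').
pose b i j j' := tensr (W i) (cdiff F j j').
have db i i' j j' z : d i i' j' (b i j j' z) = b i' j j' (d i i' j z) by exact: tens_swap.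
have bb i j j' j'' z : b i j' j'' (b i j j' z) = 0 by apply: tensr_comp0 => a; exact: cdiffK.
have dd i i' i'' j z : d i' i'' j (d i i' j z) = 0 by exact: (@cdiffK _ (tens_complex rid W (F j)) i i' i'' z).
have row i (j : int) z : 0 < j -> b i j (j - 1) z = 0 -> exists y, b i (j + 1) j y = z.
  move=> j0; apply: lfree_exact => // x dx.
  have cx : cyc x by apply: (@cycP _ _ _ (j - 1)) => //; rewrite subrK.
  apply: bd_succ => //; apply: einj => //.
  by rewrite [e j x]conc_zero ?gt_eqF //; exact: submod0 (bd_submod _ _).
(* [k = n - j] counts the columns still to the right. Each move to the next column lowers the degree
   in [W] by one, hence the condition [c + k <= i]; beyond column [n] the module [F (j + 1)] is
   zero. *)
have chase (k : nat) : forall j : int, 0 <= j -> j + k%:Z = n%:Z -> forall i i' : int,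
    i = i' + 1 -> c + k%:Z <= i -> forall z, (exists y, d i i' j z = b i' (j + 1) j y) ->
    exists w y', z = d (i + 1) i j w + b i (j + 1) j y'.
  elim: k => [|k IH] j j0 ej i i' ei ci z [y ey].
    have F0 : forall x : F (j + 1), x = 0 by apply: Fzero; lia.
    have y0 : b i' (j + 1) j y = 0.
      have -> : b i' (j + 1) j y = tensr (W i') (\0 : {linear F (j + 1) -> F j}) y.
        apply: (tens_ext (f := b i' (j + 1) j)) => x m.
        by rewrite !tensrE (F0 m) !linear0.
      move: y {ey}; apply: tens_ind => [|z1 z2 h1 h2|x m]; first exact: linear0.
        by rewrite linearD h1 h2 addr0.
      by rewrite tensrE /= tmk0r.
    have hx : ex W i by apply: Wex; lia.
    have [|w ew] := bd_succ (flat_exact (Fflat j) hx (x := z) _) erefl.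
      by apply: (cycP ei); rewrite -[LHS]/(d i i' j z) ey y0.
    by exists w, 0; rewrite linear0 addr0.
  have [i'' ei'] := degP i'.
  have [y2 ey2] : exists y2, d i' i'' (j + 1) y = b i'' (j + 1 + 1) (j + 1) y2.
    have [||y2 <-] := row i'' (j + 1) (d i' i'' (j + 1) y); [lia| |by exists y2].
    by rewrite addrK -db -ey dd.
  have [||||w1 [y3 e3]] := IH (j + 1) _ _ i' i'' ei' _ y; [lia|lia|lia|by exists y2|].
  have hx : ex W i by apply: Wex; lia.
  rewrite -ei in w1 e3.
  have [|w ew] := bd_succ (flat_exact (Fflat j) hx (x := z - b i (j + 1) j w1) _) erefl.
    apply: (cycP ei); rewrite -[LHS]/(d i i' j _) linearB ey e3 linearD bb addr0.
    by rewrite -db subrr.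
  by exists w, w1; rewrite -[X in X + _]/(cdiff (tens_complex rid W (F j)) (i + 1) i w) ew subrK.
move=> i ci; apply: restr_ex => x cx; have [i' ei] := degP i.
have F1 (y : F (-1)) : y = 0 by apply: Fzero; lia.
have cyc0 (y : F 0) : cyc y by apply: (@cycP _ _ _ (-1)); [|exact: F1].
pose e0 : {linear F 0 -> restr S^o phi} := e 0.
have [z ez] : exists z, tensr (W i) e0 z = x.
  apply: tensr_surj => y; have [|a [_ [k [v ev]]]] := esurj 0 y.
    by move=> j; exact: (linear0 (cdiff (conc (restr S^o phi)) 0 j)).
  by exists a; apply/eqP; rewrite -subr_eq0; apply/eqP; rewrite -[LHS]ev.
have row0 a w : tensr (W a) e0 w = 0 -> exists y, b a 1 0 y = w.
  apply: lfree_exact => // y ey; have [v <-] : exists v : F 1, cdiff F 1 0 v = y.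
    by apply: bd_succ => //; apply: einj; [exact: cyc0|rewrite ey; exact: submod0 (bd_submod _ _)].
  by exists v.
have [|||w [y' e']] := chase n 0 _ _ i i' ei ci z.
- by [].
- by rewrite add0r.
- have [y <-] : exists y, b i' 1 0 y = d i i' 0 z; last by exists y.
  by apply: row0; rewrite -[LHS]tens_swap ez; exact: cx.
exists (i + 1), (tensr (W (i + 1)) e0 w); rewrite -[LHS]/(tensl rid _ (cdiff W (i + 1) i) _).
rewrite tens_swap -[X in tensr _ _ X](addrK (b i (0 + 1) 0 y')) -[tensl _ _ _ _ + _]e'.
rewrite linearB ez [tensr _ _ (b _ _ _ _)]tensr_comp0 ?subr0 // => a.
by rewrite -[LHS](@cfun_comm _ _ _ e (0 + 1) 0 a).
Qed.
End FlatDimension.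

(** * Hom complexes and K-projectivity *)

Section HomComplexes.
Variable R : comPzRingType.
Implicit Types X Y P E : complex R.

Definition sgn (n : int) : R := (-1) ^+ `|n|%N.
Lemma sgnS (n m : int) : n = m + 1 -> sgn n = - sgn m.
Proof. by move=> ->; exact: sign_absz_succ. Qed.

Lemma homdE X Y (n m i i' j j' : int) (f : Defs.hom X Y n) (x : X i) :
  n = m + 1 -> i = i' + 1 -> j' = j + 1 ->
  hfun (hom_diff X Y n m f) i j x =
  cdiff Y j' j (hfun f i j' x) - sgn n *: hfun f i' j (cdiff X i i' x).
Proof. by move=> en ei ej; subst n i j'; rewrite /= /hom_diff_fun eqxx addrK. Qed.

Lemma hfunP X Y n (f : Defs.hom X Y n) i j a x y :
  hfun f i j (a *: x + y) = a *: hfun f i j x + hfun f i j y.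
Proof. exact: (linearP (hlin f i j)). Qed.
Lemma hfun0 X Y n (f : Defs.hom X Y n) i j : hfun f i j 0 = 0.
Proof. exact: (linear0 (hlin f i j)). Qed.
Lemma hfunZ X Y n (f : Defs.hom X Y n) i j a x : hfun f i j (a *: x) = a *: hfun f i j x.
Proof. exact: (linearZ_LR (hlin f i j)). Qed.
Lemma hfunD X Y n (f : Defs.hom X Y n) i j x y : hfun f i j (x + y) = hfun f i j x + hfun f i j y.
Proof. exact: (linearD (hlin f i j)). Qed.
Lemma hfunN X Y n (f : Defs.hom X Y n) i j x : hfun f i j (- x) = - hfun f i j x.
Proof. exact: (linearN (hlin f i j)). Qed.
Lemma hfunB X Y n (f : Defs.hom X Y n) i j x y : hfun f i j (x - y) = hfun f i j x - hfun f i j y.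
Proof. exact: (linearB (hlin f i j)). Qed.
Lemma hom_plus X Y n (f g : Defs.hom X Y n) i j x : hfun (f + g) i j x = hfun f i j x + hfun g i j x.
Proof. by []. Qed.
Lemma hom_zero X Y n i j x : hfun (0 : Defs.hom X Y n) i j x = 0.
Proof. by []. Qed.
Lemma hom_opp X Y n (f : Defs.hom X Y n) i j x : hfun (- f) i j x = - hfun f i j x.
Proof. exact: scaleN1r. Qed.
Lemma hom_mult X Y n a (f : Defs.hom X Y n) i j x : hfun (a *: f) i j x = a *: hfun f i j x.
Proof. by []. Qed.
Definition homE := (hom_plus, hom_zero, hom_opp, hom_mult).

Lemma hom_eqP X Y n (f g : Defs.hom X Y n) :
  (forall (i j : int) x, j = i + n -> hfun f i j x = hfun g i j x) -> f = g.
Proof.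
move=> h; apply: hom_ext => i j x; have [/h //|ne] := eqVneq j (i + n).
by rewrite !hfun_shape.
Qed.

Lemma hom_cycP X Y n (f : Defs.Hom X Y n) : cyc f <->
  forall (i i' j j' : int) x, i = i' + 1 -> j' = j + 1 ->
    cdiff Y j' j (hfun f i j' x) = sgn n *: hfun f i' j (cdiff X i i' x).
Proof.
have [m en] := degP n; split=> [cf i i' j j' x ei ej|h].
  have := homdE f x en ei ej; rewrite [hom_diff _ _ _ _ _]cf => /eqP.
  by rewrite eq_sym subr_eq0 => /eqP.
apply: (cycP en); apply: hom_ext => i j x; have [i' ei] := degP i.
by rewrite (homdE _ _ en ei erefl) (h _ _ _ _ _ ei erefl) subrr.
Qed.

Lemma hom_bdP X Y n (f : Defs.Hom X Y n) k : k = n + 1 -> bd f <->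
  exists g : Defs.Hom X Y k, forall (i i' j j' : int) x, i = i' + 1 -> j' = j + 1 ->
    hfun f i j x = cdiff Y j' j (hfun g i j' x) + sgn n *: hfun g i' j (cdiff X i i' x).
Proof.
move=> ek; split=> [b|[g hg]].
  have [g <-] := bd_succ b ek; exists g => i i' j j' x ei ej.
  by rewrite (homdE _ _ ek ei ej) (sgnS ek) scaleNr opprK.
exists k, g; apply: hom_ext => i j x; have [i' ei] := degP i.
by rewrite (homdE _ _ ek ei erefl) (hg _ _ _ _ _ ei erefl) (sgnS ek) scaleNr opprK.
Qed.

Definition mkhom X Y n (F : forall i j, X i -> Y j) (hF : forall i j, linear (F i j)) : Defs.hom X Y n.
Proof.
refine (@MkHom R X Y n (fun i j x => if j == i + n then F i j x else 0) _ _).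
  by move=> i j a x y; case: ifP => _; rewrite ?hF // scaler0 addr0.
by move=> i j x /negbTE ->.
Defined.

Lemma mkhomE X Y n F hF (i j : int) x : j = i + n -> hfun (@mkhom X Y n F hF) i j x = F i j x.
Proof. by move=> e /=; rewrite -e eqxx. Qed.

Section PostComposition.
Variables (P X Y : complex R) (f : chain_map X Y).
Definition hom_post n (g : Defs.hom P X n) : Defs.hom P Y n.
Proof.
refine (@MkHom R P Y n (fun i j x => f j (hfun g i j x)) _ _).
  by move=> i j a x y; rewrite hfunP linearP.
by move=> i j x ne; rewrite hfun_shape // linear0.
Defined.
Lemma hom_post_linear n : linear (@hom_post n).
Proof. by move=> a g h; apply: hom_ext => i j x; rewrite /= linearP. Qed.
Lemma hom_post_comm n m g :
  cdiff (Defs.Hom P Y) n m (mklin (@hom_post_linear n) g) =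
  mklin (@hom_post_linear m) (cdiff (Defs.Hom P X) n m g).
Proof.
have [en|ne] := eqVneq n (m + 1); last by rewrite !cdiff_shape // linear0.
apply: hom_ext => i j x; have [i' ei] := degP i.
apply: etrans (homdE _ _ en ei erefl) _.
rewrite [RHS]/= -/(hom_diff P X n m g) [X in _ = f j X](homdE _ _ en ei erefl).
by rewrite (linearB (f j)) (linearZ_LR (f j)) -cfun_comm.
Qed.
Definition homR : chain_map (Defs.Hom P X) (Defs.Hom P Y) :=
  @ChainMap R (Defs.Hom P X) (Defs.Hom P Y) (fun n => mklin (@hom_post_linear n)) hom_post_comm.
End PostComposition.

Section PreComposition.
Variables (P P' Y : complex R) (u : chain_map P P').
Definition hom_pre n (g : Defs.hom P' Y n) : Defs.hom P Y n.
Proof.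
refine (@MkHom R P Y n (fun i j x => hfun g i j (u i x)) _ _).
  by move=> i j a x y; rewrite linearP hfunP.
by move=> i j x ne; exact: hfun_shape.
Defined.
Lemma hom_pre_linear n : linear (@hom_pre n).
Proof. by move=> a g h; apply: hom_ext. Qed.
Lemma hom_pre_comm n m g :
  cdiff (Defs.Hom P Y) n m (mklin (@hom_pre_linear n) g) =
  mklin (@hom_pre_linear m) (cdiff (Defs.Hom P' Y) n m g).
Proof.
have [en|ne] := eqVneq n (m + 1); last by rewrite !cdiff_shape // linear0.
apply: hom_ext => i j x; have [i' ei] := degP i.
apply: etrans (homdE _ _ en ei erefl) _.
rewrite [RHS]/= -/(hom_diff P' Y n m g) [RHS](homdE _ _ en ei erefl).
by rewrite cfun_comm.
Qed.
Definition homL : chain_map (Defs.Hom P' Y) (Defs.Hom P Y) :=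
  @ChainMap R (Defs.Hom P' Y) (Defs.Hom P Y) (fun n => mklin (@hom_pre_linear n)) hom_pre_comm.
End PreComposition.

Lemma iso_ex X Y (f : chain_map X Y) i : (forall j, injective (f j)) ->
  (forall j y, exists x, f j x = y) -> ex X i <-> ex Y i.
Proof.
move=> inj surj; split=> h.
  move=> y cy; have [x ex] := surj i y; rewrite -ex; apply/cfun_bd/h => j.
  by apply: (inj j); rewrite linear0 -cfun_comm ex cy.
move=> x cx; have [y ey] := bd_succ (h _ (cfun_cyc f cx)) erefl.
have [z ez] := surj _ y; exists (i + 1), z; apply: (inj i).
by rewrite -cfun_comm ez.
Qed.

Lemma fib_ex_qi X Y (f : chain_map X Y) : (forall i, ex (fib f) i) <-> qi f.
Proof.
split=> [h|[inj surj] i [x y] /fib_cycP /= [cx e]].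
  split=> i x cx.
    move=> bx; have [y ey] := bd_succ bx erefl.
    have [|x' [/= -> _]] := (fib_bdP _).1 (h i (x, y) _); last exact: bd_diff.
    exact/fib_cycP.
  have [i' ei] := degP i; subst i.
  have [|x' [/= dx b]] := (fib_bdP _).1 (h i' (0, x) _).
    by apply/fib_cycP; split=> /=; [exact: submod0 (cyc_submod _ _)|rewrite linear0 cx].
  by exists x'; split=> //; apply: (cycP erefl); rewrite -dx.
apply/fib_bdP => /=; have [w ew] : exists w, cdiff X (i + 1) i w = x.
  by apply: bd_succ => //; apply: inj => //; rewrite e; exact: bd_diff.
have [|v [cv bv]] := surj (i + 1) (y - f (i + 1) w).
  by apply: (cycP erefl); rewrite linearB cfun_comm ew e subrr.
exists (w + v); split; first by rewrite linearD ew cv addr0.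
by rewrite linearD (_ : _ - y = f (i + 1) v - (y - f (i + 1) w)) //; zmodule.
Qed.

Definition K0 P : Prop := forall E, (forall i, ex E i) -> forall n, ex (Defs.Hom P E) n.

Lemma K0_res (C : complex R) : K0 (res C).
Proof.
move=> E hE n; apply/acyclic_ex; apply: res_Kprojective => i; exact/acyclic_ex.
Qed.

Section Pairing.
Variables (P X Y : complex R) (f : chain_map X Y).

Definition hom_pair n (z : fib (homR P f) n) : Defs.hom P (fib f) n.
Proof.
refine (@MkHom R P (fib f) n (fun i j x => (hfun z.1 i j x, hfun z.2 i (j + 1) x)) _ _).
  by move=> i j a x y; rewrite !hfunP.
move=> i j x ne; rewrite !hfun_shape //.
by rewrite addrA (inj_eq (addIr 1)).
Defined.
Lemma hom_pair_linear n : linear (@hom_pair n).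
Proof. by move=> a g h; apply: hom_ext. Qed.
Lemma hom_pair_comm n m g :
  cdiff (Defs.Hom P (fib f)) n m (mklin (@hom_pair_linear n) g) =
  mklin (@hom_pair_linear m) (cdiff (fib (homR P f)) n m g).
Proof.
have [en|ne] := eqVneq n (m + 1); last by rewrite !cdiff_shape // linear0.
apply: hom_ext => i j x; have [i' ei] := degP i.
apply: etrans (homdE _ _ en ei erefl) _.
subst n; rewrite [cdiff (fib (homR P f)) _ _ _]fib_diffE fib_diffE.
congr (_, _) => /=.
  exact/esym/(@homdE P X (m + 1) m i i' j (j + 1) g.1 x erefl ei erefl).
rewrite -[RHS]/(f (j + 1) (hfun g.1 i (j + 1) x) +
  hfun (- hom_diff P Y (m + 1 + 1) (m + 1) g.2) i (j + 1) x).
rewrite hom_opp (@homdE _ _ _ (m + 1) _ i' _ (j + 1 + 1) _ _ erefl ei erefl).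
by rewrite [sgn (m + 1 + 1)](sgnS erefl) scaleNr; zmodule.
Qed.
Definition pair_chain : chain_map (fib (homR P f)) (Defs.Hom P (fib f)) :=
  @ChainMap R (fib (homR P f)) (Defs.Hom P (fib f)) (fun n => mklin (@hom_pair_linear n)) hom_pair_comm.

(** [Hom(P, -)] commutes with fibers, and a map is a quasi-isomorphism iff its fiber is exact. *)
Lemma K0_qi : K0 P -> qi f -> qi (homR P f).
Proof.
move=> hP hf; apply/fib_ex_qi => n; apply/(iso_ex (f := pair_chain)); last first.
- by apply: hP; exact/fib_ex_qi.
- move=> m G.
  have l1 i j : linear (fun x => (hfun G i j x).1) by move=> a x y; rewrite hfunP.
  have l2 i j : linear (fun x => castdeg j (hfun G i (j - 1) x).2 : Y j).
    by move=> a x y; rewrite hfunP castdeg_linear.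
  exists (mkhom m l1, mkhom (m + 1) l2); apply: hom_eqP => i j x ej.
  have h k : k = j -> castdeg (j + 1) (hfun G i k x).2 = (hfun G i j x).2.
    by move=> ->; exact: castdeg_id.
  rewrite /= h ?addrK // [i + (m + 1)]addrA -ej !eqxx; by case: (hfun G _ _ _).
- move=> m [g h] [g' h'] e.
  have e' i j x : (hfun g i j x, hfun h i (j + 1) x) = (hfun g' i j x, hfun h' i (j + 1) x).
    exact: (congr1 (fun F : Defs.hom P (fib f) m => hfun F i j x) e).
  congr (_, _); apply: hom_ext => i j x; first by case: (e' i j x).
  by have [j' ej] := degP j; subst j; case: (e' i j' x).
Qed.
End Pairing.

Section Copairing.
Variables (X Y : complex R) (u : chain_map X Y).

(** A cycle on the fiber is a pair of maps [a] on [X] and [b] on [Y]. As a shift of [Y] is a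
    subcomplex, [b] is a cycle and bounds some [b']; subtracting the composite of [b'] with [u]
    turns [a] into a cycle on [X]. *)
Lemma K0_fib : K0 X -> K0 Y -> K0 (fib u).
Proof.
move=> hX hY E hE n f cf; have [m en] := degP n.
have la i j : linear (fun x : X i => hfun f i j ((x, 0) : fib u i)).
  by move=> a x y; rewrite -hfunP; congr (hfun f i j (_, _)); rewrite /= scaler0 addr0.
have lb i j : linear (fun y : Y i => hfun f (i - 1) j ((0, castdeg (i - 1 + 1) y) : fib u (i - 1))).
  by move=> a x y; rewrite -hfunP castdeg_linear; congr (hfun f _ j (_, _)); rewrite /= scaler0 addr0.
pose a : Defs.Hom X E n := mkhom n la; pose b : Defs.Hom Y E m := mkhom m lb.
have aE (i j : int) x : hfun a i j x = hfun f i j ((x, 0) : fib u i).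
  have [e|ne] := eqVneq j (i + n); first by rewrite mkhomE.
  by rewrite !hfun_shape.
have bE (i j : int) y : hfun b (i + 1) j y = hfun f i j ((0, y) : fib u i).
  have [e|ne] := eqVneq j (i + n).
    by rewrite mkhomE ?e ?en ?addrK ?castdeg_id //; ring.
  by rewrite !hfun_shape // -addrA [1 + m]addrC -en.
have fE (i j : int) (z : fib u i) : hfun f i j z = hfun a i j z.1 + hfun b (i + 1) j z.2.
  by rewrite aE bE -hfunD; congr (hfun f i j _); case: z => z1 z2; congr (_, _); rewrite /= ?addr0 ?add0r.
have fc := (hom_cycP f).1 cf.
have [b' eb'] : exists b' : Defs.Hom Y E n, hom_diff Y E n m b' = b.
  apply: bd_succ => //; apply: hY => //; apply/hom_cycP => i i' j j' y ei ej.
  have [i'' ei'] := degP i'; subst i i'; rewrite !bE (fc _ i'' _ _ _ erefl ej) fib_diffE /=.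
  rewrite linear0 [u _ _]linear0 sub0r (sgnS en) scaleNr -scalerN -hfunN.
  by congr (_ *: hfun f _ _ (_, _)); rewrite /= ?oppr0 ?opprK.
pose a1 : Defs.Hom X E n := a - sgn n *: homL E u n b'.
have [a' ea'] : exists a' : Defs.Hom X E (n + 1), hom_diff X E (n + 1) n a' = a1.
  apply: bd_succ => //; apply: hX => //; apply: (cycP en).
  rewrite linearB linearZ_LR -[cdiff _ _ _ (homL E u n b')]/(cdiff (Defs.Hom X E) n m _) cfun_comm.
  rewrite [cdiff _ _ _ b']eb'; apply/eqP; rewrite subr_eq0; apply/eqP.
  apply: hom_eqP => i j x ej; have [i' ei] := degP i.
  rewrite [LHS](homdE _ _ en ei erefl) !aE (fc _ _ _ _ _ ei erefl).
  rewrite -scalerBr [RHS]homE; congr (_ *: _); subst i.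
  rewrite -[RHS]/(hfun b (i' + 1) j (u (i' + 1) x)) bE -hfunB fib_diffE /=.
  by congr (hfun f _ _ (_, _)); rewrite /= ?subrr // linear0 !subr0.
have lc i j : linear (fun z : fib u i => hfun a' i j z.1 + hfun b' (i + 1) j z.2).
  by move=> c x y; rewrite !hfunP scalerDr; zmodule.
apply/(hom_bdP _ erefl); exists (mkhom (n + 1) lc) => i i' j j' z ei ej.
have cE (k l : int) w : hfun (mkhom (n + 1) lc) k l w = hfun a' k l w.1 + hfun b' (k + 1) l w.2.
  have [e|ne] := eqVneq l (k + (n + 1)); first by rewrite mkhomE.
  by rewrite !hfun_shape ?addr0 //; move: ne; rewrite -addrA [1 + n]addrC.
have e1 := @homdE _ _ (n + 1) n i i' j j' a' z.1 erefl ei ej.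
have e2 := @homdE _ _ n m (i + 1) (i' + 1) j j' b' z.2 en (congr1 (+%R^~ 1) ei) ej.
rewrite eb' in e2; rewrite ea' in e1.
have a1E : hfun a1 i j z.1 = hfun a i j z.1 - sgn n *: hfun b' i j (u i z.1).
  by rewrite /a1 hom_plus hom_opp hom_mult.
rewrite fE !cE linearD; have -> : hfun a i j z.1 = cdiff E j' j (hfun a' i j' z.1) -
   sgn (n + 1) *: hfun a' i' j (cdiff X i i' z.1) + sgn n *: hfun b' i j (u i z.1).
  by rewrite -e1 a1E subrK.
rewrite e2 (sgnS erefl) scaleNr opprK; subst i; rewrite fib_diffE /= hfunB scalerDr scalerBr.
zmodule.
Qed.
End Copairing.
End HomComplexes.

Arguments tensl : simpl never.

(** * Extension of scalars *)

Section BaseChange.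
Variables (R S : comPzRingType) (phi : {rmorphism R -> S}).
Notation T X := (tens_complex phi X S^o).

Lemma restr_linear (M N : lmodType S) (f : {linear M -> N}) :
  linear (fun x : restr M phi => f x : restr N phi).
Proof. by move=> a x y; exact: (linearP f (phi a) x y). Qed.
Definition restr_map (M N : lmodType S) (f : {linear M -> N}) :
  {linear restr M phi -> restr N phi} := mklin (restr_linear f).

Definition restr_complex (E : complex S) : complex R :=
  @Complex R (fun i => restr (E i) phi) (fun i j => restr_map (cdiff E i j))
    (@cdiff_shape S E) (@cdiffK S E).

Lemma sgn_morph n : phi (sgn R n) = sgn S n.
Proof. by rewrite /sgn rmorphXn rmorphN1. Qed.

Lemma tens_unit_linear (M : lmodType R) :
  linear (fun x : M => tmk phi x (1 : S^o) : restr (tens phi M S^o) phi).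
Proof. by move=> a x y; exact: tmkPl. Qed.
Definition tens_unit_map (M : lmodType R) : {linear M -> restr (tens phi M S^o) phi} :=
  mklin (@tens_unit_linear M).
Definition tens_unit (X : complex R) : chain_map X (restr_complex (T X)) :=
  @ChainMap R X (restr_complex (T X)) (fun i => tens_unit_map (X i))
    (fun i j x => tenslE phi (cdiff X i j) x (1 : S^o)).

Lemma tmk1 (M : lmodType R) (x : M) (s : S) : tmk phi x (s : S^o) = s *: tmk phi x (1 : S^o).
Proof. by rewrite -tmkZr -[_ *: _]/(s * 1) mulr1. Qed.

Section Extend.
Variables (M : lmodType R) (A : lmodType S) (g : M -> A).
Hypothesis hg : forall a x y, g (a *: x + y) = phi a *: g x + g y.
Lemma extend_subproof t u : @tens_rel R S phi M S^o t u ->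
  teval (fun z => (z.2 : S) *: g z.1) t = teval (fun z => (z.2 : S) *: g z.1) u.
Proof.
case=> [[a [x [y [n [-> ->]]]]]|[b [x [n [q [-> ->]]]]]] /=.
  by rewrite hg scalerDr !scalerA mulrC.
by rewrite scalerDl scalerA.
Qed.
Definition extend : {linear tens phi M S^o -> A} := plift extend_subproof.
Lemma extendE x (s : S) : extend (tmk phi x (s : S^o)) = s *: g x.
Proof. exact: pliftE. Qed.
End Extend.

(** Adjunction: [S]-linear maps from [P \otimes S] to [E] are [R]-linear maps from [P] to the
    restriction of [E], which is exact if [E] is. *)
Lemma K0_tens (P : complex R) : K0 P -> K0 (T P).
Proof.
move=> hP E hE n f /hom_cycP fc.
have l i j : linear (fun x : P i => hfun f i j (tmk phi x (1 : S^o)) : restr_complex E j).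
  by move=> a x y; rewrite tmkPl hfunP.
pose f' : Defs.Hom P (restr_complex E) n := mkhom n l.
have f'E (i j : int) x : hfun f' i j x = hfun f i j (tmk phi x (1 : S^o)).
  have [e|ne] := eqVneq j (i + n); first by rewrite mkhomE.
  by rewrite !hfun_shape.
have [|g hg] := (hom_bdP f' erefl).1 (hP (restr_complex E) hE n f' _).
  apply/hom_cycP => i i' j j' x ei ej; rewrite !f'E.
  rewrite -[RHS]/(phi (sgn R n) *: _) sgn_morph -[LHS]/(cdiff E j' j _) (fc _ _ _ _ _ ei ej).
  by congr (_ *: hfun f _ _ _); exact: tenslE.
have gl i j a x y : (hfun g i j (a *: x + y) : E j) = phi a *: (hfun g i j x : E j) + hfun g i j y.
  exact: (@hfunP R P (restr_complex E) _ g i j a x y).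
pose G i j := extend (gl i j).
have Gl i j : linear (fun z : T P i => G i j z : E j) by exact: (linearP (G i j)).
apply/(hom_bdP f erefl); exists (mkhom (n + 1) Gl) => i i' j j' z ei ej.
have [en|ne] := eqVneq j (i + n); last first.
  rewrite hfun_shape // [X in cdiff _ _ _ X]hfun_shape; last first.
    by rewrite ej addrA (inj_eq (addIr 1)).
  rewrite [hfun _ i' j _]hfun_shape ?linear0 ?scaler0 ?addr0 //.
  by rewrite addrA addrAC -ei.
rewrite mkhomE; last by rewrite ej en addrA.
rewrite mkhomE; last by rewrite en ei addrA addrAC.
move: z; apply: tens_ext_add => [z w|z w|x s].
- exact: hfunD.
- have -> : G i j' (z + w) = G i j' z + G i j' w by exact: linearD.
  rewrite linearD.
  have -> : cdiff (T P) i i' (z + w) = cdiff (T P) i i' z + cdiff (T P) i i' w by exact: linearD.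
  have -> : G i' j (cdiff (T P) i i' z + cdiff (T P) i i' w) =
    G i' j (cdiff (T P) i i' z) + G i' j (cdiff (T P) i i' w) by exact: linearD.
  by rewrite scalerDr; zmodule.
- rewrite tmk1 [LHS]hfunZ -f'E (hg _ _ _ _ _ ei ej) -[X in _ *: (_ + X)]/(phi (sgn R n) *: (hfun g i' j (cdiff P i i' x) : E j)).
  rewrite -tmk1 extendE [cdiff (T P) i i' _]tenslE extendE sgn_morph linearZ_LR scalerDr.
  by rewrite !scalerA mulrC.
Qed.

Section TensorMaps.
Variable N : lmodType S.
Notation TN X := (tens_complex phi X N).

Lemma tens_diffE (X : complex R) i j z :
  cdiff (TN X) i j z = tensl phi N (cdiff X i j) z.
Proof. by []. Qed.

Definition tens_map (X Y : complex R) (f : chain_map X Y) : chain_map (TN X) (TN Y).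
Proof.
refine (@ChainMap S (TN X) (TN Y) (fun i => tensl phi N (f i)) _) => i j z.
by rewrite !tens_diffE !tensl_comp; apply: tensl_eq => x /=; exact: cfun_comm.
Defined.

Section TensFib.
Variables (X Y : complex R) (f : chain_map X Y).
Definition tens_fib_fun i (z : TN (fib f) i) : fib (tens_map f) i :=
  (tensl phi N (prodfst (X i) (Y (i + 1))) z, tensl phi N (prodsnd (X i) (Y (i + 1))) z).
Lemma tens_fib_linear i : linear (@tens_fib_fun i).
Proof.
move=> a z w; congr (_, _).
  exact: (linearP (tensl phi N (prodfst (X i) (Y (i + 1))))).
exact: (linearP (tensl phi N (prodsnd (X i) (Y (i + 1))))).
Qed.
Lemma tens_fib_comm i j z : cdiff (fib (tens_map f)) i j (mklin (@tens_fib_linear i) z) =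
  mklin (@tens_fib_linear j) (cdiff (TN (fib f)) i j z).
Proof.
have [e|ne] := eqVneq i (j + 1); last by rewrite !cdiff_shape // linear0.
subst i; rewrite fib_diffE; congr (_, _).
  by rewrite !tens_diffE !tensl_comp; apply: tensl_eq.
rewrite !tens_diffE -[X in X - _]/(tensl phi N (f (j + 1)) (tensl phi N (prodfst _ _) z)).
rewrite !tensl_comp; apply/esym.
rewrite [LHS](@tensl_lin _ _ _ _ _ _ _ (lcomp (cdiff Y (j + 1 + 1) (j + 1)) (prodsnd (X (j + 1)) (Y (j + 1 + 1))))
  (lcomp (f (j + 1)) (prodfst (X (j + 1)) (Y (j + 1 + 1)))) (-1)).
  by rewrite rmorphN1 scaleN1r [LHS]addrC.
move=> [x y]; have := congr1 snd (@fib_diffE R X Y f j (x, y)); rewrite /= /lin_fun => ->.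
by rewrite scaleN1r [RHS]addrC.
Qed.
Definition tens_fib : chain_map (TN (fib f)) (fib (tens_map f)) :=
  @ChainMap S _ _ (fun i => mklin (@tens_fib_linear i)) tens_fib_comm.

(** The modules of a fiber are biproducts, and the tensor product preserves these. *)
Lemma tens_fib_ex i : ex (TN (fib f)) i <-> ex (fib (tens_map f)) i.
Proof.
have split (k : int) (z : TN (fib f) k) : z =
  tensl phi N (prodinl (X k) (Y (k + 1))) (tensl phi N (prodfst _ _) z) +
    tensl phi N (prodinr (X k) (Y (k + 1))) (tensl phi N (prodsnd _ _) z).
  rewrite !tensl_comp -[LHS](@tensl_id _ _ phi _ _ (idfun : {linear fib f k -> fib f k})) //.
  rewrite [LHS](@tensl_lin _ _ _ _ _ _ _ (lcomp (prodinl _ _) (prodfst _ _)) (lcomp (prodinr _ _) (prodsnd _ _)) 1).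
    by rewrite rmorph1 scale1r //.
  by move=> x; rewrite scale1r [LHS]prod_split.
apply: (iso_ex (f := tens_fib)) => k.
  move=> z w e; have e1 : tensl phi N (prodfst _ _) z = tensl phi N (prodfst _ _) w := congr1 fst e.
  have e2 : tensl phi N (prodsnd _ _) z = tensl phi N (prodsnd _ _) w := congr1 snd e.
  by rewrite (split k z) (split k w) e1 e2.
move=> [z w]; exists (tensl phi N (prodinl (X k) (Y (k + 1))) z + tensl phi N (prodinr (X k) (Y (k + 1))) w).
have i0 (M M' : lmodType R) (h : {linear M -> M'}) y : h =1 (fun=> 0) -> tensl phi N h y = 0.
  move=> h0; move: y; apply: (tens_ext_add (g := fun=> 0)) => [y y'|y y'|x s].
  - exact: tenslD.
  - by rewrite addr0.
  - by rewrite tenslE h0 tmk0l.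
apply: (congr2 pair); rewrite tenslD !tensl_comp.
  by rewrite (@tensl_id _ _ phi _ N (lcomp _ _)) // i0 ?addr0.
by rewrite i0 // add0r tensl_id.
Qed.
End TensFib.
End TensorMaps.

Lemma fib_ex (A : comPzRingType) (X Y : complex A) (f : chain_map X Y) i :
  ex X i -> ex Y (i + 1) -> ex (fib f) i.
Proof.
move=> hX hY [x y] /fib_cycP /= [cx e]; have [w ew] := bd_succ (hX x cx) erefl.
apply/fib_bdP => /=; exists w; split=> //; apply: hY; apply: (cycP erefl).
by rewrite linearB cfun_comm ew e subrr.
Qed.
End BaseChange.

(** * Descent along a point of the spectrum *)

Section ResidueLift.
Variables (R S : comPzRingType) (phi : {rmorphism R -> S}) (Q : set S).
Hypotheses (hQ : is_ideal Q) (n1 : ~ Q 1) (hm : mSpec R (Spec_map phi Q)).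
Notation m := (Spec_map phi Q).

(** Injectivity of homology with coefficients in [R / m] under the unit: the splitting of
    [R / m -> S / Q] sends [X \otimes S] to [X] modulo boundaries and [m X], killing boundaries and
    multiples of [Q], and sends [x \otimes 1] to the class of [x]. *)
Lemma residue_lift (X : complex R) i (x : X i) k (y : tens_complex phi X S^o k) :
  inI Q ((tmk phi x (1 : S^o) : tens_complex phi X S^o i) - cdiff (tens_complex phi X S^o) k i y) ->
  exists k' x', inI m (x - cdiff X k' i x').
Proof.
have [W [hW QW W1 hc]] := residue_split hQ n1 hm.
have him : is_ideal m by case: hm.
(* [lam] is a choice of representatives and is linear only modulo [m]; [b] below therefore takes
   values in a quotient killed by [m]. *)
pose lam s := projT1 (cid (hc s)); have hlam s : W (s - phi (lam s)) by rewrite /lam; case: cid.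
have Wm c : W (phi c) -> m c.
  move=> Wc; apply: contrapT => nc; have [c' mc'] := mSpec_inv hm nc; apply: W1.
  have -> : 1 = phi (1 - c' * c) + phi c' * phi c by rewrite rmorphB rmorph1 rmorphM subrK.
  by apply: (submodD hW); [exact: QW|exact: (submodZ hW)].
pose N (z : X i) := exists b, bd b /\ inI m (z - b).
have him' M : submod (@inI R m M) := inI_submod M him.
have hb := bd_submod X i.
have hN : submod N.
  split; first by exists 0; rewrite subr0; split; [exact: submod0 hb|exact: submod0].
  move=> a z w [b [bb hz]] [b' [bb' hw]]; exists (a *: b + b'); split; first by case: hb => _; apply.
  have -> : a *: z + w - (a *: b + b') = a *: (z - b) + (w - b') by rewrite scalerBr; zmodule.
  by case: (him' (X i)) => _; apply.
have kill c z : m c -> c *: qcls hN z = 0.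
  move=> mc; rewrite -linearZ_LR; apply/qcls0; exists 0; rewrite subr0; split; last exact: inIZ.
  exact: submod0 hb.
have cong c c' z : m (c - c') -> c *: qcls hN z = c' *: qcls hN z.
  by move=> /(kill _ z); rewrite scalerBl => /eqP; rewrite subr_eq0 => /eqP.
pose b z s := lam s *: qcls hN z.
have bl a z w s : b (a *: z + w) s = a *: b z s + b w s.
  by rewrite /b linearP scalerDr !scalerA mulrC.
have br a z s t : b z (phi a * s + t) = a *: b z s + b z t.
  rewrite /b scalerA -scalerDl; apply/cong/Wm.
  set u := _ + t; have -> : phi (lam u - (a * lam s + lam t)) =
      phi a * (s - phi (lam s)) + (t - phi (lam t)) - (u - phi (lam u)).
    by rewrite rmorphB rmorphD rmorphM /u; ring.
  apply: (submodB hW); last exact: hlam.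
  by apply: (submodD hW); [exact: (submodZ hW)|exact: hlam].
pose L := rlift bl br.
have LD (z w : tens phi (X i) S^o) : L (z + w) = L z + L w by exact: (linearD L z w).
have LE z (s : S) : L (tmk phi z (s : S^o)) = lam s *: qcls hN z by exact: rliftE.
have L0 : L (0 : tens phi (X i) S^o) = 0 by exact: linear0.
have LB (z w : tens phi (X i) S^o) : L (z - w) = L z - L w by exact: (linearB L z w).
have L1 q (z : tens phi (X i) S^o) : Q q -> L (q *: z) = 0.
  move=> Qq; move: z; apply: tens_ind => [|z w hz hw|z s].
  - by rewrite scaler0.
  - by rewrite scalerDr LD hz hw addr0.
  - rewrite -tmkZr LE; apply/kill/Wm; have Qqs : Q (q * s) by rewrite mulrC; exact: idealZ.
    rewrite -[phi _](subKr (q * s)); apply: (submodB hW) => //; exact: QW.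
have L2 (z : tens_complex phi X S^o k) : L (cdiff (tens_complex phi X S^o) k i z) = 0.
  move: z; apply: (tens_ext_add (g := fun=> 0)) => [z w|z w|z s].
  - have -> : cdiff (tens_complex phi X S^o) k i (z + w) = cdiff (tens_complex phi X S^o) k i z
      + cdiff (tens_complex phi X S^o) k i w by exact: linearD.
    exact: LD.
  - by rewrite addr0.
  - rewrite [cdiff _ _ _ _]tenslE LE; have -> : qcls hN (cdiff X k i z) = 0; last exact: scaler0.
    by apply/qcls0; exists (cdiff X k i z); rewrite subrr; split; [exact: bd_diff|exact: submod0].
move=> [J [c [v [hcQ e]]]].
have Lsum (K : finType) (F : K -> tens phi (X i) S^o) : L (\sum_j F j) = \sum_j L (F j).
  by elim/big_rec2: _ => [|j z w _ <-]; [exact: L0|exact: LD].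
have := congr1 (fun z : tens phi (X i) S^o => L z) e; rewrite LB L2 subr0 Lsum big1 => [|j _]; last exact: L1.
rewrite LE => lx; have mlam : m (1 - lam 1) by apply: Wm; rewrite rmorphB rmorph1.
have : qcls hN x = 0 by rewrite -[qcls hN x]scale1r (cong _ _ _ mlam).
by move/qcls0 => [b' [[k' [x' <-]] h]]; exists k', x'.
Qed.
End ResidueLift.

Section QuotientComplex.
Variables (R : comPzRingType) (D : complex R) (N : forall i, D i -> Prop).
Arguments N : clear implicits.
Hypotheses (hN : forall i, submod (N i)) (dN : forall i j x, N i x -> N j (cdiff D i j x)).

Lemma quo_diff_subproof i j x : N i x -> lcomp (qcls (hN j)) (cdiff D i j) x = 0.
Proof. by move=> /dN nx; exact/qcls0. Qed.
Definition quo_diff i j : {linear quo (hN i) -> quo (hN j)} :=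
  qlift (hN i) (@quo_diff_subproof i j).
Lemma quo_diffE i j x : quo_diff i j (qcls (hN i) x) = qcls (hN j) (cdiff D i j x).
Proof. exact: qliftE. Qed.
Lemma quo_shape i j x : i != j + 1 -> quo_diff i j x = 0.
Proof.
by move=> ne; have [y <-] := qcls_surj x; rewrite quo_diffE cdiff_shape // linear0.
Qed.
Lemma quo_diffK i j k x : quo_diff j k (quo_diff i j x) = 0.
Proof. by have [y <-] := qcls_surj x; rewrite !quo_diffE cdiffK linear0. Qed.
Definition quo_complex : complex R := Complex quo_shape quo_diffK.
Definition quo_map : chain_map D quo_complex :=
  @ChainMap R D quo_complex (fun i => qcls (hN i)) quo_diffE.
End QuotientComplex.

Lemma chain_homE (R : comPzRingType) (X Y : complex R) (f : chain_map X Y) i x :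
  hfun (chain_map_hom f) i i x = f i x.
Proof. exact: castdeg_id. Qed.

Section Truncation.
Variable S : comPzRingType.

(** The identity of [D] becomes null-homotopic on the acyclic quotient of [D] by
    its truncation in degrees at least [a]. *)
Lemma K0_kills (Q : set S) (D : complex S) (a : int) : is_ideal Q -> K0 D ->
  (forall i : int, i < a -> ex D i) -> forall i : int, i < a -> kills Q i (id_chain D).
Proof.
move=> hQ hD hex.
(* The truncation keeps the cycles in degree [a], so the quotient [E] is [D a] modulo cycles in
   degree [a] and is exact there too. *)
pose N (i : int) (x : D i) := (i < a -> x = 0) /\ (i = a -> cyc x).
have hN i : submod (@N i).
  split; first by split=> // _; exact: submod0 (cyc_submod _ _).
  move=> c x y [x1 x2] [y1 y2]; split=> h; first by rewrite x1 // y1 // scaler0 addr0.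
  by case: (cyc_submod D i) => _; apply; [exact: x2|exact: y2].
have dN i j x : N i x -> N j (cdiff D i j x).
  move=> [x1 x2]; split=> [lt|_]; last exact: cyc_diff.
  have [e|ne] := eqVneq i (j + 1); last by rewrite cdiff_shape.
  have [e'|ne'] := eqVneq i a; first exact: x2.
  by rewrite x1 ?linear0 //; lia.
pose E := quo_complex hN dN.
have hE i : ex E i.
  move=> c; have [x <-] := qcls_surj c => cx; have [j ej] := degP i.
  have [/eqP|] := eqVneq (qcls (hN i) x) 0; first by move=> /eqP ->; exact: submod0 (bd_submod E i).
  move=> /eqP nx; have nNx : ~ N i x by move=> Nx; apply: nx; exact/qcls0.
  have [ja|ja] := ltP j a; last by case: nNx; split=> h; lia.
  have dx : cdiff D i j x = 0.
    have := cx j; rewrite [cdiff E i j _]quo_diffE => /qcls0 [h _]; exact: h.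
  have cx' : cyc x := cycP ej dx.
  have [e|ne] := eqVneq i a; first by case: nNx; split=> // h; lia.
  have [|y <-] := bd_succ (hex i _ x cx') erefl; first lia.
  by exists (i + 1), (qcls (hN (i + 1)) y); exact: quo_diffE.
have [|g hg] := (hom_bdP (chain_map_hom (quo_map hN dN)) erefl).1 (hD E hE 0 _ _).
  by move=> j; exact: chain_map_hom_cycle.
move=> i ia w dw; have [i' ei] := degP i.
have := hg i i' i (i + 1) w ei erefl; rewrite chain_homE [sgn S 0]expr0 scale1r.
have [y <-] := qcls_surj (hfun g i (i + 1) w); rewrite [cdiff E _ _ _]quo_diffE.
(* The homotopy is linear, so this term lies in [Q E]; since [N i] is zero for [i < a], the
   congruence lifts to [D i]. *)
have : inI Q (hfun g i' i (cdiff D i i' w)) by exact: (inI_linear (hlin g i' i) (dw i')).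
move=> [J [c [v [hc ->]]]].
pose v' j := projT1 (cid (qcls_surj (v j))).
have ev j : v j = qcls (hN i) (v' j) by rewrite /v'; case: cid.
have -> : \sum_j c j *: v j = qcls (hN i) (\sum_j c j *: v' j).
  by rewrite linear_sum; apply: eq_bigr => j _; rewrite ev linearZ_LR.
rewrite -linearD => /qclsP [/(_ ia) /eqP + _]; rewrite subr_eq0 => /eqP e.
exists (i + 1), y; exists J, c, v'; split=> //.
by rewrite -[id_chain D i w]/w {1}e addrC addKr.
Qed.
End Truncation.

(** * Descent at a maximal ideal *)

Section Descent.
Variables (R S : comPzRingType) (phi : {rmorphism R -> S}) (hR : noetherian R).
Notation T X := (tens_complex phi X S^o).

Lemma ideal_gens (m : set R) : is_ideal m -> exists xs : seq R,
  (forall x, x \in xs -> m x) /\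
  forall p, is_ideal p -> (forall x, x \in xs -> p x) -> m `<=` p.
Proof.
move=> hm; have [n [s [hs gs]]] := fgsub_ord (noeth_ideal hR hm).
exists [seq s j | j <- enum 'I_n]; split=> [x /mapP [j _ ->] //|p hp h x /gs [c ->]].
apply: (submod_sum (ideal_submod hp)) => j _; apply: (submodZ (ideal_submod hp)).
by apply: h; apply: map_f; rewrite mem_enum.
Qed.

Lemma qi_hfg (X Y : complex R) (f : chain_map X Y) i : qi f -> hfg Y i -> hfg X i.
Proof.
move=> [inj surj] [n [s [hs gs]]].
pose t j := projT1 (cid (surj i _ (hs j))).
have ht j : cyc (t j) /\ bd (f i (t j) - s j) by rewrite /t; case: cid.
exists n, t; split=> [j|x cx]; first by case: (ht j).
have [c bc] := gs _ (cfun_cyc f cx); exists c; apply: inj.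
  apply: submodB (cyc_submod _ _) _ _ cx _; apply: submod_sum (cyc_submod _ _) _ _ _ _ _ => j _.
  by apply: submodZ (cyc_submod _ _) _ _ _; case: (ht j).
rewrite linearB linear_sum (_ : _ - _ = (f i x - \sum_j c j *: s j) - \sum_j c j *: (f i (t j) - s j)).
  apply: submodB (bd_submod _ _) _ _ bc _; apply: submod_sum (bd_submod _ _) _ _ _ _ _ => j _.
  by apply: submodZ (bd_submod _ _) _ _ _; case: (ht j).
rewrite -addrA; congr (_ + _); rewrite -opprD -big_split /=; congr (- _).
by apply: eq_bigr => j _; rewrite linearZ_LR scalerBr subrKC.
Qed.

Section MaximalIdeal.
Variable Q : set S.
Hypotheses (hQ : is_ideal Q) (n1 : ~ Q 1) (hm : mSpec R (Spec_map phi Q)).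
Notation m := (Spec_map phi Q).

(** An identity map is its own [n]-fold composite, so vanishing modulo [m] in degrees below [a]
    makes the Koszul complex exact. The [size xs] degrees lost in [KK_kills] are regained in
    [KK_nakayama], and the bound stays at [a]. *)
Lemma inf_descent (C : complex R) (a : int) : (forall i, hfg C i) ->
  (forall i : int, i < a -> ex (Ltensor phi C) i) -> forall i : int, i < a -> exS (~` m) C i.
Proof.
move=> hC hex; have him : is_ideal m by case: hm.
have [xs [mxs gxs]] := ideal_gens him.
have [inj surj] := (qiP (res_map C)).1 (res_quasi_iso C).
pose X := res C; have kD := K0_kills hQ (@K0_tens R S phi _ (@K0_res R C)) hex.
have kX (i : int) : i < a -> kills m i (id_chain X).
  move=> ia w dw; have [|k [y hy]] := kD i ia (tmk phi w (1 : S^o) : T X i).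
    move=> j; rewrite [cdiff _ _ _ _]tenslE; have [J [c [v [hc ->]]]] := dw j.
    exists J, (fun l => phi (c l)), (fun l => tmk phi (v l) (1 : S^o)); split=> //.
    by rewrite tmk_suml; apply: eq_bigr => l _; rewrite tmkZl.
  exact: residue_lift hQ n1 hm _ _ _ _ _ hy.
have Xfree i : lfree (X i) by exact: lfree_free.
have [n hn] := nilpotent_kills hR hm gxs.
have Xhfg i : hfg X i := qi_hfg (conj inj surj) (hC i).
move=> i ia z cz.
have [x [cx bx]] := surj i z cz.
have hK : ex (KK xs X) (i - (size xs)%:Z).
  move=> w cw; apply: (hn _ _ _ (id_chain (KK xs X))) => //; [exact: KK_nice|exact: KK_nice|].
  elim: n {hn} => [//|n IH]; exists (KK xs X), (KKmap xs (id_chain X)), (id_chain (KK xs X)).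
  split=> // [||y]; [|exact: KK_nice|by rewrite KKmap_id].
  by apply: KK_kills => // j; rewrite subrK => ji; apply: kX; exact: le_lt_trans ji ia.
have := KK_nakayama hR (mSpec_prime hm) mxs Xhfg hK; rewrite subrK => /(_ x cx) [s [ns bs]].
exists s; split=> //; rewrite -[z](subKr (res_map C i x)) scalerBr.
apply: submodB (bd_submod _ _) _ _ _ _; first by rewrite -linearZ_LR; exact: cfun_bd.
exact: submodZ (bd_submod _ _) _ _ bx.
Qed.

(** [X'] is the fiber of [u : X -> Y], where [Y] is a free resolution over [R] of [X \otimes S] and
    [u] lifts the unit. [Y] is exact above [t], so [Y \otimes S] and hence [X' \otimes S] are exact
    above [t + n]. If [(p, q)] is a cycle of the fiber modulo [m], then [p \otimes 1] is a boundary
    modulo [Q], and [residue_lift] makes [p] a boundary modulo [m]. *)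
Lemma tower_step n : (forall W : complex R, (forall i, lfree (W i)) -> forall c : int,
    (forall i : int, c <= i -> ex W i) ->
    forall i : int, c + n%:Z <= i -> ex (T W) i) ->
  forall (X : complex R) (t : int), (forall i, lfree (X i)) -> K0 X ->
    (forall i : int, t < i -> ex (T X) i) ->
  exists (X' : complex R) (f : chain_map X' X), [/\ forall i, lfree (X' i), K0 X',
    forall i : int, t + n%:Z < i -> ex (T X') i,
    forall i, kills m i f & forall i, t < i -> lifts i f].
Proof.
move=> hn X t Xfree X0 hX.
pose Z := restr_complex phi (T X); pose Y := res Z; pose rho := res_map Z.
have qrho : qi rho := (qiP rho).1 (res_quasi_iso Z).
have Yfree i : lfree (Y i) by exact: lfree_free.
have Yex (i : int) : t < i -> ex Y i.
  move=> ti x cx; apply: qrho.1 => //; exact: (hX i ti) _ (cfun_cyc rho cx).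
have eta_cyc : cyc (chain_map_hom (tens_unit phi X) : Defs.Hom X Z 0).
  by move=> j; exact: chain_map_hom_cycle.
(* As [X] is K-projective, the unit lifts along [rho] up to the homotopy [h] obtained below. *)
have [v [cv bv]] := (K0_qi X0 qrho).2 0 _ eta_cyc.
have vc : forall i j x, cdiff Y i j (hlin v i i x) = hlin v j j (cdiff X i j x).
  move=> i j x; have [e|ne] := eqVneq i (j + 1); last by rewrite !cdiff_shape // linear0.
  have := (hom_cycP v).1 cv i j j i x e e; rewrite [sgn R 0]expr0 scale1r; exact.
pose u : chain_map X Y := @ChainMap R X Y (fun i => hlin v i i) vc.
have [h hh] := (hom_bdP _ erefl).1 bv.
exists (fib u), (fib_fst u); split.
- by move=> i; exact: lfree_prod.
- by apply: K0_fib => //; exact: K0_res.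
- move=> i ti; apply/tens_fib_ex; apply: fib_ex; first by apply: hX; lia.
  by apply: (hn Y Yfree (t + 1)) => [j tj|]; [apply: Yex|]; lia.
- move=> i [p q] dw.
  have dp j : inI m (cdiff X i j p) by exact: (inI_linear (prodfst _ _) (dw j)).
  have [i' ei] := degP i.
  have dq : inI m (u i p - cdiff Y (i + 1) i q).
    subst i; have := inI_linear (prodsnd _ _) (dw i'); rewrite fib_diffE; exact.
  have e1 := hh i i' i (i + 1) p ei erefl.
  rewrite hom_plus hom_opp chain_homE [sgn R 0]expr0 scale1r in e1.
  pose y : T X (i + 1) := rho (i + 1) q - hfun h i (i + 1) p.
  apply: (residue_lift hQ n1 hm (y := y)).
  have phQ (z : Z i) : inI m z -> inI Q (z : T X i).
    by move=> [J [c [w [hc ->]]]]; exists J, (fun l => phi (c l)), w.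
  have -> : (tmk phi p (1 : S^o) : T X i) - cdiff (T X) (i + 1) i y =
      (rho i (u i p - cdiff Y (i + 1) i q) : T X i) - hfun h i' i (cdiff X i i' p).
    have e2 : (rho i (u i p) : Z i) - tmk phi p (1 : S^o) =
        cdiff Z (i + 1) i (hfun h i (i + 1) p) + hfun h i' i (cdiff X i i' p) by exact: e1.
    have e3 : cdiff (T X) (i + 1) i y = (rho i (cdiff Y (i + 1) i q) : Z i) -
        cdiff Z (i + 1) i (hfun h i (i + 1) p).
      rewrite -cfun_comm; exact: (linearB (cdiff Z (i + 1) i)).
    have -> : (tmk phi p (1 : S^o) : Z i) = rho i (u i p) -
      (cdiff Z (i + 1) i (hfun h i (i + 1) p) + hfun h i' i (cdiff X i i' p)) by rewrite -e2 subKr.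
    by rewrite e3 (linearB (rho i)); zmodule.
  apply: submodB (inI_submod _ hQ) _ _ _ _; apply: phQ; first exact: inI_linear.
  exact: (inI_linear (hlin h i' i)).
- move=> i ti; apply: fib_fst_lifts; exact: Yex.
Qed.

(** In high degrees a cycle of the Koszul complex of [X] lifts to a cycle at the top of the tower,
    and the composite of the [k] maps of the tower sends cycles to boundaries. *)
Lemma bounded_descent : finite_flat_dim (restr S^o phi) -> exists c : nat,
  forall (X : complex R) (t : int), (forall i, lfree (X i)) -> K0 X -> (forall i, hfg X i) ->
    (forall i : int, t < i -> ex (T X) i) -> forall i : int, t + c%:Z < i -> exS (~` m) X i.
Proof.
move=> /flat_dim_ex [n hn]; have him : is_ideal m by case: hm.
have [xs [mxs gxs]] := ideal_gens him; have [k hk] := nilpotent_kills hR hm gxs.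
exists (k * n + size xs)%N => X t Xfree X0 Xhfg hX i ti.
have [X' [f [Xfree' _ _ chf lf]]] : exists (X' : complex R) (f : chain_map (KK xs X') (KK xs X)),
    [/\ forall i, lfree (X' i), K0 X', forall i : int, t + (k * n)%:Z < i -> ex (T X') i,
      forall i, mchain m xs i k f & forall i : int, t + (k * n)%:Z < i -> lifts i f].
  elim: k {hk ti} => [|k [X' [f [Xfree' X0' hX' chf lf]]]].
    exists X, (id_chain _); split=> // [j tj|j tj j' z w _ cw e].
      by apply: hX; lia.
    by exists z; split=> //; exact: esym e.
  have [X'' [g [Xfree'' X0'' hX'' kg lg]]] := tower_step hn Xfree' X0' hX'.
  exists X'', (comp_chain f (KKmap xs g)); split=> // [j tj|j|j tj].
  - by apply: hX''; move: tj; rewrite mulSn; lia.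
  - exists (KK xs X'), (KKmap xs g), f; split=> //; last exact: KK_nice.
    by apply: KK_kills.
  - have tj' : t + (k * n)%:Z < j by move: tj; rewrite mulSn; lia.
    apply: lifts_comp => j' ej; split; first exact: lf.
    exact: (KK_lifts (t := t + (k * n)%:Z)).
have hK : ex (KK xs X) (i - (size xs)%:Z).
  move=> z cz; have [j ej] := degP (i - (size xs)%:Z).
  have [|||z' [<- dz']] := lf (i - (size xs)%:Z) _ j z 0 ej.
  - lia.
  - exact: submod0 (cyc_submod _ _).
  - by rewrite linear0 cz.
  - by apply: hk => //; [exact: KK_nice|exact: KK_nice|exact: (cycP ej)].
by have := KK_nakayama hR (mSpec_prime hm) mxs Xhfg hK; rewrite subrK.
Qed.
End MaximalIdeal.
End Descent.

(** * Bounded below complexes of finite projective modules *)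

Section Extension.
Variables (R : comPzRingType) (D : set R) (X Y : complex R).
Hypotheses (D1 : D 1) (DM : forall a b, D a -> D b -> D (a * b)).
Hypothesis Xfgp : forall i, fgp (X i).

(** [f = d h] on [X i]. Only the values of [h] on [X i] and [X (i - 1)] enter, so [h] can be built
    one degree at a time. *)
Definition solves n k (f : Defs.Hom X Y n) (h : Defs.Hom X Y k) (i : int) : Prop :=
  forall (j : int) x, hfun f i j x = hfun (hom_diff X Y k n h) i j x.
Definition agrees n (h h' : Defs.Hom X Y n) (i : int) : Prop :=
  forall (j : int) x, hfun h i j x = hfun h' i j x.

Lemma solves_agrees n k (f : Defs.Hom X Y n) (h h' : Defs.Hom X Y k) (i i' : int) :
  k = n + 1 -> i = i' + 1 -> agrees h h' i -> agrees h h' i' -> solves f h i -> solves f h' i.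
Proof.
move=> ek ei h1 h2 hs j x; rewrite hs.
by rewrite (homdE _ _ ek ei erefl) (homdE _ _ ek ei erefl) h1 h2.
Qed.

Lemma prod_in (J : finType) (P : pred J) (s : J -> R) : (forall j, D (s j)) -> D (\prod_(j | P j) s j).
Proof. by move=> h; apply: (big_ind D). Qed.

(** The error [f - d h] is corrected on a dual basis of [X i1], each basis element with its own
    denominator; [s] is their product and [s' j] the cofactor. *)
Lemma ext_step n k (f : Defs.Hom X Y n) (h : Defs.Hom X Y k) (i1 : int) : k = n + 1 ->
  (forall i : int, i < i1 -> solves f h i) ->
  (forall x : X i1, exists s, D s /\ bd (s *: hfun (f - hom_diff X Y k n h) i1 (i1 + n) x)) ->
  exists s h', [/\ D s, forall i : int, i < i1 -> agrees (s *: h) h' i &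
    forall i : int, i <= i1 -> solves (s *: f) h' i].
Proof.
move=> ek hs ob; have [J [e [p hp]]] := Xfgp i1.
set g := f - _ in ob.
have ob' (j : J) : exists sy : R * Y (i1 + n + 1), D sy.1 /\
    cdiff Y (i1 + n + 1) (i1 + n) sy.2 = sy.1 *: hfun g i1 (i1 + n) (e j).
  by have [s [Ds b]] := ob (e j); have [y ey] := bd_succ b erefl; exists (s, y).
pose sy j := projT1 (cid (ob' j)).
have hsy j : D (sy j).1 /\ cdiff Y (i1 + n + 1) (i1 + n) (sy j).2 =
    (sy j).1 *: hfun g i1 (i1 + n) (e j) by rewrite /sy; case: cid.
pose s := \prod_j (sy j).1; pose s' j := \prod_(l | l != j) (sy l).1.
have es j : s = s' j * (sy j).1 by rewrite /s (bigD1 j) //= mulrC.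
pose corr i j (x : X i) : Y j :=
  if i == i1 then castdeg j (\sum_l (p l (castdeg i1 x) : R) *: (s' l *: (sy l).2)) else 0.
have corr_lin i j : linear (@corr i j).
  move=> a x y; rewrite /corr; case: eqP => [ei|_]; last by rewrite scaler0 addr0.
  subst i; rewrite !castdeg_id -castdeg_linear; congr (castdeg j _).
  rewrite scaler_sumr; apply: etrans; last exact: big_split.
  by apply: eq_bigr => l _; rewrite linearP [LHS]scalerDl -[_ *: (p l x : R^o)]/(a * p l x) -[in LHS]scalerA.
pose c : Defs.Hom X Y k := mkhom k corr_lin.
have c0 (i j : int) x : i != i1 -> hfun c i j x = 0.
  by move=> ne; rewrite /= /corr (negbTE ne); case: ifP.
have agr i : i < i1 -> agrees (s *: h) (s *: h + c) i.
  by move=> lt j x; rewrite [RHS]hom_plus c0 ?addr0 //; lia.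
have slt i : i < i1 -> solves (s *: f) (s *: h + c) i.
  move=> lt; have [i' ei] := degP i.
  apply: (solves_agrees ek ei); [by apply: agr|by apply: agr; lia|].
  by move=> j x; rewrite [LHS]hom_mult hs // [in RHS]linearZ_LR.
exists s, (s *: h + c); split=> // [|i]; first by apply: prod_in => j; case: (hsy j).
rewrite le_eqVlt => /predU1P [->|] //; last exact: slt.
have [i' ei] := degP i1; move=> j x.
have [ej|ne] := eqVneq j (i1 + n); last by rewrite !hfun_shape.
subst j; have dc : hfun (hom_diff X Y k n c) i1 (i1 + n) x = s *: hfun g i1 (i1 + n) x.
  rewrite (homdE _ _ ek ei erefl) [hfun c i' _ _]c0; last by rewrite ei; lia.
  rewrite scaler0 subr0 mkhomE ?ek ?addrA // /corr eqxx !castdeg_id linear_sum.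
  rewrite {2}[x]hp -[hfun g _ _ _]/(hlin g i1 (i1 + n) _) linear_sum scaler_sumr.
  apply: eq_bigr => l _; rewrite linearZ_LR [cdiff _ _ _ (s' l *: _)]linearZ_LR (proj2 (hsy l)).
  by rewrite [hlin g _ _ _]hfunZ !scalerA (es l); congr (_ *: _); ring.
have -> : hom_diff X Y k n (s *: h + c) = s *: hom_diff X Y k n h + hom_diff X Y k n c.
  by rewrite linearD linearZ_LR.
by rewrite [RHS]hom_plus dc /g !hom_mult hom_plus hom_opp -scalerDr subrKC.
Qed.

(** [f - d h] is a cycle of [Hom(X, Y)] that vanishes on [X (i1 - 1)]. *)
Lemma obstruction_cyc n k (f : Defs.Hom X Y n) (h : Defs.Hom X Y k) (i1 : int) : k = n + 1 ->
  cyc f -> (forall i : int, i < i1 -> solves f h i) ->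
  forall x : X i1, cyc (hfun (f - hom_diff X Y k n h) i1 (i1 + n) x).
Proof.
move=> ek cf hs x; set g := f - _; have cg : cyc (g : Defs.Hom X Y n).
  by apply: submodB (cyc_submod _ _) _ _ cf _; exact: (@cyc_diff _ (Defs.Hom X Y) k n h).
have [i' ei] := degP i1; have [j ej] := degP (i1 + n); apply: (cycP ej).
rewrite ((hom_cycP g).1 cg _ _ _ _ _ ei ej) /g hom_plus hom_opp hs ?subrr ?scaler0 //; lia.
Qed.

(** Every step may cost a denominator, whence the finite range of degrees. *)
Lemma ext_finite n k (f : Defs.Hom X Y n) (h : Defs.Hom X Y k) (i0 : int) (c : nat) : k = n + 1 ->
  cyc f -> (forall i : int, i < i0 -> solves f h i) ->
  (forall i : int, i0 <= i -> i < i0 + c%:Z -> exS D Y (i + n)) ->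
  exists s h', [/\ D s, forall i : int, i < i0 -> agrees (s *: h) h' i &
    forall i : int, i < i0 + c%:Z -> solves (s *: f) h' i].
Proof.
move=> ek cf hs; elim: c => [|c IH] hY.
  exists 1, h; split=> // [i _ j x|i ii j x]; first by rewrite scale1r.
  by rewrite scale1r; apply: hs; lia.
have [|s [h1 [Ds agr hs1]]] := IH; first by move=> i ii ii'; apply: hY; lia.
have cf1 : cyc (s *: f : Defs.Hom X Y n) by apply: submodZ (cyc_submod _ _) _ _ cf.
have [|s' [h2 [Ds' agr' hs2]]] := @ext_step n k (s *: f) h1 (i0 + c%:Z) ek hs1.
  move=> x; apply: hY; [lia|lia|exact: obstruction_cyc].
exists (s' * s), h2; split=> [|i ii j x|i ii]; first exact: DM.
  rewrite -agr'; last lia.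
  by rewrite hom_mult [RHS]hom_mult -agr // hom_mult scalerA.
have -> : (s' * s) *: f = s' *: (s *: f) by rewrite scalerA.
by apply: hs2; lia.
Qed.
End Extension.

Section InfiniteExtension.
Variables (R : comPzRingType) (X Y : complex R).
Hypothesis Xfgp : forall i, fgp (X i).

(** Without denominators the steps can go on forever: step [c] leaves the degrees below [i0 + c]
    unchanged, so the sequence [F] is eventually constant in each degree. *)
Lemma ext_infinite n k (f : Defs.Hom X Y n) (h : Defs.Hom X Y k) (i0 : int) : k = n + 1 ->
  cyc f -> (forall i : int, i < i0 -> solves f h i) ->
  (forall i : int, i0 <= i -> ex Y (i + n)) ->
  exists h' : Defs.Hom X Y k, (forall i : int, i < i0 -> agrees h h' i) /\ forall i, solves f h' i.
Proof.
move=> ek cf hs hY.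
pose good (c : nat) (h1 h2 : Defs.Hom X Y k) :=
  (forall i : int, i < i0 + c%:Z -> agrees h1 h2 i) /\
  (forall i : int, i < i0 + c.+1%:Z -> solves f h2 i).
pose F := fix F c : Defs.Hom X Y k := if c is c'.+1 then xget 0 [set h2 | good c' (F c') h2] else h.
have step c h1 : (forall i : int, i < i0 + c%:Z -> solves f h1 i) -> exists h2, good c h1 h2.
  move=> hs1; have [|||s [h2 [-> agr hs2]]] := @ext_step R [set 1] X Y _ _ Xfgp n k f h1 (i0 + c%:Z) ek hs1.
  - by [].
  - by move=> a b -> ->; rewrite mulr1.
  - move=> x; exists 1; rewrite scale1r; split=> //; apply: hY; [lia|exact: obstruction_cyc].
  exists h2; split=> [i ii|i ii].
    by move=> j x; rewrite -agr // hom_mult scale1r.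
  by move=> j x; rewrite -hs2 ?hom_mult ?scale1r //; lia.
have hF c : forall i : int, i < i0 + c%:Z -> solves f (F c) i.
  elim: c => [|c IH]; first by move=> i ii; apply: hs; lia.
  have /xgetPex /= : exists h2, [set h2 | good c (F c) h2] h2 := step c (F c) IH.
  by move=> /(_ 0) [_].
have hG c : good c (F c) (F c.+1).
  have /xgetPex /= : exists h2, [set h2 | good c (F c) h2] h2 := step c (F c) (hF c).
  by move=> /(_ 0).
have agr c d : forall i : int, i < i0 + c%:Z -> agrees (F c) (F (d + c)%N) i.
  elim: d => [//|d IH] i ii j x; rewrite IH // addSn.
  by apply: (hG (d + c)%N).1; rewrite PoszD; lia.
(* A stage from which [F] no longer changes in degree [i]; below [i0] it is the initial [h]. *)
pose ix (i : int) : nat := if i < i0 then 0%N else `|i - i0|.+1.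
have ixP i : i < i0 \/ i < i0 + (ix i)%:Z.
  rewrite /ix; case: ltP => [|h0]; [by left|right]; lia.
pose L : Defs.Hom X Y k := MkHom (fun i j => @hfun_linear R X Y k (F (ix i)) i j)
  (fun i j x => @hfun_shape R X Y k (F (ix i)) i j x).
have LE i c : (ix i <= c)%N -> agrees L (F c) i.
  move=> ic j x; rewrite -(subnK ic) -[LHS]/(hfun (F (ix i)) i j x).
  have [lt|] := ixP i; last by move=> ?; apply: agr.
  rewrite {1}/ix lt (agr 0%N (c - ix i + ix i)%N); last by lia.
  by rewrite addn0.
exists L; split=> [i ii j x|i].
  by rewrite -[RHS]/(hfun (F (ix i)) i j x) /ix ii.
have [i' ei] := degP i.
have sgn_agr c : (ix i <= c)%N -> (ix i' <= c)%N -> i < i0 + c%:Z -> solves f L i.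
  move=> ic ic' ii; apply: (solves_agrees ek ei) (hF c i ii) => j x; exact/esym/LE.
apply: (sgn_agr (maxn (ix i) (maxn (ix i') 1%N))); rewrite ?leq_maxl //.
  by rewrite (leq_trans (leq_maxl _ _) (leq_maxr _ _)).
have [lt|lt] := ixP i; last by apply: lt_le_trans lt _; rewrite lerD2l lez_nat leq_maxl.
by apply: lt_le_trans lt _; rewrite lerDl.
Qed.

End InfiniteExtension.

Lemma K0_bounded (R : comPzRingType) (X : complex R) (b : int) : (forall i, fgp (X i)) ->
  (forall i : int, i < b -> forall x : X i, x = 0) -> K0 X.
Proof.
move=> Xfgp X0 E hE n f cf.
have [||h [_ hs]] := @ext_infinite R X E Xfgp n (n + 1) f 0 b erefl cf.
- by move=> i ib j x; rewrite (X0 i ib x) !hfun0.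
- by [].
exists (n + 1), h; apply: hom_ext => i j x; exact/esym/hs.
Qed.

(** * Resolutions by finite projective modules *)

Section FiniteResolution.
Variables (R : comPzRingType) (hR : noetherian R) (C : complex R).

Definition lincomb_fun (K : finType) (M : lmodType R) (w : K -> M) (y : {ffun K -> R^o}) : M :=
  \sum_k (y k : R) *: w k.
Lemma lincomb_linear (K : finType) (M : lmodType R) (w : K -> M) : linear (lincomb_fun w).
Proof.
move=> a x y; rewrite /lincomb_fun scaler_sumr -big_split; apply: eq_bigr => k _.
by rewrite !ffunE scalerDl -scalerA.
Qed.
Definition lincomb (K : finType) (M : lmodType R) (w : K -> M) : {linear {ffun K -> R^o} -> M} :=
  mklin (lincomb_linear w).

Lemma zero_fgp : fgp {ffun 'I_0 -> R^o}. Proof. exact: fgp_ffun. Qed.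
Lemma ffun_ord0 (x : {ffun 'I_0 -> R^o}) : x = 0.
Proof. by apply/ffunP; case. Qed.

(** One degree of a resolution: a finite projective module, its cycles, and the augmentation. *)
Record stage (i : int) := Stage {
  stmod : lmodType R;
  stfgp : fgp stmod;
  stcyc : stmod -> Prop;
  stsub : submod stcyc;
  staug : {linear stmod -> C i}
}.
Arguments stcyc {i} s x.
Arguments staug {i} s.

Definition zero_stage i : stage i.
Proof.
refine (@Stage i _ zero_fgp (fun=> True) _ (\0 : {linear {ffun 'I_0 -> R^o} -> C i})).
by split.
Defined.

(** The last two clauses give injectivity on homology in degree [j] and surjectivity in degree
    [i]. *)
Definition connects i j (s : stage j) (s' : stage i) (D : {linear stmod s' -> stmod s}) : Prop :=
  [/\ forall y, stcyc s (D y), forall y, stcyc s' y <-> D y = 0,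
      forall y, cdiff C i j (staug s' y) = staug s (D y),
      forall x, stcyc s x -> bd (staug s x) -> exists y, D y = x
    & forall c : C i, cyc c -> exists y, stcyc s' y /\ bd (c - staug s' y)].
Definition follows i j (s : stage j) (s' : stage i) : Prop := exists D, @connects i j s s' D.

Lemma follows_zero (i j : int) : ex C i -> follows (zero_stage j) (zero_stage i).
Proof.
move=> hC; exists (\0 : {linear _ -> _}); split=> //=.
- by move=> y; rewrite linear0.
- by move=> x _ _; exists 0; rewrite [RHS]ffun_ord0 [LHS]ffun_ord0.
- by move=> c cc; exists 0; split=> //; rewrite subr0; exact: hC.
Qed.

(** Two families of free generators: one whose differentials generate the cycles of the previous
    stage that become boundaries in [C], and one that maps to generators of the homology of [C] in
    degree [i]. *)
Lemma follows_ex (i j : int) (s : stage j) : i = j + 1 -> hfg C i -> exists s' : stage i, follows s s'.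
Proof.
move=> ei [q [h [ch hh]]].
have [|K [w [hw gw]]] := @fgp_noeth _ _ hR (stfgp s) (fun x => stcyc s x /\ bd (staug s x)).
  split; first by split; [exact: submod0 (stsub s)|rewrite linear0; exact: submod0 (bd_submod _ _)].
  move=> a x y [cx bx] [cy bdy]; split; first exact: (stsub s).2.
  by rewrite linearP; exact: (bd_submod _ _).2.
have hc k : exists c : C i, cdiff C i j c = staug s (w k) by apply: bd_succ ei; case: (hw k).
pose c k := projT1 (cid (hc k)).
have cE k : cdiff C i j (c k) = staug s (w k) by rewrite /c; case: cid.
pose M := ({ffun K -> R^o} * {ffun 'I_q -> R^o})%type.
pose D : {linear M -> stmod s} := lcomp (lincomb w) (prodfst _ _).
have El : linear (fun y : M => lincomb c y.1 + lincomb h y.2).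
  by move=> a x y; rewrite !linearP scalerDr addrACA.
have Zs : submod (fun y => D y = 0).
  by split=> [|a x y ex ey]; [exact: linear0|rewrite linearP ex ey scaler0 addr0].
exists (@Stage i M (fgp_prod (@fgp_ffun _ _) (@fgp_ffun _ _)) _ Zs (mklin El)), D; split=> //.
- move=> y; apply: submod_sum => [|k _]; first exact: stsub.
  by apply: submodZ; [exact: stsub|case: (hw k)].
- move=> y; rewrite -[staug _ y]/(lincomb c y.1 + lincomb h y.2) linearD.
  rewrite [X in _ + X](_ : _ = 0) ?addr0.
    by rewrite !linear_sum; apply: eq_bigr => k _; rewrite !linearZ_LR cE.
  by rewrite linear_sum big1 // => k _; rewrite linearZ_LR ch scaler0.
- move=> x zx bx; have [y ->] := gw x (conj zx bx); exists ([ffun k => y k], 0).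
  by apply: eq_bigr => k _; rewrite ffunE.
- move=> z cz; have [y by'] := hh z cz; exists (0, [ffun k => y k]); split.
    exact: linear0 (lincomb w).
  rewrite -[staug _ _]/(lincomb c 0 + lincomb h [ffun k => y k]) linear0 add0r.
  by congr (bd (_ - _)): by'; apply: eq_bigr => k _; rewrite ffunE.
Qed.

Definition cast_stage i j (s : stage i) : stage j :=
  if i =P j is ReflectT e then eq_rect i stage s j e else zero_stage j.
Lemma cast_stage_id i (s : stage i) : cast_stage i s = s.
Proof. by rewrite /cast_stage; case: eqP => // e; rewrite (eq_axiomK e). Qed.
Lemma cast_stage_ne i j (s : stage i) : i != j -> cast_stage j s = zero_stage j.
Proof. by rewrite /cast_stage; case: eqP. Qed.
Lemma cast_stage_zero i j : cast_stage j (zero_stage i) = zero_stage j.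
Proof.
by have [e|ne] := eqVneq i j; [subst j; exact: cast_stage_id|exact: cast_stage_ne].
Qed.

Lemma finite_resolution (a : int) : (forall i, hfg C i) -> (forall i : int, i < a -> ex C i) ->
  exists (P : complex R) (e : chain_map P C),
    [/\ forall i, fgp (P i), forall i : int, i < a -> forall x : P i, x = 0 & qi e].
Proof.
move=> hC hE; pose b := a - 1.
have step n (s : stage (b + n%:Z)) : exists s' : stage (b + n.+1%:Z), follows s s'.
  by apply: follows_ex => //; lia.
pose st := fix st n : stage (b + n%:Z) :=
  if n is n'.+1 then projT1 (cid (step n' (st n'))) else zero_stage (b + 0%:Z).
have stS n : follows (st n) (st n.+1) by rewrite /=; case: (cid (step n (st n))).
(* For [i < b] the degrees do not match and the cast returns the zero stage, so one formula covers
   all integers. *)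
pose S i : stage i := cast_stage i (st `|i - b|%N).
have S0 (i : int) : i <= b -> S i = zero_stage i.
  move=> ib; have [e|ne] := eqVneq i b; last by apply: cast_stage_ne; lia.
  subst i; rewrite /S; have : `|b - b|%N = 0%N by rewrite subrr.
  by case: `|b - b|%N => // _; exact: cast_stage_zero.
have SE n : S (b + n%:Z) = st n.
  have h m : m = n -> cast_stage (b + n%:Z) (st m) = st n by move=> ->; exact: cast_stage_id.
  by apply: h; lia.
have SS (i j : int) : i = j + 1 -> follows (S j) (S i).
  move=> ei; have [jb|jb] := leP b j.
    have [n en] : exists n : nat, j = b + n%:Z by exists `|j - b|%N; lia.
    have en' : i = b + n.+1%:Z by lia.
    by clear ei; subst i j; rewrite !SE.
  by rewrite !S0; [apply: follows_zero; apply: hE; lia|lia|lia].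
have hD (i j : int) : exists D : {linear stmod (S i) -> stmod (S j)}, (i != j + 1 -> forall x, D x = 0) /\
    (i = j + 1 -> connects D).
  have [e|ne] := eqVneq i (j + 1).
    by have [D hD] := SS i j e; exists D.
  by exists (\0 : {linear _ -> _}); split=> // e; rewrite e eqxx in ne.
pose D i j := projT1 (cid (hD i j)).
have D0 (i j : int) x : i != j + 1 -> D i j x = 0.
  by move=> ne; apply: (projT2 (cid (hD i j))).1.
have DE (i j : int) : i = j + 1 -> connects (D i j).
    exact: (projT2 (cid (hD i j))).2.
have DK i j k x : D j k (D i j x) = 0.
  have [ei|ne] := eqVneq i (j + 1); last by rewrite [D i j x]D0 // linear0.
  have [ej|ne] := eqVneq j (k + 1); last exact: D0.
  by have [h _ _ _ _] := DE i j ei; have [_ h' _ _ _] := DE j k ej; exact: (h' _).1 (h x).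
pose P := Complex D0 DK.
have comm i j x : cdiff C i j (staug (S i) x) = staug (S j) (cdiff P i j x).
  have [ei|ne] := eqVneq i (j + 1); last by rewrite !cdiff_shape // linear0.
  by have [_ _ h _ _] := DE i j ei; exact: h.
exists P, (@ChainMap R P C (fun i => staug (S i)) comm); split.
- by move=> i; exact: stfgp.
- move=> i ia; rewrite -[P i]/(stmod (S i)) S0; last lia.
  by move=> x; exact: ffun_ord0.
- have Z i (x : P i) : cyc x -> stcyc (S i) x.
    by have [j ej] := degP i => cx; have [_ h _ _ _] := DE i j ej; exact: (h x).2 (cx j).
  split=> i x cx.
    move=> bx; have [_ _ _ h _] := DE (i + 1) i erefl; have [y <-] := h x (Z _ _ cx) bx.
    exact: (@bd_diff _ P).
  have [j ej] := degP i; have [_ h1 _ _ h] := DE i j ej; have [y [zy by']] := h x cx.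
  exists y; split; first exact: (@cycP _ P i j y ej ((h1 y).1 zy)).
  by rewrite -opprB; apply: submodN by'; exact: bd_submod.
Qed.
End FiniteResolution.

(** * Homotopy equivalences and homothety maps *)

Section HomotopyEquivalences.
Variable R : comPzRingType.
Implicit Types P Q X Y Z : complex R.

Lemma qi_comp X Y Z (f : chain_map X Y) (g : chain_map Y Z) (h : chain_map X Z) :
  (forall i x, h i x = g i (f i x)) -> qi g -> (qi f <-> qi h).
Proof.
move=> e [ig sg]; split=> [[jf sf]|[jh sh]]; split=> i x cx.
- by rewrite e => /ig - /(_ (cfun_cyc f cx)); exact: jf.
- have [y [cy by1]] := sg i x cx; have [z [cz bz]] := sf i y cy.
  exists z; split=> //; rewrite e.
  have -> : g i (f i z) - x = g i (f i z - y) + (g i y - x) by rewrite linearB; zmodule.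
  by apply: (submodD (bd_submod _ _)) => //; exact: cfun_bd.
- by move=> /(cfun_bd g); rewrite -e; exact: jh.
- have [z [cz bz]] := sh i _ (cfun_cyc g cx); exists z; split=> //; apply: ig.
    by apply: (submodB (cyc_submod _ _)) => //; exact: cfun_cyc.
  by rewrite linearB -e.
Qed.

Lemma qi_ex X Y (f : chain_map X Y) i : qi f -> (ex X i <-> ex Y i).
Proof.
move=> [jf sf]; split=> h x cx.
  have [y [cy b]] := sf i x cx; rewrite -[x](subKr (f i y)).
  by apply: (submodB (bd_submod _ _)) => //; exact/cfun_bd/h.
by apply: jf => //; apply: h; exact: cfun_cyc.
Qed.

Definition homotopic X Y (f g : chain_map X Y) : Prop :=
  exists h : Defs.hom X Y 1, forall (i i' k : int) (x : X i), i = i' + 1 -> k = i + 1 ->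
    f i x - g i x = cdiff Y k i (hfun h i k x) + hfun h i' i (cdiff X i i' x).

Lemma chain_map_hom_cyc X Y (f : chain_map X Y) : cyc (chain_map_hom f : Defs.Hom X Y 0).
Proof. by move=> j; exact: chain_map_hom_cycle. Qed.

Lemma homotopicP X Y (f g : chain_map X Y) :
  homotopic f g <-> bd (chain_map_hom f - chain_map_hom g : Defs.Hom X Y 0).
Proof.
split=> [[h hh]|/(hom_bdP _ (erefl (0 + 1))) [h hh]].
  apply/(hom_bdP _ (erefl (0 + 1))); exists h => i i' j j' x ei ej.
  have [e|ne] := eqVneq i j.
    subst j; rewrite hom_plus hom_opp !chain_homE (hh _ _ _ _ ei ej).
    by rewrite /sgn expr0 scale1r.
  rewrite hfun_shape; last by rewrite addr0 eq_sym.
  rewrite [hfun h i j' _]hfun_shape ?linear0; last by rewrite ej (inj_eq (addIr 1)) eq_sym.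
  by rewrite hfun_shape ?scaler0 ?addr0 // -[i' + _]ei eq_sym.
exists h => i i' k x ei ek; have := hh i i' i k x ei ek.
by rewrite hom_plus hom_opp !chain_homE /sgn expr0 scale1r.
Qed.

Lemma homotopic_bd X Y (f g : chain_map X Y) i (x : X i) : homotopic f g -> cyc x -> bd (f i x - g i x).
Proof.
move=> [h hh] cx; have [i' ei] := degP i.
by rewrite (hh _ _ _ x ei erefl) cx hfun0 addr0; exact: bd_diff.
Qed.

Lemma cyc_chain X Y (v : Defs.Hom X Y 0) : cyc v ->
  exists f : chain_map X Y, forall i x, f i x = hfun v i i x.
Proof.
move=> /hom_cycP cv; have l i : linear (fun x : X i => hfun v i i x) by move=> a x y; exact: hfunP.
suff c i j x : cdiff Y i j (mklin (l i) x) = mklin (l j) (cdiff X i j x).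
  by exists (ChainMap c).
have [e|ne] := eqVneq i (j + 1); last by rewrite !cdiff_shape // linear0.
by have := cv _ _ _ _ x e e; rewrite /sgn expr0 scale1r.
Qed.

Lemma lift_qi P Y Q (f : chain_map P Y) (g : chain_map Q Y) : K0 Q -> qi f ->
  exists v : chain_map Q P, homotopic (comp_chain f v) g.
Proof.
move=> kQ hf; have [_ /(_ 0 _ (chain_map_hom_cyc g))] := K0_qi kQ hf.
move=> [v [cv b]]; have [v' ev] := cyc_chain cv; exists v'; apply/homotopicP.
congr bd: b; congr (_ - _); apply: hom_eqP => i j x; rewrite addr0 => ej; subst j.
rewrite chain_homE -[LHS]/(f i (hfun v i i x)) -ev //.
Qed.

Lemma homotopic_lift P Y Q (f : chain_map P Y) (u v : chain_map Q P) : K0 Q -> qi f ->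
  homotopic (comp_chain f u) (comp_chain f v) -> homotopic u v.
Proof.
move=> kQ hf /homotopicP b; apply/homotopicP; have [j _] := K0_qi kQ hf; apply: j.
  by apply: (submodB (cyc_submod _ _)); exact: chain_map_hom_cyc.
congr bd: b; apply: hom_eqP => i j x; rewrite addr0 => ej; subst j.
rewrite -[RHS]/(f i (hfun (chain_map_hom u - chain_map_hom v) i i x)).
by rewrite !hom_plus !hom_opp !chain_homE linearB.
Qed.

Lemma homotopic_qi X Y (f g : chain_map X Y) : homotopic f g -> qi f -> qi g.
Proof.
move=> hfg' [jf sf]; split=> i x cx.
  move=> b; apply: jf => //; rewrite -[f i x](subrK (g i x)).
  by apply: (submodD (bd_submod _ _)) => //; exact: homotopic_bd.
have [y [cy b]] := sf i x cx; exists y; split=> //.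
have -> : g i y - x = (f i y - x) - (f i y - g i y) by zmodule.
by apply: (submodB (bd_submod _ _)) => //; exact: homotopic_bd.
Qed.

Lemma homotopic_sym X Y (f g : chain_map X Y) : homotopic f g -> homotopic g f.
Proof.
move=> /homotopicP b; apply/homotopicP; rewrite -opprB.
by apply: submodN b; exact: bd_submod.
Qed.

Lemma homotopic_pre X Y Z (f g : chain_map X Y) n (p : Defs.Hom Y Z n) : homotopic f g -> cyc p ->
  bd (homL Z f n p - homL Z g n p).
Proof.
move=> [h hh] /hom_cycP cp.
have l i j : linear (fun x : X i => sgn R n *: hfun p (i + 1) j (hfun h i (i + 1) x)).
  by move=> a x y; rewrite !hfunP scalerDr !scalerA [_ * a]mulrC.
apply/(hom_bdP _ erefl); exists (mkhom (n + 1) l) => i i' j j' x ei ej.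
have [e|ne] := eqVneq j (i + n); last first.
  rewrite hfun_shape // [X in cdiff _ _ _ X]hfun_shape; last first.
    by rewrite ej addrA (inj_eq (addIr 1)).
  by rewrite linear0 hfun_shape ?scaler0 ?addr0 //; move: ne; rewrite ei -!addrA [1 + n]addrC.
rewrite !mkhomE; [|by rewrite e ei -!addrA [1 + n]addrC|by rewrite ej e addrA].
rewrite hom_plus hom_opp -[LHS]/(hfun p i j (f i x) - hfun p i j (g i x)) -hfunB.
rewrite (hh _ _ _ x ei erefl) hfunD linearZ_LR (cp _ _ _ _ _ erefl ej) !scalerA.
have s1 : sgn R n * sgn R n = 1 by rewrite /sgn -exprD addnn -mul2n exprM sqrrN !expr1n.
by rewrite s1 !scale1r -ei.
Qed.

(** The identity of [P] lifts along [v] to [w]; then [w v] and the identity of [Q] agree up to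
    homotopy after composition with [v], hence before it. *)
Lemma K0_inverse P Q (v : chain_map Q P) : K0 P -> K0 Q -> qi v ->
  exists w : chain_map P Q, homotopic (comp_chain v w) (id_chain P) /\
    homotopic (comp_chain w v) (id_chain Q).
Proof.
move=> kP kQ hv; have [w hw] := lift_qi (id_chain P) kP hv; exists w; split=> //.
apply: (homotopic_lift kQ hv); case: hw => h hh.
have l i j : linear (fun x : Q i => hfun h i j (v i x)) by move=> a x y; rewrite linearP hfunP.
exists (mkhom 1 l) => i i' k x ei ek.
by rewrite !mkhomE // -?ei // -(cfun_comm v) -(hh _ _ _ _ ei ek).
Qed.

Lemma homL_comp P Q Z Y (v : chain_map Q P) (w : chain_map Z Q) n (f : Defs.Hom P Y n) :
  homL Y w n (homL Y v n f) = homL Y (comp_chain v w) n f.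
Proof. exact: hom_ext. Qed.
Lemma homL_id P Y n (f : Defs.Hom P Y n) : homL Y (id_chain P) n f = f.
Proof. exact: hom_ext. Qed.

Lemma homL_qi P Q Y (v : chain_map Q P) : K0 P -> K0 Q -> qi v -> qi (homL Y v).
Proof.
move=> kP kQ hv; have [w [h1 h2]] := K0_inverse kP kQ hv; split=> n f cf.
  move=> /(cfun_bd (homL Y w)) b; rewrite -[f]homL_id -(subKr (homL Y (comp_chain v w) n f) (homL Y _ n f)).
  apply: (submodB (bd_submod _ _)); first by rewrite -homL_comp.
  exact: homotopic_pre.
exists (homL Y w n f); split; first exact: cfun_cyc.
by rewrite homL_comp -[X in _ - X]homL_id; exact: homotopic_pre.
Qed.
End HomotopyEquivalences.

Section HomothetyMaps.
Variable R : comPzRingType.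
Implicit Types P Q X Y Z : complex R.

Section Map.
Variables (P Y : complex R) (u : chain_map P Y).
(** An arbitrary chain map replaces the augmentation, so that different resolutions can be compared;
    at [res_map C] this is [homothety C]. *)
Definition hmt_fun (i : int) : conc R^o i -> Defs.Hom P Y i :=
  match i return conc R^o i -> Defs.Hom P Y i with
  | Posz 0 => fun a => (a : R) *: chain_map_hom u
  | _ => fun _ => 0
  end.
Lemma hmt_linear i : linear (@hmt_fun i).
Proof.
by case: i => [[|i]|i] a x y /=; rewrite ?scaler0 ?addr0 // scalerDl scalerA.
Qed.
Lemma hmt_comm i j x : cdiff (Defs.Hom P Y) i j (mklin (@hmt_linear i) x) =
  mklin (@hmt_linear j) (cdiff (conc R^o) i j x).
Proof.
rewrite [cdiff (conc _) _ _ _]/= linear0.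
case: i x => [[|i]|i] x; [|exact: linear0..].
apply: etrans (linearZ_LR (hom_diff P Y 0 j) (x : R) _) _.
by rewrite chain_map_hom_cycle scaler0.
Qed.
Definition hmt : chain_map (conc R^o) (Defs.Hom P Y) :=
  @ChainMap R (conc R^o) (Defs.Hom P Y) (fun i => mklin (@hmt_linear i)) hmt_comm.
End Map.

Lemma hmt_ext P Y (u v : chain_map P Y) n a : (forall i x, u i x = v i x) -> hmt u n a = hmt v n a.
Proof.
move=> e; case: n a => [[|n]|n] a //; congr (_ *: _).
by apply: hom_ext => i j x; rewrite /= e.
Qed.

Lemma hmt_homR P Y Z (f : chain_map Y Z) (u : chain_map P Y) n a :
  homR P f n (hmt u n a) = hmt (comp_chain f u) n a.
Proof.
apply: hom_ext => i j x; rewrite -[LHS]/(f j (hfun (hmt u n a) i j x)).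
case: n a => [[|n]|n] a; [|exact: linear0..].
rewrite -[hfun (hmt u 0 a) _ _ _]/((a : R) *: hfun (chain_map_hom u) i j x) linearZ_LR.
rewrite -[RHS]/((a : R) *: hfun (chain_map_hom (comp_chain f u)) i j x); congr (_ *: _).
have [e|ne] := eqVneq j (i + 0); last by rewrite !hfun_shape // linear0.
by rewrite addr0 in e; subst j; rewrite !chain_homE.
Qed.
Lemma hmt_homL P Q Y (v : chain_map Q P) (u : chain_map P Y) n a :
  homL Y v n (hmt u n a) = hmt (comp_chain u v) n a.
Proof.
apply: hom_ext => i j x; rewrite -[LHS]/(hfun (hmt u n a) i j (v i x)).
by case: n a => [[|n]|n] a.
Qed.

Definition sd P : Prop := qi (hmt (id_chain P)).

Lemma sd_qi P Y (f : chain_map P Y) : K0 P -> qi f -> sd P <-> qi (hmt f).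
Proof. by move=> kP hf; apply: qi_comp (K0_qi kP hf) => n a; rewrite hmt_homR; exact: hmt_ext. Qed.

Lemma sd_equiv P Q (v : chain_map Q P) : K0 P -> K0 Q -> qi v -> sd Q <-> sd P.
Proof.
move=> kP kQ hv; apply: iff_trans (sd_qi kQ hv) _; apply: iff_sym.
by apply: qi_comp (homL_qi _ kP kQ hv) => n a; rewrite hmt_homL; exact: hmt_ext.
Qed.

(** The augmentation of [res C] lifts to a quasi-isomorphism [res C -> P] of K-projective complexes,
    along which [sd] is invariant. *)
Lemma sd_homothety P (C : complex R) (f : chain_map P C) : K0 P -> qi f ->
  sd P <-> quasi_iso (homothety C).
Proof.
move=> kP hf; have hr : qi (res_map C) by apply/qiP; exact: res_quasi_iso.
have [v hv] := lift_qi (res_map C) (@K0_res _ C) hf.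
have qv : qi v.
  apply/(qi_comp (h := comp_chain f v) _ hf) => //.
  exact: homotopic_qi (homotopic_sym hv) hr.
apply: iff_trans (iff_sym (sd_equiv kP (@K0_res _ C) qv)) _.
apply: iff_trans (sd_qi (@K0_res _ C) hr) _.
exact: iff_sym (qiP (homothety C)).
Qed.
End HomothetyMaps.

Section TensorHomotopies.
Variables (R S : comPzRingType) (phi : {rmorphism R -> S}).
Notation T X := (tens_complex phi X S^o).

Lemma tens_homotopic_bd (X Y : complex R) (f g : chain_map X Y) i (z : T X i) :
  homotopic f g -> cyc z -> bd (tens_map phi S^o f i z - tens_map phi S^o g i z).
Proof.
move=> [h hh] cz; have [i' ei] := degP i.
exists (i + 1), (tensl phi S^o (hlin h i (i + 1)) z); rewrite tens_diffE tensl_comp.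
rewrite -[tens_map _ _ f i z]/(tensl phi S^o (f i) z) -[tens_map _ _ g i z]/(tensl phi S^o (g i) z).
pose F := lcomp (hlin h i' i) (cdiff X i i').
pose G := lcomp (cdiff Y (i + 1) i) (hlin h i (i + 1)).
have Fl : linear (fun x => G x + F x) by move=> a x y; rewrite !linearP scalerDr addrACA.
rewrite (@tensl_lin _ _ phi _ _ S^o (f i) (mklin Fl) (g i) 1 z); last first.
  by move=> x; rewrite scale1r -[LHS](subrK (g i x)) (hh _ _ _ x ei erefl).
rewrite (@tensl_lin _ _ phi _ _ S^o (mklin Fl) G F 1 z); last first.
  by move=> x; rewrite scale1r.
have -> : tensl phi S^o F z = 0.
  by rewrite -tensl_comp -[X in tensl phi S^o _ X]tens_diffE cz; exact: linear0.
by rewrite !rmorph1 !scale1r addr0 addrK.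
Qed.

Lemma comp_tens_map (X Y Z : complex R) (f : chain_map X Y) (g : chain_map Y Z) i z :
  tens_map phi S^o g i (tens_map phi S^o f i z) = tens_map phi S^o (comp_chain g f) i z.
Proof. exact: tensl_comp. Qed.

Lemma tens_map_qi (P Q : complex R) (v : chain_map Q P) : K0 P -> K0 Q -> qi v ->
  qi (tens_map phi S^o v).
Proof.
move=> kP kQ hv; have [w [h1 h2]] := K0_inverse kP kQ hv.
have idE (X : complex R) i (z : T X i) : tens_map phi S^o (id_chain X) i z = z by exact: tensl_id.
split=> i z cz.
  move=> /(cfun_bd (tens_map phi S^o w)); rewrite comp_tens_map => b.
  rewrite -[z](idE Q) -[X in bd X](subKr (tens_map phi S^o (comp_chain w v) i z)).
  by apply: (submodB (bd_submod _ _)) => //; exact: tens_homotopic_bd.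
exists (tens_map phi S^o w i z); split; first exact: cfun_cyc.
by rewrite comp_tens_map -[X in _ - X]idE; exact: tens_homotopic_bd.
Qed.
End TensorHomotopies.

(** * Truncated Hom complexes *)

Section TruncatedHom.
Variables (R : comPzRingType) (P Y : complex R) (N : int).

Definition low_zero n (f : Defs.Hom P Y n) : Prop :=
  forall (i j : int) x, i <= N -> hfun f i j x = 0.
Lemma low_zero_submod n : submod (@low_zero n).
Proof.
split=> [i j x _|a f g f0 g0 i j x iN] //.
by rewrite hom_plus hom_mult f0 // g0 // scaler0 addr0.
Qed.
(** The differential of [P] lowers degrees, so it preserves [P_{<= N}]. *)
Lemma low_zero_diff n m f : low_zero f -> low_zero (cdiff (Defs.Hom P Y) n m f).
Proof.
have [en|ne] := eqVneq n (m + 1); last first.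
  by move=> _; rewrite cdiff_shape //; exact: submod0 (low_zero_submod _).
move=> f0 i j x iN; have [i' ei] := degP i; apply: etrans (homdE _ _ en ei erefl) _.
by rewrite !f0 ?linear0 ?scaler0 ?oppr0 ?addr0 //; lia.
Qed.

(** The complex [Hom(P_{<= N}, Y)], as a quotient of [Hom(P, Y)]. *)
Definition homN : complex R := quo_complex low_zero_submod low_zero_diff.
Definition homq : chain_map (Defs.Hom P Y) homN := quo_map low_zero_submod low_zero_diff.

Lemma homq_surj n (c : homN n) : exists f, homq n f = c.
Proof. exact: qcls_surj. Qed.
Lemma homq_eq n f g : homq n f = homq n g <-> forall i : int, i <= N -> agrees f g i.
Proof.
apply: iff_trans (qclsP _ _ _) _; split=> [h i iN j x|h i j x iN].
  by have := h i j x iN; rewrite hom_plus hom_opp => /eqP; rewrite subr_eq0 => /eqP.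
by rewrite hom_plus hom_opp h ?subrr.
Qed.

Lemma homN_bdP n k f : k = n + 1 ->
  bd (homq n f) <-> exists h : Defs.Hom P Y k, forall i : int, i <= N -> solves f h i.
Proof.
move=> ek; split=> [b|[h hs]].
  have [c ec] := bd_succ b ek; have [h eh] := homq_surj c; exists h.
  by apply/homq_eq; rewrite -ec -eh cfun_comm.
exists k, (homq k h); rewrite cfun_comm; apply/homq_eq => i iN j x.
exact/esym/hs.
Qed.
Lemma homN_cycP n m f : n = m + 1 -> cyc (homq n f) <->
  forall i : int, i <= N -> solves (0 : Defs.Hom P Y m) f i.
Proof.
move=> en; split=> [/(_ m)|h].
  by rewrite cfun_comm -(linear0 (homq m)) => /homq_eq h i iN j x; exact/esym/h.
apply: (cycP en); rewrite cfun_comm -(linear0 (homq m)); apply/homq_eq => i iN j x.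
exact/esym/h.
Qed.

Lemma homN_zero a n (c : homN n) : (forall i : int, i < a -> forall x : P i, x = 0) ->
  (forall i : int, i < a -> forall x : Y i, x = 0) -> n < a - N -> c = 0.
Proof.
move=> P0 Y0 nN; have [f <-] := homq_surj c; rewrite -(linear0 (homq n)).
apply/homq_eq => i iN j x; have [ej|ne] := eqVneq j (i + n); last by rewrite !hfun_shape.
by rewrite [LHS]Y0 ?[RHS]Y0 //; lia.
Qed.

Section DualBasis.
Variables (a n : int) (P0 : forall i : int, i < a -> forall x : P i, x = 0).
Variables (J : int -> finType) (e : forall i, J i -> P i) (p : forall i, J i -> {linear P i -> R^o}).
Hypothesis hp : forall i x, x = \sum_j (p j x : R) *: e j :> P i.
Variables (K : int -> finType) (e' : forall i, K i -> Y i) (p' : forall i, K i -> {linear Y i -> R^o}).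
Hypothesis hp' : forall i x, x = \sum_k (p' k x : R) *: e' k :> Y i.

Definition homN_len : nat := if a <= N then `|N - a|.+1 else 0.
Definition homN_index : finType := {l : 'I_homN_len & (J (a + l%:Z) * K (a + l%:Z + n))%type}.

Definition unit_fun (d : int) (j : J d) (k : K (d + n)) (i i' : int) (x : P i) : Y i' :=
  if i == d then castdeg i' ((p j (castdeg d x) : R) *: e' k) else 0.
Lemma unit_fun_linear d (j : J d) (k : K (d + n)) i i' : linear (@unit_fun d j k i i').
Proof.
move=> b x y; rewrite /unit_fun; case: eqP => [ei|_]; last by rewrite scaler0 addr0.
subst i; rewrite !castdeg_id -castdeg_linear linearP; congr (castdeg i' _).
by rewrite scalerDl scalerA.
Qed.
Definition hom_unit d (j : J d) (k : K (d + n)) : Defs.hom P Y n := mkhom n (unit_fun_linear j k).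

Definition homN_basis (t : homN_index) : homN n :=
  homq n (hom_unit (tagged t).1 (tagged t).2).
Definition hom_coord d (j : J d) (k : K (d + n)) (f : Defs.Hom P Y n) : R^o :=
  p' k (hfun f d (d + n) (e j)).
Lemma hom_coord_linear d (j : J d) (k : K (d + n)) : linear (hom_coord j k).
Proof. by move=> b f g; rewrite /hom_coord -linearP. Qed.
Lemma hom_coord_low (t : homN_index) f : low_zero f ->
  mklin (hom_coord_linear (tagged t).1 (tagged t).2) f = 0.
Proof.
case: t => l [j k] f0; rewrite -[LHS]/(p' k (hfun f (a + l%:Z) (a + l%:Z + n) (e j))).
rewrite f0 ?linear0 //; have := ltn_ord l; rewrite {2}/homN_len; case: leP => //; lia.
Qed.
Definition homN_coord (t : homN_index) : {linear homN n -> R^o} :=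
  qlift (low_zero_submod n) (hom_coord_low t).
Lemma homN_coordE t f : homN_coord t (homq n f) = hom_coord (tagged t).1 (tagged t).2 f.
Proof. exact: qliftE. Qed.

(** Only the degrees from [a] to [N] matter, [homN_len] in number; in each, the maps
    [x -> p j x *: e' k] play the role of matrix units. *)
Lemma homN_dual c : c = \sum_t (homN_coord t c : R) *: homN_basis t.
Proof.
have [f <-] := homq_surj c.
pose g : Defs.Hom P Y n := \sum_t (homN_coord t (homq n f) : R) *: hom_unit (tagged t).1 (tagged t).2.
have -> : \sum_t (homN_coord t (homq n f) : R) *: homN_basis t = homq n g.
  by rewrite linear_sum; apply: eq_bigr => t _; rewrite linearZ_LR.
apply/homq_eq => i iN i' x.
have [ei'|ne] := eqVneq i' (i + n); last by rewrite !hfun_shape.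
have [ia|ia] := ltP i a; first by rewrite (P0 ia x) !hfun0.
have gE : hfun g i i' x = \sum_t (homN_coord t (homq n f) : R) *: hfun (hom_unit (tagged t).1 (tagged t).2) i i' x.
  by rewrite /g; elim/big_rec2: _ => // t y h _ <-.
have ll : (`|i - a| < homN_len)%N by rewrite /homN_len; case: leP; lia.
pose l := Ordinal ll; have el : i = a + l%:Z by rewrite /=; lia.
rewrite gE; clear ia iN gE; move: x; rewrite ei' el => x.
apply: etrans; last first.
  exact: (@sig_big_dep _ _ _ 'I_homN_len (fun l => (J (a + l%:Z) * K (a + l%:Z + n))%type) xpredT
    (fun=> xpredT) (fun l jk => (homN_coord (@Tagged _ l _ jk) (homq n f) : R) *:
       hfun (hom_unit jk.1 jk.2) (a + (val (Ordinal ll))%:Z) _ x)).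
rewrite (bigD1 l) // [X in _ = _ + X]big1 ?addr0 => [|l' nl].
  have h jk : hfun (hom_unit jk.1 jk.2) (a + l%:Z) (a + l%:Z + n) x = (p jk.1 x : R) *: e' jk.2.
    by rewrite mkhomE // /unit_fun eqxx !castdeg_id.
  rewrite [RHS](eq_bigr (fun jk => (hom_coord jk.1 jk.2 f * (p jk.1 x : R)) *: e' jk.2)); last first.
    by move=> jk _; rewrite homN_coordE h scalerA.
  rewrite -(pair_bigA _ (fun j k => (hom_coord j k f * (p j x : R)) *: e' k)) /=.
  rewrite {1}[x]hp -[LHS]/(hlin f _ _ _) linear_sum; apply: eq_bigr => j _.
  rewrite linearZ_LR {1}[hlin f _ _ _]hp' scaler_sumr; apply: eq_bigr => k _.
  by rewrite scalerA mulrC.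
apply: big1 => jk _; rewrite mkhomE // /unit_fun.
have /negbTE -> : a + l%:Z != a + l'%:Z by rewrite (inj_eq (addrI a)); apply: contraNneq nl => -[e0];
  apply/eqP/val_inj.
exact: scaler0.
Qed.
End DualBasis.
End TruncatedHom.

(** * Base change of fibers and truncated Hom complexes *)

Section BaseChangeCertificates.
Variables (R S : comPzRingType) (phi : {rmorphism R -> S}).
Notation T X := (tens_complex phi X S^o).

(** [B] is the base change of the finite projective module [A] along [j]. *)
Definition bcert (A : lmodType R) (B : lmodType S) (j : {linear A -> restr B phi}) : Prop :=
  exists (K : finType) (e : K -> A) (p : K -> {linear A -> R^o}) (q : K -> {linear B -> S^o}),
    [/\ forall x, x = \sum_k (p k x : R) *: e k,
        forall y : B, y = \sum_k (q k y : S) *: (j (e k) : B)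
      & forall k x, q k (j x) = phi (p k x)].

Lemma bcert_fgp A B j : @bcert A B j -> fgp A.
Proof. by move=> [K [e [p [q [h _ _]]]]]; exists K, e, p. Qed.

Lemma bcert_linear (A : lmodType R) (B : lmodType S) (j : {linear A -> restr B phi}) a x y :
  (j (a *: x + y) : B) = phi a *: (j x : B) + (j y : B).
Proof. exact: linearP. Qed.

Lemma bcert_bij A B j : @bcert A B j ->
  injective (extend (A := B) (bcert_linear j)) /\ forall y, exists z, extend (A := B) (bcert_linear j) z = y.
Proof.
move=> [K [e [p [q [hp hq qj]]]]]; set E := extend _.
have ED z w : E (z + w) = E z + E w by exact: (linearD E z w).
have EE x (s : S) : E (tmk phi x (s : S^o)) = s *: (j x : B) by exact: extendE.
pose F y : tens phi A S^o := \sum_k (q k y : S) *: tmk phi (e k) (1 : S^o).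
have EF y : E (F y) = y.
  rewrite [RHS]hq /F; have EZ s z : E (s *: z) = s *: E z by exact: linearZ_LR.
  have E0 : E 0 = 0 by exact: linear0.
  elim/big_rec2: _ => // k z w _ <-; by rewrite ED EZ EE scale1r.
have FE z : z = F (E z).
  move: z; apply: tens_ext_add => [//|z w|x s].
    rewrite ED /F; apply: etrans; last exact: big_split.
    by apply: eq_bigr => k _; rewrite linearD; exact: scalerDl.
  rewrite EE {1}[x]hp tmk_suml; apply: eq_bigr => k _.
  rewrite linearZ_LR -[s *: _ : S^o]/(s * (q k (j x) : S)) qj tmkZl.
  by rewrite mulrC -scalerA -tmk1.
by split=> [z w e1|y]; [rewrite (FE z) (FE w) e1|exists (F y)].
Qed.

Lemma bcert_ex (A : complex R) (B : complex S) (j : chain_map A (restr_complex phi B)) i :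
  (forall i, bcert (j i)) -> ex (T A) i <-> ex B i.
Proof.
move=> hj; pose E i : {linear T A i -> B i} := extend (A := B i) (bcert_linear (j i)).
have c i' k (z : T A i') : cdiff B i' k (E i' z) = E k (cdiff (T A) i' k z).
  move: z; apply: tens_ext_add => [z w|z w|x s].
  - have -> : E i' (z + w) = E i' z + E i' w by exact: (linearD (E i') z w).
    exact: linearD.
  - have -> : cdiff (T A) i' k (z + w) = cdiff (T A) i' k z + cdiff (T A) i' k w by exact: linearD.
    exact: (linearD (E k)).
  - rewrite [cdiff (T A) _ _ _]tenslE [E i' _]extendE [E k _]extendE linearZ_LR; congr (_ *: _).
    exact: (cfun_comm j).
apply: (iso_ex (f := ChainMap c)) => k; by have [h1 h2] := bcert_bij (hj k).
Qed.

Section Fiber.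
Variables (A A' : complex R) (B B' : complex S) (u : chain_map A A') (v : chain_map B B').
Variables (j : chain_map A (restr_complex phi B)) (j' : chain_map A' (restr_complex phi B')).
Hypothesis uv : forall i x, j' i (u i x) = v i (j i x).
Hypotheses (hj : forall i, bcert (j i)) (hj' : forall i, bcert (j' i)).

Definition fib_cert_fun i (z : fib u i) : restr_complex phi (fib v) i := (j i z.1, j' (i + 1) z.2).
Lemma fib_cert_linear i : linear (@fib_cert_fun i).
Proof. by move=> a x y; congr (_, _); [exact: (linearP (j i))|exact: (linearP (j' (i + 1)))]. Qed.
Lemma fib_cert_comm i k z : cdiff (restr_complex phi (fib v)) i k (mklin (@fib_cert_linear i) z) =
  mklin (@fib_cert_linear k) (cdiff (fib u) i k z).
Proof.
have [e|ne] := eqVneq i (k + 1); last by rewrite !cdiff_shape // linear0.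
subst i; rewrite !fib_diffE.
congr (_, _); first exact: (cfun_comm j).
rewrite -[RHS]/(j' (k + 1) (u (k + 1) z.1 - cdiff A' (k + 1 + 1) (k + 1) z.2)) linearB uv.
by congr (_ - _); exact: (cfun_comm j').
Qed.
Definition fib_cert : chain_map (fib u) (restr_complex phi (fib v)) :=
  @ChainMap R (fib u) (restr_complex phi (fib v)) (fun i => mklin (@fib_cert_linear i)) fib_cert_comm.

Lemma fib_bcert i : bcert (fib_cert i).
Proof.
have [K [e [p [q [h1 h2 h3]]]]] := hj i; have [K' [e' [p' [q' [h1' h2' h3']]]]] := hj' (i + 1).
exists (K + K')%type,
  (fun kk => match kk with inl k => prodinl _ _ (e k) | inr k => prodinr _ _ (e' k) end),
  (fun kk => match kk with inl k => lcomp (p k) (prodfst _ _) | inr k => lcomp (p' k) (prodsnd _ _) end),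
  (fun kk => match kk with inl k => lcomp (q k) (prodfst _ _) | inr k => lcomp (q' k) (prodsnd _ _) end).
split.
- move=> z; rewrite big_sumType {1}[z]prod_split {1}[prodfst _ _ z]h1 {1}[prodsnd _ _ z]h1'.
  by rewrite !linear_sum; congr (_ + _); apply: eq_bigr => k _; rewrite linearZ_LR.
- move=> z; rewrite big_sumType {1}[z]prod_split {1}[prodfst _ _ z]h2 {1}[prodsnd _ _ z]h2'.
  rewrite !linear_sum; congr (_ + _); apply: eq_bigr => k _; rewrite linearZ_LR.
    by congr (_ *: (_, _)); rewrite [RHS]linear0.
  by congr (_ *: (_, _)); rewrite [RHS]linear0.
- by case=> k z; [exact: h3|exact: h3'].
Qed.
End Fiber.

Definition conc_cert_fun (i : int) : conc R^o i -> restr_complex phi (conc S^o) i :=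
  match i return conc R^o i -> restr_complex phi (conc S^o) i with Posz 0 => phi | _ => fun=> 0 end.
Lemma conc_cert_linear i : linear (@conc_cert_fun i).
Proof.
case: i => [[|i]|i] a x y /=; rewrite ?scaler0 ?addr0 //.
exact: (etrans (rmorphD phi _ _) (congr1 (+%R^~ _) (rmorphM phi a x))).
Qed.
Lemma conc_cert_comm i k x : cdiff (restr_complex phi (conc S^o)) i k (mklin (@conc_cert_linear i) x) =
  mklin (@conc_cert_linear k) (cdiff (conc R^o) i k x).
Proof. by rewrite [cdiff (conc _) _ _ _]/= linear0. Qed.
Definition conc_cert : chain_map (conc R^o) (restr_complex phi (conc S^o)) :=
  @ChainMap R (conc R^o) (restr_complex phi (conc S^o)) (fun i => mklin (@conc_cert_linear i)) conc_cert_comm.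

Lemma conc_bcert i : bcert (conc_cert i).
Proof.
have [e|ne] := eqVneq i 0.
  subst i; exists 'I_1, (fun=> 1), (fun=> idfun), (fun=> idfun); split=> //.
  - by move=> x; rewrite big_ord1 -[RHS]/((x : R) * 1) mulr1.
  - by move=> x; rewrite big_ord1 -[RHS]/((x : S) * phi 1) rmorph1 mulr1.
exists 'I_0, (fun=> 0), (fun=> \0), (fun=> \0); split; [| |by case].
  by move=> x; rewrite big_ord0; exact: conc_zero.
by move=> x; rewrite big_ord0; exact: conc_zero.
Qed.

Lemma tens_cdiffE (X : complex R) i j x (s : S) :
  cdiff (T X) i j (tmk phi x (s : S^o)) = tmk phi (cdiff X i j x) (s : S^o).
Proof. exact: tenslE. Qed.

Section TruncatedHom.
Variables (P Y : complex R) (N : int).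

Section Map.
Variable n : int.
Definition thom (f : Defs.Hom P Y n) : Defs.Hom (T P) (T Y) n.
Proof.
refine (@MkHom S (T P) (T Y) n (fun i j => tensl phi S^o (hlin f i j)) _ _).
  by move=> i j a x y; exact: (linearP (tensl phi S^o (hlin f i j))).
move=> i j x ne; move: x; apply: (tens_ext_add (g := fun=> 0)) => [z w|z w|x s].
- exact: tenslD.
- by rewrite addr0.
- by rewrite tenslE -[hlin f i j x]/(hfun f i j x) hfun_shape // tmk0l.
Defined.
Lemma thomE f i j x (s : S) : hfun (thom f) i j (tmk phi x (s : S^o)) = tmk phi (hfun f i j x) (s : S^o).
Proof. exact: tenslE. Qed.

Lemma hom_tens_ext (f g : Defs.Hom (T P) (T Y) n) (i j : int) :
  (forall x, hfun f i j (tmk phi x (1 : S^o)) = hfun g i j (tmk phi x (1 : S^o))) ->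
  forall z, hfun f i j z = hfun g i j z.
Proof.
move=> h; apply: tens_ext_add => [z w|z w|x s]; rewrite ?hfunD //.
by rewrite tmk1 !hfunZ h.
Qed.

Lemma thom_linear : linear (thom : Defs.Hom P Y n -> restr (Defs.Hom (T P) (T Y) n) phi).
Proof.
move=> a f g; apply: hom_ext => i j; apply: hom_tens_ext => x.
by rewrite thomE hom_plus hom_mult tmkPl -!thomE.
Qed.
Lemma thom_low f : low_zero N f ->
  lcomp (restr_map phi (homq (T P) (T Y) N n)) (mklin thom_linear) f = 0.
Proof.
move=> f0; apply: etrans (linear0 (homq (T P) (T Y) N n)); apply/homq_eq => i iN j.
by apply: hom_tens_ext => x; rewrite thomE f0 // tmk0l.
Qed.
Definition homN_cert_map : {linear homN P Y N n -> restr (homN (T P) (T Y) N n) phi} :=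
  qlift (low_zero_submod P Y N n) thom_low.
Lemma homN_certE f : homN_cert_map (homq P Y N n f) = homq (T P) (T Y) N n (thom f).
Proof. exact: qliftE. Qed.
End Map.

Lemma thom_comm n m f : thom (cdiff (Defs.Hom P Y) n m f) = cdiff (Defs.Hom (T P) (T Y)) n m (thom f).
Proof.
have [en|ne] := eqVneq n (m + 1); last first.
  by rewrite !cdiff_shape //; exact: (linear0 (mklin (@thom_linear m))).
apply: hom_ext => i j; apply: hom_tens_ext => x; have [i' ei] := degP i.
rewrite thomE [RHS](homdE _ _ en ei erefl) [cdiff (T P) _ _ _]tens_cdiffE !thomE tens_cdiffE.
rewrite [hfun _ _ _ _](homdE _ _ en ei erefl) addrC -scaleNr tmkPl rmorphN sgn_morph scaleNr.
exact: addrC.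
Qed.

Lemma homN_cert_comm n m c : cdiff (restr_complex phi (homN (T P) (T Y) N)) n m (homN_cert_map n c) =
  homN_cert_map m (cdiff (homN P Y N) n m c).
Proof.
have [f <-] := homq_surj c; rewrite homN_certE cfun_comm homN_certE thom_comm.
exact: (cfun_comm (homq (T P) (T Y) N)).
Qed.
Definition homN_cert : chain_map (homN P Y N) (restr_complex phi (homN (T P) (T Y) N)) :=
  @ChainMap R (homN P Y N) (restr_complex phi (homN (T P) (T Y) N)) homN_cert_map homN_cert_comm.

Lemma tens_dual_coord_linear (M : lmodType R) (p : {linear M -> R^o}) a x y :
  (phi (p (a *: x + y)) : S^o) = phi a *: (phi (p x) : S^o) + (phi (p y) : S^o).
Proof. by rewrite linearP rmorphD; congr (_ + _); exact: rmorphM. Qed.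
Definition tens_coord (M : lmodType R) (p : {linear M -> R^o}) : {linear tens phi M S^o -> S^o} :=
  extend (A := S^o) (tens_dual_coord_linear p).
Lemma tens_coordE (M : lmodType R) (p : {linear M -> R^o}) x (s : S) :
  tens_coord p (tmk phi x (s : S^o)) = s * phi (p x).
Proof. exact: extendE. Qed.
Lemma tens_dual (M : lmodType R) (J : finType) (e : J -> M) (p : J -> {linear M -> R^o}) :
  (forall x, x = \sum_j (p j x : R) *: e j) ->
  forall z, z = \sum_j (tens_coord (p j) z : S) *: tmk phi (e j) (1 : S^o).
Proof.
move=> hp; apply: tens_ext_add => [//|z w|x s].
  apply: etrans; last exact: big_split.
  by apply: eq_bigr => j _; rewrite [tens_coord _ _]linearD; exact: scalerDl.
rewrite {1}[x]hp tmk_suml; apply: eq_bigr => j _.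
by rewrite tens_coordE tmkZl mulrC -scalerA -tmk1.
Qed.

(** [homN_dual] is applied over [R], and over [S] with the base-changed bases. Both use the same
    index type, so the two dual bases match term by term. *)
Lemma homN_bcert a n : (forall i, fgp (P i)) -> (forall i, fgp (Y i)) ->
  (forall i : int, i < a -> forall x : P i, x = 0) -> bcert (homN_cert n).
Proof.
move=> fP fY P0.
pose JP i := projT1 (cid (fP i)); pose eP i := projT1 (cid (projT2 (cid (fP i)))).
pose pP i := projT1 (cid (projT2 (cid (projT2 (cid (fP i)))))).
have hP i := projT2 (cid (projT2 (cid (projT2 (cid (fP i)))))).
pose JY i := projT1 (cid (fY i)); pose eY i := projT1 (cid (projT2 (cid (fY i)))).
pose pY i := projT1 (cid (projT2 (cid (projT2 (cid (fY i)))))).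
have hY i := projT2 (cid (projT2 (cid (projT2 (cid (fY i)))))).
have TP0 (i : int) : i < a -> forall z : T P i, z = 0.
  move=> ia; apply: (tens_ext_add (g := fun=> 0)) => [z w //|z w|x s]; first by rewrite addr0.
  by rewrite (P0 i ia x) tmk0l.
have dR := @homN_dual R P Y N a n P0 JP eP pP hP JY eY pY hY.
have dS := @homN_dual S (T P) (T Y) N a n TP0 JP (fun i j => tmk phi (eP i j) (1 : S^o))
  (fun i j => tens_coord (pP i j)) (fun i => tens_dual (hP i))
  JY (fun i j => tmk phi (eY i j) (1 : S^o)) (fun i j => tens_coord (pY i j)) (fun i => tens_dual (hY i)).
eexists; eexists; eexists; eexists; split; [exact: dR|move=> y|].
  rewrite [LHS]dS; apply: eq_bigr => -[l [j k]] _; congr (_ *: _).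
  rewrite /homN_basis homN_certE; congr (homq _ _ _ _ _); apply: hom_eqP => i i' z ei'.
  move: z; apply: hom_tens_ext => x; rewrite thomE !mkhomE // /unit_fun.
  case: eqP => [ei|_]; last by rewrite tmk0l.
  subst i i'; rewrite !castdeg_id tens_coordE mul1r tmkZl //.
move=> [l [j k]] c; have [f <-] := homq_surj c; rewrite homN_certE.
rewrite [X in phi X]homN_coordE; apply: etrans (homN_coordE _ _ _ _) _.
by rewrite /hom_coord thomE tens_coordE mul1r.
Qed.
End TruncatedHom.
End BaseChangeCertificates.

(** * Truncated homothety maps *)

Section HomothetyTruncation.
Variables (R : comPzRingType) (P : complex R).

(** The fiber of [R -> Hom(P_{<= N}, P)]. *)
Definition XN (N : int) : complex R := fib (comp_chain (homq P P N) (hmt (id_chain P))).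

(** A cycle is a scalar with a null-homotopy of it on [P_{<= N}]. The index [k] and its equation let
    the degree of [f] be written in any form. *)
Lemma XN_cycP N n k (a : conc R^o n) (f : Defs.Hom P P k) : k = n + 1 ->
  cyc ((a, castdeg (n + 1) (homq P P N k f)) : XN N n) <->
  forall i : int, i <= N -> solves (hmt (id_chain P) n a) f i.
Proof.
move=> ek; subst k; rewrite castdeg_id; apply: iff_trans (fib_cycP _) _.
have e := @cfun_comm _ _ _ (homq P P N) (n + 1) n f.
split=> [[_ h] i iN j x|h].
  by have /homq_eq := etrans h e; apply.
split; first by move=> j; have [en|ne] := eqVneq n (j + 1); [exact: erefl|exact: cdiff_shape].
by apply: etrans (esym e); apply/homq_eq => i iN j x; exact: h.
Qed.

Lemma XN_bd N n k s (a : conc R^o n) (f : Defs.Hom P P k) : k = n + 1 ->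
  bd (s *: ((a, castdeg (n + 1) (homq P P N k f)) : XN N n)) ->
  s *: a = 0 /\ exists x : conc R^o k, bd (homq P P N k (hmt (id_chain P) k x - s *: f)).
Proof.
move=> ek; subst k; rewrite castdeg_id => /fib_bdP [x [e b]]; split; first exact: e.
by exists x; rewrite linearB linearZ_LR.
Qed.

Hypothesis Pfgp : forall i, fgp (P i).
Variables (t : int) (Pt : forall i : int, t < i -> ex P i).

(** Obstructions to extending the null-homotopy [f] from [P_{<= N}] to [P] lie in the degrees
    [i + n] of [P] with [i > N], all above [t]. So [a] is null-homotopic on [P], hence zero, and the
    extension of [f] is a cycle of [Hom(P, P)], homologous to a homothety. *)
Lemma sd_XN N n : sd P -> t <= N + n -> ex (XN N) n.
Proof.
move=> [js ss] tN [a c] cz; have [f ef] := homq_surj c; subst c.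
have hf : forall i : int, i < N + 1 -> solves (hmt (id_chain P) n a) f i.
  by move=> i iN; apply: ((XN_cycP N a f erefl).1 _ i); [rewrite castdeg_id|lia].
have ca : cyc (hmt (id_chain P) n a) by apply: cfun_cyc.
have [|g [ag hg]] := @ext_infinite R P P Pfgp n (n + 1) (hmt (id_chain P) n a) f (N + 1) erefl ca hf.
  by move=> i iN; apply: Pt; lia.
have ba : bd a.
  apply: js => //; exists (n + 1), g; apply: hom_ext => i j x; exact/esym/hg.
have a0 : a = 0 by case: ba => k [y <-].
have cg : cyc g.
  apply: (cycP (j := n) erefl); apply: hom_ext => i j x; rewrite -[LHS]hg a0 linear0 //.
have [x [cx bx]] := ss _ g cg.
apply/fib_bdP; exists x; split; first by rewrite /= a0.
rewrite -[X in bd X]/(homq P P N _ (hmt (id_chain P) _ x) - homq P P N _ f).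
have -> : homq P P N (n + 1) f = homq P P N (n + 1) g by apply/homq_eq => i iN; apply: ag; lia.
by rewrite -linearB; exact: cfun_bd.
Qed.

Section Converse.
Variable D : set R.
Hypothesis hX : forall n : int, exists N0 : int, forall N : int, N0 <= N -> exS D (XN N) n.

Lemma exS_XN_inj n (a : conc R^o n) : bd (hmt (id_chain P) n a) -> exists s, D s /\ s *: a = 0.
Proof.
move=> b; have [g eg] := bd_succ b erefl; have [N /(_ N (lexx _)) hN] := hX n.
have [|s [Ds b1]] := hN (a, castdeg (n + 1) (homq P P N (n + 1) g)).
  by apply/XN_cycP => // i iN j x; rewrite -eg.
by exists s; split=> //; case: (XN_bd erefl b1).
Qed.

Lemma exS_XN_surj n (f : Defs.Hom P P n) : cyc f ->
  exists s a, D s /\ bd (hmt (id_chain P) n a - s *: f).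
Proof.
move=> cf; have [m em] := degP n; subst n.
(* [N >= t - m] puts the remaining obstructions, in degrees [i + m + 1] with [i > N], above [t]. *)
have [N0 hN0] := hX m; pose N := Num.max N0 (t - m).
have [||s [Ds b]] := hN0 N _ ((0, castdeg (m + 1) (homq P P N (m + 1) f)) : XN N m).
- by rewrite /N le_max lexx.
- apply/XN_cycP => // i iN j x; rewrite linear0;
    exact/esym/(congr1 (fun h : Defs.hom P P m => hfun h i j x) (cf m)).
have [_ [a b1]] := XN_bd erefl b.
exists s, a; split=> //.
have [g hg] : exists h : Defs.Hom P P (m + 1 + 1), forall i : int, i <= N ->
    solves (hmt (id_chain P) (m + 1) a - s *: f) h i.
  exact/homN_bdP.
have [|||h [_ hh]] := @ext_infinite R P P Pfgp (m + 1) (m + 1 + 1)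
  (hmt (id_chain P) (m + 1) a - s *: f) g (N + 1) erefl.
- apply: (submodB (cyc_submod _ _)); first exact: cfun_cyc.
  by apply: (submodZ (cyc_submod _ _)).
- by move=> i iN; apply: hg; lia.
- by move=> i iN; apply: Pt; move: iN; rewrite /N; lia.
exists (m + 1 + 1), h; apply: hom_ext => i j x; exact/esym/hh.
Qed.
End Converse.

Lemma XN_sd : (forall n : int, exists N0 : int, forall N : int, N0 <= N -> ex (XN N) n) -> sd P.
Proof.
move=> h; have hX n : exists N0 : int, forall N : int, N0 <= N -> exS [set 1] (XN N) n.
  by have [N0 hN] := h n; exists N0 => N iN; apply/exS1/hN.
split=> n a ca.
  move=> /(exS_XN_inj hX) [s [-> ]]; rewrite scale1r => ->; exact: submod0 (bd_submod _ _).
have [s [x [-> b]]] := exS_XN_surj hX ca; exists x; split; last by rewrite -[a]scale1r.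
by move=> j; have [e|ne] := eqVneq n (j + 1); [exact: erefl|exact: cdiff_shape].
Qed.

(** [Hom(P, P)] need not commute with localization, so the argument is elementwise: the scalars that
    achieve the conclusion for a given element form an ideal that no maximal ideal contains. *)
Lemma local_sd (hR : noetherian R) : (forall m, mSpec R m -> forall n : int,
    exists N0 : int, forall N : int, N0 <= N -> exS (~` m) (XN N) n) -> sd P.
Proof.
move=> h; split=> n a ca.
  move=> b; suff : a = 0 by move=> ->; exact: submod0 (bd_submod _ _).
  have hI : is_ideal [set s | s *: a = 0].
    split; first exact: scale0r.
    by move=> c x y /= ex ey; rewrite scalerDl -scalerA ex ey scaler0 addr0.
  apply: contrapT => na.
  have [|m hm sm] := max_above hR hI; first by rewrite /= scale1r.
  by have [s [ns es]] := exS_XN_inj (h m hm) b; apply: ns; exact: sm.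
suff [x b] : exists x, bd (hmt (id_chain P) n x - 1 *: a).
  by rewrite scale1r in b; exists x.
have hI : is_ideal [set s | exists x, bd (hmt (id_chain P) n x - s *: a)].
  split; first by exists 0; rewrite linear0 scale0r subr0; exact: submod0 (bd_submod _ _).
  move=> c s s' [x bx] [x' bx']; exists (c *: x + x').
  have -> : hmt (id_chain P) n (c *: x + x') - (c * s + s') *: a =
     c *: (hmt (id_chain P) n x - s *: a) + (hmt (id_chain P) n x' - s' *: a).
    by rewrite linearP scalerDl scalerBr scalerA; zmodule.
  exact: (bd_submod _ _).2.
apply: contrapT => n1; have [|m hm sm] := max_above hR hI; first exact: n1.
by have [s [x [ns b]]] := exS_XN_surj (h m hm) ca; apply: ns; apply: sm; exists x.
Qed.
End HomothetyTruncation.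

Section TruncationBaseChange.
Variables (R S : comPzRingType) (phi : {rmorphism R -> S}) (P : complex R) (a : int).
Notation T X := (tens_complex phi X S^o).
Hypotheses (Pfgp : forall i, fgp (P i)) (P0 : forall i : int, i < a -> forall x : P i, x = 0).

Lemma thom_hmt n x : thom phi (hmt (id_chain P) n x) =
  hmt (id_chain (T P)) n (conc_cert phi n x).
Proof.
apply: hom_ext => i j; apply: hom_tens_ext => y; rewrite thomE.
case: n x => [[|n]|n] x; [|exact: tmk0l..].
rewrite -[hfun (hmt (id_chain P) 0 x) i j y]/((x : R) *: hfun (chain_map_hom (id_chain P)) i j y).
rewrite -[RHS]/(phi x *: hfun (chain_map_hom (id_chain (T P))) i j (tmk phi y (1 : S^o))).
rewrite tmkZl; congr (_ *: _).
have [e|ne] := eqVneq j (i + 0); last by rewrite !hfun_shape // tmk0l.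
by rewrite addr0 in e; subst j; rewrite !chain_homE.
Qed.

Lemma XN_base_change N n : ex (T (XN P N)) n <-> ex (XN (T P) N) n.
Proof.
have uv i x : homN_cert phi P P N i (comp_chain (homq P P N) (hmt (id_chain P)) i x) =
  comp_chain (homq (T P) (T P) N) (hmt (id_chain (T P))) i (conc_cert phi i x).
  by rewrite [LHS]homN_certE thom_hmt.
apply: (bcert_ex (j := fib_cert uv)) => i; apply: fib_bcert; first exact: conc_bcert.
by move=> k; apply: homN_bcert P0.
Qed.
End TruncationBaseChange.

(** The dual basis is extracted from a base change along the identity of [R]. *)
Lemma XN_fgp (R : comPzRingType) (P : complex R) (a N n : int) : (forall i, fgp (P i)) ->
  (forall i : int, i < a -> forall x : P i, x = 0) -> fgp (XN P N n).
Proof.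
move=> Pfgp P0; apply: fgp_prod; first exact: bcert_fgp (conc_bcert (idfun : {rmorphism R -> R}) n).
exact: bcert_fgp (@homN_bcert R R idfun P P N a (n + 1) Pfgp Pfgp P0).
Qed.

Lemma XN_zero (R : comPzRingType) (P : complex R) (a N : int) :
  (forall i : int, i < a -> forall x : P i, x = 0) ->
  exists b : int, forall n : int, n < b -> forall z : XN P N n, z = 0.
Proof.
move=> P0; exists (Num.min 0 (a - N - 1)) => n nb [x y]; congr (_, _).
  by apply: conc_zero; move: nb; rewrite lt_min => /andP[]; lia.
apply: (@homN_zero R P P N a (n + 1) y P0 P0); move: nb; rewrite lt_min => /andP[]; lia.
Qed.

(** * Supports *)

Section Support.
Variables (R : comPzRingType) (hR : noetherian R) (P : complex R) (a : int).
Hypotheses (Pfgp : forall i, fgp (P i)) (P0 : forall i : int, i < a -> forall x : P i, x = 0).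

Lemma exS_sub (D D' : set R) (X : complex R) i : D `<=` D' -> exS D X i -> exS D' X i.
Proof. by move=> s h x /h [c [/s Dc b]]; exists c. Qed.

Lemma exS_zero (D : set R) (i : int) : D 1 -> i < a -> exS D P i.
Proof. by move=> D1 ia x _; exists 1; rewrite (P0 ia x) scaler0; split=> //;
  exact: submod0 (bd_submod _ _). Qed.

Section Prime.
Variables (q : set R) (hq : Spec R q).

Lemma prime1 : (~` q) 1. Proof. by case: hq. Qed.
Lemma primeM x y : (~` q) x -> (~` q) y -> (~` q) (x * y).
Proof. by case: hq => _ _ h nx ny /h []. Qed.

Lemma partial_nullhom (i : int) : (forall j : int, j < i -> exS (~` q) P j) ->
  exists s (h : Defs.Hom P P 1), ~ q s /\
    forall j : int, j < i -> solves (s *: (chain_map_hom (id_chain P) : Defs.Hom P P 0)) h j.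
Proof.
move=> hP; have hs : forall j : int, j < a ->
  solves (chain_map_hom (id_chain P) : Defs.Hom P P 0) (0 : Defs.Hom P P 1) j.
  by move=> j ja k x; rewrite (P0 ja x) !hfun0.
pose c : nat := if a <= i then `|i - a|%N else 0.
have [|s [h [ns _ hh]]] := @ext_finite R (~` q) P P prime1 primeM Pfgp 0 1
  (chain_map_hom (id_chain P)) 0 a c erefl (chain_map_hom_cyc _) hs.
  by move=> j; rewrite addr0 /c; case: (leP a i) => ia ja jc; apply: hP; lia.
exists s, h; split=> // j ji; apply: hh; rewrite /c; case: (leP a i); lia.
Qed.

(** At [q] the homology below [i] vanishes, so the cycles are a direct summand of [P i], with
    projection [e] up to the denominator [s0]. The nonzero finite module [H_i(P)] at [q] maps onto
    the residue field, and composition with [e] extends this map to [P i]. *)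
Lemma theta (i : int) : (forall j : int, j < i -> exS (~` q) P j) -> ~ exS (~` q) P i ->
  exists (f : {linear P i -> R^o}) (z : P i), [/\ cyc z, ~ q (f z) & forall x, bd x -> q (f x)].
Proof.
move=> hP nP; have [s0 [h [ns0 hh]]] := partial_nullhom hP; have [i' ei] := degP i.
have [i'' ei'] := degP i'.
(* In degree [i - 1], [s0 = d h + h d]; hence [s0 - h d] takes [P i] to cycles, and it is [s0] on
   cycles. *)
pose e x := s0 *: x - hfun h i' i (cdiff P i i' x).
have e_lin c x y : e (c *: x + y) = c *: e x + e y.
  rewrite /e [cdiff _ _ _ _]linearP hfunP scalerDr scalerBr !scalerA [s0 * c]mulrC.
  by zmodule.
have e_cyc x : cyc (e x).
  apply: (cycP ei); rewrite /e linearB linearZ_LR.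
  have ii : i' < i by lia.
  have := hh i' ii i' (cdiff P i i' x); rewrite (homdE _ _ (erefl (0 + 1)) ei' ei) cdiffK hfun0.
  by rewrite scaler0 subr0 hom_mult chain_homE => ->; rewrite subrr.
have e_z x : cyc x -> e x = s0 *: x by move=> cx; rewrite /e cx hfun0 subr0.
pose F (W : P i -> Prop) := [/\ submod W, forall x, W x -> cyc x, forall x, bd x -> W x,
  forall s z, ~ q s -> cyc z -> W (s *: z) -> W z & ~ forall z, cyc z -> W z].
(* The cycles modulo such a maximal [W] have rank one over [R / q]; [f] below is the composite
   of [e] with the resulting functional, multiplied by a denominator [s] outside [q]. *)
have [||W [[hW Wc Wb Ws nW] Wmax]] := @noeth_max R (P i) F (fgp_noeth hR (Pfgp i)).
- by move=> W [].
- exists (fun z => cyc z /\ exists s, ~ q s /\ bd (s *: z)); split.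
  + split; first by split; [exact: submod0 (cyc_submod _ _)|exists 1; rewrite scaler0; split;
      [exact: prime1|exact: submod0 (bd_submod _ _)]].
    move=> c x y [cx [s [ns bs]]] [cy [s' [ns' bs']]]; split; first exact: (cyc_submod _ _).2.
    exists (s * s'); split; first exact: primeM.
    have -> : (s * s') *: (c *: x + y) = (c * s') *: (s *: x) + s *: (s' *: y).
      by rewrite scalerDr !scalerA; congr (_ *: _ + _); ring.
    by apply: (bd_submod _ _).2 => //; apply: submodZ bs'; exact: bd_submod.
  + by move=> x [].
  + by move=> x bx; split; [exact: cyc_bd|exists 1; rewrite scale1r; split=> //; exact: prime1].
  + move=> s z ns cz [_ [s' [ns' b]]]; split=> //; exists (s' * s); split; first exact: primeM.
    by rewrite -scalerA.
  + by move=> hall; apply: nP => x /hall [].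
have [z0 [cz0 nz0]] : exists z, cyc z /\ ~ W z.
  by apply: contrapT => hn; apply: nW => z cz; apply: contrapT => nz; apply: hn; exists z.
have rank z : cyc z -> exists s r, ~ q s /\ W (s *: z - r *: z0).
  pose W' y := cyc y /\ exists s r, ~ q s /\ W (s *: y - r *: z0).
  suff h' : forall z, cyc z -> W' z by move=> /h' [].
  apply: contrapT => nW'; apply: nz0; apply: (Wmax W'); last first.
  - by split=> //; exists 1, 1; rewrite subrr; split; [exact: prime1|exact: submod0].
  - by move=> x Wx; split; [exact: Wc|exists 1, 0; rewrite scale0r subr0 scale1r; split=> //; exact: prime1].
  split=> //.
  + split; first by split; [exact: submod0 (cyc_submod _ _)|exists 1, 0;
      rewrite scaler0 scale0r subr0; split; [exact: prime1|exact: submod0]].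
    move=> c x y [cx [s [r [ns wx]]]] [cy [s' [r' [ns' wy]]]]; split; first exact: (cyc_submod _ _).2.
    exists (s * s'), (c * s' * r + s * r'); split; first exact: primeM.
    have -> : (s * s') *: (c *: x + y) - (c * s' * r + s * r') *: z0 =
        (c * s') *: (s *: x - r *: z0) + s *: (s' *: y - r' *: z0).
      rewrite scalerDr scalerDl !scalerBr !scalerA.
      by rewrite (_ : s * s' * c = c * s' * s); [zmodule|ring].
    by apply: hW.2 => //; exact: submodZ.
  + by move=> x [].
  + move=> x bx; split; [exact: cyc_bd|exists 1, 0; rewrite scale0r subr0 scale1r; split;
      [exact: prime1|exact: Wb]].
  + move=> s z' ns cz' [_ [s' [r [ns' w]]]]; split=> //; exists (s' * s), r; split; first exact: primeM.
    by rewrite -scalerA.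
have [J [eb [p hp]]] := Pfgp i.
have hj j : exists sr : R * R, ~ q sr.1 /\ W (sr.1 *: e (eb j) - sr.2 *: z0).
  by have [s [r [ns w]]] := rank _ (e_cyc (eb j)); exists (s, r).
pose sr j := projT1 (cid (hj j)).
have srP j : ~ q (sr j).1 /\ W ((sr j).1 *: e (eb j) - (sr j).2 *: z0) := projT2 (cid (hj j)).
pose s := \prod_j (sr j).1; pose s' j := \prod_(l | l != j) (sr l).1.
have es j : s = s' j * (sr j).1 by rewrite /s (bigD1 j) //= mulrC.
pose f x : R := \sum_j (p j x : R) * (s' j * (sr j).2).
have f_lin : linear (f : P i -> R^o).
  move=> c x y; rewrite /f scaler_sumr; apply: etrans; last exact: big_split.
  by apply: eq_bigr => j _; rewrite linearP [LHS]mulrDl; congr (_ + _); exact/esym/mulrA.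
have e_sum x : e x = \sum_j (p j x : R) *: e (eb j).
  rewrite {1}[x]hp; have e0 : e 0 = 0 by rewrite /e [cdiff _ _ _ _]linear0 hfun0 scaler0 subr0.
  by elim/big_rec2: _ => // j y y' _ <-; rewrite e_lin.
have key x : W (s *: e x - f x *: z0).
  have -> : s *: e x - f x *: z0 = \sum_j ((p j x : R) * s' j) *: ((sr j).1 *: e (eb j) - (sr j).2 *: z0).
    rewrite e_sum scaler_sumr /f scaler_suml -sumrB; apply: eq_bigr => j _.
    by rewrite [RHS]scalerBr !scalerA (es j); congr (_ - _); congr (_ *: _); ring.
  by apply: submod_sum => // j _; apply: submodZ => //; case: (srP j).
have W0 r : W (r *: z0) -> q r.
  by move=> w; apply: contrapT => nr; apply: nz0; exact: Ws w.
have ns : ~ q s by apply: (@prod_in R (~` q) prime1 primeM) => j; case: (srP j).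
exists (mklin f_lin), z0; split=> //.
  move=> qf; have := key z0; rewrite (e_z _ cz0) scalerA -scalerBl => /W0 qd.
  apply: (primeM ns ns0); case: hq => hI _ _; rewrite -[s * s0](subrK (f z0)).
  exact: idealD.
move=> x bx; apply: W0; have := key x; rewrite (e_z _ (cyc_bd bx)) => w.
rewrite -[X in W X](subKr (s *: (s0 *: x))); apply: (submodB hW) => //.
by apply: (submodZ hW); apply: (submodZ hW); exact: Wb.
Qed.

(** A functional on [P i] as in [theta], times a class of [H_u] with annihilator [q], is a
    morphism of degree [u - i > 0] that is not homotopic to a multiple of the identity. *)
Lemma theta_descent (i u N : int) (z0 : P u) : i < u -> i <= N -> cyc z0 ->
  (forall c, q c <-> bd (c *: z0)) ->
  (forall j : int, u < j -> exS (~` q) P j) -> (forall j : int, j < i -> exS (~` q) P j) ->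
  exS (~` q) (XN P N) (u - i - 1) -> exS (~` q) P i.
Proof.
move=> iu iN cz0 annz hup hlow hX; apply: contrapT => nP.
have [f [z [cz nfz fb]]] := theta hlow nP.
pose n := u - i; have nE : n = u - i by []; have en : n = (n - 1) + 1 by rewrite subrK.
(* [x -> f x *: z0] in degree [i] and zero elsewhere: a cycle on the degrees up to [i], because [z0]
   is a cycle. *)
pose g0f (j j' : int) (x : P j) : P j' := if j == i then castdeg j' ((f (castdeg i x) : R) *: z0) else 0.
have g0l j j' : linear (@g0f j j').
  move=> c x y; rewrite /g0f; case: eqP => [ej|_]; last by rewrite scaler0 addr0.
  subst j; rewrite !castdeg_id -castdeg_linear linearP; congr (castdeg j' _).
  by rewrite scalerDl scalerA.
pose g0 : Defs.Hom P P n := mkhom n g0l.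
have g0E x : hfun g0 i u x = (f x : R) *: z0.
  by rewrite mkhomE ?/g0f ?eqxx ?castdeg_id // nE; lia.
have g00 (j j' : int) x : j != i -> hfun g0 j j' x = 0.
  by move=> ne; rewrite /= /g0f (negbTE ne); case: ifP.
pose o : Defs.Hom P P (n - 1) := 0.
have c0 : cyc o by exact: submod0 (cyc_submod _ _).
have s0 : forall j : int, j < i + 1 -> solves o g0 j.
  move=> j ji j' x; have [j1 ej1] := degP j.
  rewrite (homdE _ _ en ej1 erefl) [hfun g0 j1 _ _]g00; last lia.
  rewrite scaler0 subr0; have [ej|ne] := eqVneq j i; last by rewrite g00 // linear0.
  move: x; rewrite ej => x; have [ej'|ne] := eqVneq (j' + 1) u; last first.
    by rewrite [hfun g0 _ _ _]hfun_shape; [rewrite linear0|rewrite nE; lia].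
  by rewrite ej' g0E linearZ_LR cz0 scaler0.
(* The first obstruction is [f (d x) *: z0] up to sign, a boundary since [f (d x)] is in [q]. The
   later ones lie in degrees above [u], where the homology at [q] vanishes. *)
have [|s1 [g1 [ns1 ag1 hs1]]] := @ext_step R (~` q) P P prime1 primeM Pfgp (n - 1) n o g0 (i + 1) en s0.
  move=> x; exists 1; split; first exact: prime1.
  rewrite scale1r hom_plus hom_opp hom_zero sub0r (homdE _ _ en erefl erefl) [hfun g0 (i + 1) _ _]g00; last lia.
  have -> : i + 1 + (n - 1) = u by rewrite nE; lia.
  rewrite linear0 sub0r opprK g0E; apply: (submodZ (bd_submod _ _)).
  by apply/annz/fb; exact: bd_diff.
have [|||s2 [g [ns2 ag2 hs2]]] := @ext_finite R (~` q) P P prime1 primeM Pfgp (n - 1) n (s1 *: o) g1 (i + 2) `|N - i|%N en.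
- by rewrite scaler0.
- by move=> j ji; apply: hs1; lia.
- by move=> j ji _; apply: hup; rewrite nE; lia.
have cg : cyc (homq P P N n g).
  apply/(@homN_cycP R P P N n (n - 1) g en) => j jN j' x; rewrite -hs2; last lia.
  by rewrite !scaler0.
have [|s3 [ns3 b]] := hX ((0, castdeg (n - 1 + 1) (homq P P N n g)) : XN P N (n - 1)).
  apply/(@XN_cycP R P N (n - 1) n 0 g en) => j jN j' x; rewrite linear0 -[RHS]hs2; last lia.
  by rewrite !scaler0.
have [_ [r br]] := XN_bd en b.
(* The degree [n = u - i] is positive, so there is no homothety in it. The morphism is then
   null-homotopic up to a scalar outside [q], and evaluation at the cycle [z] gives the
   contradiction. *)
have e0 : r = 0 by apply: conc_zero; rewrite nE; lia.
rewrite e0 linear0 sub0r in br; have [k /(_ i iN u z)] := (homN_bdP _ _ (erefl (n + 1))).1 br.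
have [i' ei] := degP i.
rewrite (homdE _ _ erefl ei erefl) cz hfun0 scaler0 subr0 hom_opp hom_mult -ag2; last lia.
rewrite hom_mult -ag1; last lia.
rewrite hom_mult g0E => bz.
have : bd ((s3 * (s2 * (s1 * f z))) *: z0).
  rewrite -!scalerA -[X in bd X]opprK bz; apply: (submodN (bd_submod _ _)); exact: bd_diff.
move=> /annz; apply: primeM => //; apply: primeM => //; exact: primeM.
Qed.

(** If the homothety of [P] is an isomorphism at [q], then [q] is in the support of [P]. *)
Lemma support_full (N : int) : (forall i, exS (~` q) P i) -> exS (~` q) (XN P N) 0 -> False.
Proof.
move=> hP hX; have [|s [h [ns hs]]] := @partial_nullhom (N + 1); first by move=> j _.
have [|s' [ns' b]] := hX (((s : R) , castdeg (0 + 1) (homq P P N 1 h)) : XN P N 0).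
  by apply/(@XN_cycP R P N 0 1 (s : conc R^o 0) h erefl) => j jN; apply: hs; lia.
have [e _] := @XN_bd R P N 0 1 s' (s : conc R^o 0) h erefl b.
apply: (primeM ns' ns); have -> : s' * s = 0 by exact: e.
by case: hq => -[].
Qed.

(** Upward induction from [a], because [theta_descent] in degree [i] needs vanishing in all lower
    degrees. *)
Lemma support_top (u : int) (z0 : P u) : cyc z0 -> (forall c, q c <-> bd (c *: z0)) ->
  (forall j : int, u < j -> exS (~` q) P j) ->
  (forall n : int, exists N0 : int, forall N : int, N0 <= N -> exS (~` q) (XN P N) n) ->
  forall i : int, i < u -> exS (~` q) P i.
Proof.
move=> cz annz hup hX; suff h (n : nat) : forall i : int, i < a + n%:Z -> i < u -> exS (~` q) P i.
  by move=> i iu; apply: (h `|i - a|.+1) => //; lia.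
elim: n => [|n IH] i ia iu; first by apply: exS_zero; [exact: prime1|lia].
have [N0 hN] := hX (u - i - 1).
apply: (@theta_descent i u (Num.max N0 i) z0) => //; first by rewrite le_max lexx orbT.
  by move=> j ji; apply: IH; lia.
by apply: hN; rewrite le_max lexx.
Qed.
End Prime.

(** A maximal annihilator, computed after localization at [m], is prime. Its finitely many
    generators have denominators with product [t], and [t *: z] has annihilator [q] even before
    localization. *)
Lemma assoc_prime (m : set R) (u : int) : Spec R m -> ~ exS (~` m) P u ->
  exists (q : set R) (z : P u), [/\ Spec R q, q `<=` m, cyc z & forall c, q c <-> bd (c *: z)].
Proof.
move=> hm nP; pose ann (z : P u) : set R := fun c => exists s, ~ m s /\ bd (s *: (c *: z)).
have bs := bd_submod P u.
have annI z : is_ideal (ann z).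
  split; first by exists 1; split; [exact: prime1|rewrite scale0r scaler0; exact: submod0].
  move=> c x y [s [ns bx]] [s' [ns' by']]; exists (s * s'); split; first exact: primeM.
  have -> : (s * s') *: ((c * x + y) *: z) = (s' * c) *: (s *: (x *: z)) + s *: (s' *: (y *: z)).
    by rewrite scalerDl scalerDr !scalerA; congr (_ *: _ + _ *: _); ring.
  by apply: bs.2 => //; exact: submodZ.
pose F (I : set R) := exists z, [/\ cyc z, I = ann z & ~ I 1].
have [||q [[z [cz eq nq]] qmax]] := @noeth_max R R^o F (noeth_self hR).
- by move=> I [z [_ -> _]]; exact: annI.
- apply: contrapT => nF; apply: nP => x cx; apply: contrapT => nx; apply: nF.
  exists (ann x), x; split=> // -[s [ns b]]; apply: nx; exists s; split=> //.
  by rewrite scale1r in b.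
have hq : Spec R q.
  split=> //; first by rewrite eq; exact: annI.
  move=> x y qxy; have [qy|nqy] := pselect (q y); [by right|left].
  apply: (qmax (ann (y *: z))).
  - exists (y *: z); split=> //; first exact: submodZ (cyc_submod _ _) _ _ cz.
    move=> [s [ns b]]; apply: nqy; rewrite eq; exists s; split=> //.
    by rewrite scale1r in b.
  - rewrite eq => c [s [ns b]]; exists s; split=> //; rewrite [c *: _]scalerA mulrC -scalerA [s *: _]scalerA.
    by rewrite mulrC -scalerA; exact: submodZ.
  - by move: qxy; rewrite eq => -[s [ns b]]; exists s; split=> //; rewrite [x *: _]scalerA.
have qm : q `<=` m.
  move=> c qc; apply: contrapT => nc; apply: nq; move: qc; rewrite eq => -[s [ns b]].
  by exists (s * c); split; [exact: primeM|rewrite scale1r -scalerA].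
have [J [g [qg hg]]] := noeth_ideal hR (ideal_submod (annI z)).
pose s j := projT1 (cid (qg j)).
have sP j : ~ m (s j) /\ bd (s j *: (g j *: z)) := projT2 (cid (qg j)).
pose t := \prod_j s j; pose t' j := \prod_(l | l != j) s l.
have et j : t = t' j * s j by rewrite /t (bigD1 j) //= mulrC.
have nt : ~ m t by apply: (@prod_in R (~` m)) => [|x y|j]; [exact: prime1|exact: primeM|case: (sP j)].
exists q, (t *: z); split=> //; first exact: submodZ (cyc_submod _ _) _ _ cz.
move=> c; split=> [|b]; last by rewrite eq; exists t; split=> //; rewrite scalerA mulrC -scalerA.
rewrite eq => /hg [d ->]; rewrite scaler_suml; apply: submod_sum => // j _.
have -> : (d j *: g j : R^o) *: (t *: z) = (d j * t' j) *: (s j *: (g j *: z)).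
  by rewrite (et j) !scalerA; congr (_ *: _); rewrite -[d j *: g j]/(d j * g j); ring.
by apply: submodZ => //; case: (sP j).
Qed.

Lemma local_top (m : set R) (j t : int) : ~ exS (~` m) P j -> (forall i : int, t < i -> exS (~` m) P i) ->
  exists u : int, [/\ j <= u, ~ exS (~` m) P u & forall i : int, u < i -> exS (~` m) P i].
Proof.
move=> nj ht; suff h (n : nat) (u : int) : j <= u -> ~ exS (~` m) P u -> t <= u + n%:Z ->
    exists u : int, [/\ j <= u, ~ exS (~` m) P u & forall i : int, u < i -> exS (~` m) P i].
  by apply: (h `|t - j|%N j) => //; lia.
elim: n u => [|n IH] u ju nu tu; first by exists u; split=> // i ui; apply: ht; lia.
have [hu|/existsNP [i /not_implyP [ui ni]]] := pselect (forall i : int, u < i -> exS (~` m) P i).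
  by exists u.
by apply: (IH i) => //; lia.
Qed.

(** [B] bounds the homology at one maximal ideal above each prime of the finite list. A nonzero
    class in a degree above [B] at some [m] leads, through an associated prime [q], to a prime [p]
    of the list at which all homology vanishes: outside degree [u] because [p] is contained in [q],
    and in degree [u] because [u > B]. *)
Lemma uniform_bound :
  (forall m, mSpec R m -> exists t : int, forall i : int, t < i -> exS (~` m) P i) ->
  (forall m, mSpec R m -> forall n : int,
     exists N0 : int, forall N : int, N0 <= N -> exS (~` m) (XN P N) n) ->
  exists t : int, forall i : int, t < i -> ex P i.
Proof.
move=> hT hX; have [ps [psP ps_below]] := finite_primes hR.
have [B hB] : exists B : int, forall p, List.In p ps -> exists m, [/\ mSpec R m, p `<=` m &
    forall i : int, B < i -> exS (~` m) P i].
  elim: ps psP {ps_below} => [|p ps IH] psP; first by exists 0.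
  have [B hB] : exists B : int, forall p, List.In p ps -> exists m, [/\ mSpec R m, p `<=` m &
    forall i : int, B < i -> exS (~` m) P i] by apply: IH => p' p'in; apply: psP; right.
  have [hpI p1 _] := psP p (or_introl erefl); have [m hm pm] := max_above hR hpI p1.
  have [t ht] := hT m hm; exists (Num.max B t) => p' [<-|/hB [m' [hm' pm' h']]].
    by exists m; split=> // i; rewrite gt_max => /andP [_ /ht].
  by exists m'; split=> // i; rewrite gt_max => /andP [/h'].
exists B => j Bj x cx; apply: contrapT => nbx.
have hI : is_ideal [set s | bd (s *: x)].
  split; first by rewrite /= scale0r; exact: submod0 (bd_submod _ _).
  by move=> c s s' b b'; rewrite /= scalerDl -scalerA; exact: (bd_submod _ _).2.
have [|m hm Im] := max_above hR hI; first by rewrite /= scale1r.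
have nj : ~ exS (~` m) P j by move=> /(_ x cx) [s [ns b]]; apply: ns; exact: Im.
have [t ht] := hT m hm; have [u [ju nu hu]] := local_top nj ht.
have [q [z [hq qm cz annz]]] := assoc_prime (mSpec_prime hm) nu.
have mq : ~` m `<=` ~` q by move=> s ns /qm.
have low := support_top hq cz annz (fun j uj => exS_sub mq (hu j uj)) (fun n => 
  let: ex_intro N0 hN := hX m hm n in ex_intro _ N0 (fun N iN => exS_sub mq (hN N iN))).
have [p pin pq] := ps_below q hq; have [m' [hm' pm' hB']] := hB p pin.
have qp : ~` q `<=` ~` p by move=> s ns /pq.
have mp : ~` m' `<=` ~` p by move=> s ns /pm'.
have [N hN] := hX m' hm' 0.
apply: (@support_full p (psP p pin) N); last exact: exS_sub mp (hN N (lexx _)).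
move=> i; case: (ltgtP i u) => [iu|ui|->].
- exact: exS_sub qp (low i iu).
- exact: exS_sub qp (exS_sub mq (hu i ui)).
- by apply: exS_sub mp (hB' u _); lia.
Qed.
End Support.

(** * Finite homology, infimum and supremum *)

Section FiniteHomology.
Variable R : comPzRingType.

Lemma fg_module_fin (M : lmodType R) :
  fg_module M <-> exists (K : finType) (g : K -> M), forall x, exists c : K -> R, x = \sum_k c k *: g k.
Proof.
split=> [[s hs]|[K [g hg]]].
  by exists 'I_(size s), (fun i : 'I_(size s) => s`_i) => x; have [c ->] := hs x; exists c.
pose t := [tuple g (enum_val i) | i < #|K|]; exists t => x; have [c ->] := hg x.
have et : size t = #|K| by rewrite size_tuple.
exists (fun i => c (enum_val (cast_ord et i))).
rewrite (reindex (fun i : 'I_(size t) => enum_val (cast_ord et i))) /=.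
  apply: eq_bigr => i _; congr (_ *: _).
  by rewrite -[RHS](tnth_nth 0 t (cast_ord et i)) tnth_mktuple.
apply: onW_bij; apply: (bij_comp (enum_val_bij K)).
by exists (cast_ord (esym et)); [exact: cast_ordK|exact: cast_ordKV].
Qed.

Lemma hfgP (X : complex R) i : fg_module (homology X i) <-> hfg X i.
Proof.
have lin (K : finType) (c : K -> R) (z : K -> Defs.cycle X i) : exists w : Defs.cycle X i,
    sval w = \sum_k c k *: sval (z k) /\ hcls w = \sum_k c k *: hcls (z k).
  elim/big_rec2: _ => [|k x h _ [w [<- <-]]]; first by exists (p0 (homology_premod X i)).
  exists (@padd _ (homology_premod X i) (@pscale _ (homology_premod X i) (c k) (z k)) w).
  split=> //; apply: etrans (pclsD _ _) _; congr (_ + _); exact: pclsZ.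
have cycle_of x : cyc x -> exists z : Defs.cycle X i, sval z = x by move=> cx; exists (exist _ x (cx (i - 1))).
apply: iff_trans (fg_module_fin _) _; split=> [[K [g hg]]|[n [s [cs hs]]]].
  have hz k : exists z : Defs.cycle X i, hcls z = g k by exact: hcls_surj.
  pose z k := projT1 (cid (hz k)).
  have zE k : hcls (z k) = g k := projT2 (cid (hz k)).
  exists #|K|, (fun l => sval (z (enum_val l))); split=> [l|x /cycle_of [y <-]]; first exact: cycle_cyc.
  have [c ec] := hg (hcls y); exists (fun l => c (enum_val l)).
  have [w [ew ew']] := lin _ (fun l => c (enum_val l)) (fun l : 'I_#|K| => z (enum_val l)).
  rewrite -ew; apply/hcls_eq; rewrite ec ew'.
  rewrite (reindex (fun l : 'I_#|K| => enum_val l)) /=; last by apply: onW_bij; exact: enum_val_bij.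
  by apply: eq_bigr => l _; rewrite zE.
pose z l := projT1 (cid (cycle_of _ (cs l))).
have zE l : sval (z l) = s l := projT2 (cid (cycle_of _ (cs l))).
exists 'I_n, (fun l => hcls (z l)) => h; have [y <-] := hcls_surj h.
have [c bc] := hs _ (cycle_cyc y); exists c; have [w [ew <-]] := lin _ c z.
apply/hcls_eq; rewrite ew; move: bc; congr (bd (_ - _)).
by apply: eq_bigr => l _; rewrite zE.
Qed.

Section DirectSum.
Variable M : int -> lmodType R.

Definition dsum_in_rel := fun t u : term R {i : int & M i} =>
    exists i (a : R) (x y : M i),
      t = TGen R (existT _ i (a *: x + y)) /\
      u = TAdd (TScale a (TGen R (existT _ i x))) (TGen R (existT _ i y)).
Definition dsum_in i (x : M i) : direct_sum M := pgen dsum_in_rel (existT _ i x).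

Lemma dsum_in_linear i : linear (@dsum_in i).
Proof.
move=> a x y; rewrite /dsum_in /pgen tclsE /=.
have -> : pgen dsum_in_rel (existT _ i (a *: x + y)) =
  tcls dsum_in_rel (TAdd (TScale a (TGen R (existT _ i x))) (TGen R (existT _ i y))).
  by apply/pclsP; apply: teq_rel; exists i, a, x, y.
by rewrite tclsE.
Qed.

Lemma dsum_proj_subproof i t u : dsum_in_rel t u ->
  teval (fun g : {j : int & M j} => castdeg i (tagged g)) t =
  teval (fun g : {j : int & M j} => castdeg i (tagged g)) u.
Proof. by move=> [j [a [x [y [-> ->]]]]] /=; rewrite castdeg_linear. Qed.
Definition dsum_proj i : {linear direct_sum M -> M i} := plift (@dsum_proj_subproof i).
Lemma dsum_projE i j (x : M j) : dsum_proj i (dsum_in x) = castdeg i x.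
Proof. exact: pliftE. Qed.

Lemma dsum_ind (W : direct_sum M -> Prop) : submod W -> (forall i (x : M i), W (dsum_in x)) ->
  forall z, W z.
Proof.
move=> hW hin z; rewrite -(prepK z); elim: (prep z : term _ _) => [[i x]||t IHt u IHu|c t IHt].
- exact: hin.
- exact: submod0 hW.
- by rewrite (pclsD (t : term_premod dsum_in_rel) u); apply: submodD.
- by rewrite (pclsZ c (t : term_premod dsum_in_rel)); apply: submodZ.
Qed.

Lemma dsum_bounded (z : direct_sum M) : exists b : nat, forall i : int, (b < `|i|)%N -> dsum_proj i z = 0.
Proof.
move: z; apply: dsum_ind => [|j x].
  split=> [|a x y [b hb] [b' hb']]; first by exists 0%N => i _; exact: linear0.
  exists (maxn b b') => i; rewrite gtn_max => /andP [ib ib'].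
  by rewrite linearP hb // hb' // scaler0 addr0.
exists `|j|%N => i ij; rewrite dsum_projE castdeg_ne //.
by apply: contraTneq ij => ->; rewrite ltnn.
Qed.

(** Each of finitely many generators has finitely many nonzero components, which bounds the degrees;
    conversely the degrees from [-b] to [b] are enumerated by an ordinal. *)
Lemma dsum_fg : fg_module (direct_sum M) <-> (forall i, fg_module (M i)) /\
  exists b : nat, forall i : int, (b < `|i|)%N -> zero_module (M i).
Proof.
split=> [/fg_module_fin [K [g hg]]|[hM [b hb]]].
  split=> [i|].
    apply/fg_module_fin; exists K, (fun k => dsum_proj i (g k)) => x.
    have [c ec] := hg (dsum_in x); exists c; have := congr1 (dsum_proj i) ec.
    rewrite dsum_projE castdeg_id => ->; rewrite linear_sum.
    by apply: eq_bigr => k _; rewrite linearZ_LR.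
  pose bk k := projT1 (cid (dsum_bounded (g k))).
  have bP k : forall i : int, (bk k < `|i|)%N -> dsum_proj i (g k) = 0 := projT2 (cid (dsum_bounded (g k))).
  exists (\max_k bk k) => i ib x; have [c ec] := hg (dsum_in x).
  have := congr1 (dsum_proj i) ec; rewrite dsum_projE castdeg_id => ->.
  rewrite linear_sum big1 // => k _; rewrite linearZ_LR bP ?scaler0 //.
  by apply: leq_ltn_trans ib; exact: leq_bigmax.
pose deg (l : 'I_(b + b).+1) : int := (l : nat)%:Z - b%:Z.
have hK l : exists (K : finType) (g : K -> M (deg l)), forall x, exists c : K -> R, x = \sum_k c k *: g k.
  exact/fg_module_fin.
pose K l := projT1 (cid (hK l)); pose g l := projT1 (cid (projT2 (cid (hK l)))).
have gP l : forall x, exists c : K l -> R, x = \sum_k c k *: g l k := projT2 (cid (projT2 (cid (hK l)))).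
apply/fg_module_fin; exists {l : 'I_(b + b).+1 & K l}, (fun lk => dsum_in (g (tag lk) (tagged lk))).
apply: dsum_ind => [|i x].
  split=> [|a x y [c ->] [d ->]].
    by exists (fun=> 0); rewrite big1 // => k _; rewrite scale0r.
  exists (fun k => a * c k + d k); rewrite scaler_sumr -big_split /=.
  by apply: eq_bigr => k _; rewrite scalerDl scalerA.
have in0 j : dsum_in (0 : M j) = 0 by exact: (linear0 (mklin (@dsum_in_linear j))).
have [ib|ib] := ltnP b `|i|.
  by exists (fun=> 0); rewrite (hb i ib x) in0 big1 // => k _; rewrite scale0r.
have ll : (`|(i + b%:Z)%R| < (b + b).+1)%N by lia.
pose l := Ordinal ll; have el : i = deg l by rewrite /deg /=; lia.
move: x; rewrite el => x; have [c ->] := gP l x.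
exists (fun lk => if @eqP _ (tag lk) l is ReflectT e then c (eq_rect _ K (tagged lk) _ e) else 0).
apply: etrans; last exact: (@sig_big_dep _ _ _ 'I_(b + b).+1 K xpredT (fun=> xpredT)
  (fun l' k => (if @eqP _ l' l is ReflectT e then c (eq_rect _ K k _ e) else 0) *: dsum_in (g l' k))).
rewrite (bigD1 l) // [X in _ = _ + X]big1 ?addr0 => [|l' nl].
  rewrite -[dsum_in _]/(mklin (@dsum_in_linear _) _) linear_sum; apply: eq_bigr => k _.
  by rewrite linearZ_LR; case: eqP => // e; rewrite (eq_axiomK e).
by apply: big1 => k _; case: eqP => [e|_]; [rewrite e eqxx in nl|rewrite scale0r].
Qed.
End DirectSum.

Lemma hfiniteP (X : complex R) : hfinite X <-> (forall i, hfg X i) /\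
  exists a b : int, (forall i : int, i < a -> ex X i) /\ forall i : int, b < i -> ex X i.
Proof.
apply: iff_trans (dsum_fg (homology X)) _; split=> [[h [b hb]]|[h [a [b [ha hb]]]]].
  split=> [i|]; first exact/hfgP.
  by exists (- b%:Z), b%:Z; split=> i ib; apply/acyclic_ex/hb; lia.
split=> [i|]; first exact/hfgP.
exists (`|a| + `|b|)%N => i ib; apply/acyclic_ex; have [ia|ia] := ltP i a; first exact: ha.
by apply: hb; lia.
Qed.
End FiniteHomology.

Section InfSup.
Variable R : comPzRingType.
Implicit Type X : complex R.

Lemma hsupportP X i : hsupport X i%:E <-> ~ ex X i.
Proof.
split=> [[j nj [e]] h|h]; first by apply: nj; rewrite e; exact/acyclic_ex.
by exists i => // hz; apply: h; exact/acyclic_ex.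
Qed.

Lemma hsupport0 X : (forall i, ex X i) -> hsupport X = set0.
Proof. by move=> h; rewrite -subset0 => x [i ni _]; apply: ni; apply/acyclic_ex; exact: h. Qed.

Lemma cinf0 X : (forall i, ex X i) -> cinf X = +oo%E.
Proof. by move=> /hsupport0 h; rewrite /cinf /infimum h eqxx. Qed.
Lemma csup0 X : (forall i, ex X i) -> csup X = -oo%E.
Proof. by move=> /hsupport0 h; rewrite /csup /supremum h eqxx. Qed.

Lemma cinfE X i : ~ ex X i -> (forall j : int, j < i -> ex X j) -> cinf X = i%:E.
Proof.
move=> ni hi; have si := (hsupportP X i).2 ni; rewrite /cinf /infimum ifF; last first.
  by apply/negbTE/set0P; exists i%:E.
apply: xget_subset1 (@is_subset1_infimums _ _ _); split=> [y [j nj <-]|y hy]; last exact: hy.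
rewrite lee_fin; have [//|ji] := leP i j; by case: nj; apply/acyclic_ex/hi.
Qed.

Lemma csupE X i : ~ ex X i -> (forall j : int, i < j -> ex X j) -> csup X = i%:E.
Proof.
move=> ni hi; have si := (hsupportP X i).2 ni; rewrite /csup /supremum ifF; last first.
  by apply/negbTE/set0P; exists i%:E.
apply: xget_subset1 (@is_subset1_supremums _ _ _); split=> [y [j nj <-]|y hy]; last exact: hy.
rewrite lee_fin; have [//|ji] := leP j i; by case: nj; apply/acyclic_ex/hi.
Qed.

Lemma support_min X a : (forall i : int, i < a -> ex X i) ->
  (forall i, ex X i) \/ exists i, ~ ex X i /\ forall j : int, j < i -> ex X j.
Proof.
move=> ha; have [h|nh] := pselect (exists i, ~ ex X i /\ forall j : int, j < i -> ex X j); [by right|left].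
suff h (n : nat) : forall i : int, i < a + n%:Z -> ex X i.
  by move=> i; apply: (h `|i - a|.+1); lia.
elim: n => [|n IH] i ia; first by apply: ha; lia.
by apply: contrapT => ni; apply: nh; exists i; split=> // j ji; apply: IH; lia.
Qed.

Lemma support_max X b : (forall i : int, b < i -> ex X i) ->
  (forall i, ex X i) \/ exists i, ~ ex X i /\ forall j : int, i < j -> ex X j.
Proof.
move=> hb; have [h|nh] := pselect (exists i, ~ ex X i /\ forall j : int, i < j -> ex X j); [by right|left].
suff h (n : nat) : forall i : int, b < i + n%:Z -> ex X i.
  by move=> i; apply: (h `|b - i|.+1); lia.
elim: n => [|n IH] i ib; first by apply: hb; lia.
by apply: contrapT => ni; apply: nh; exists i; split=> // j ji; apply: IH; lia.
Qed.
End InfSup.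

Section Comparison.
Variables (R S : comPzRingType) (X : complex R) (Y : complex S).
Hypothesis low : forall a : int, (forall i : int, i < a -> ex X i) -> forall i : int, i < a -> ex Y i.

Lemma cinf_le : (exists a : int, forall i : int, i < a -> ex X i) -> (cinf X <= cinf Y)%E.
Proof.
move=> [a ha]; have [hY|[j [nj hj]]] := support_min (low ha); first by rewrite (cinf0 hY) leey.
have [hX|[i [ni hi]]] := support_min ha.
  by case: nj; apply: (low (a := j + 1)) => //; lia.
rewrite (cinfE ni hi) (cinfE nj hj) lee_fin; have [//|ji] := leP i j.
by case: nj; exact: (low hi).
Qed.

Lemma amp_le : (forall b : int, (forall i : int, b < i -> ex X i) -> forall i : int, b < i -> ex Y i) ->
  (exists a : int, forall i : int, i < a -> ex X i) ->
  (exists b : int, forall i : int, b < i -> ex X i) -> (amp Y <= amp X)%E.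
Proof.
move=> high hA [b hb]; have [a ha] := hA; rewrite /amp.
(* An exact [Y] has amplitude [-oo - +oo], which is [-oo]. *)
have [hY|[j [nj hj]]] := support_min (low ha); first by rewrite (cinf0 hY) (csup0 hY) leNye.
have [hY|[k [nk hk]]] := support_max (high b hb); first by case: nj.
have [hX|[i [ni hi]]] := support_min ha.
  by case: nj; apply: (low (a := j + 1)) => //; lia.
have [hX|[l [nl hl]]] := support_max hb; first by case: ni.
rewrite (csupE nk hk) (cinfE nj hj) (csupE nl hl) (cinfE ni hi) lee_fin.
have ij : i <= j by have [//|ji] := leP i j; case: nj; exact: (low hi).
have kl : k <= l by have [//|ji] := leP k l; case: nk; exact: (high l hl).
by lia.
Qed.
End Comparison.

(** * Ascent and descent *)

Section AscentDescent.
Variables (R S : comPzRingType) (phi : {rmorphism R -> S}).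
Notation T X := (tens_complex phi X S^o).
Hypotheses (hR : noetherian R) (hS : noetherian S).

Lemma glue_ex (X : complex R) i : (forall m, mSpec R m -> exS (~` m) X i) -> ex X i.
Proof.
move=> h x cx; apply: contrapT => nbx.
have hI : is_ideal [set s | bd (s *: x)].
  split; first by rewrite /= scale0r; exact: submod0 (bd_submod _ _).
  by move=> c s s' b b'; rewrite /= scalerDl -scalerA; exact: (bd_submod _ _).2.
have [|m hm Im] := max_above hR hI; first by rewrite /= scale1r.
by have [s [ns b]] := h m hm x cx; apply: ns; exact: Im.
Qed.

Lemma hfg_qi (A : comPzRingType) (X Y : complex A) (f : chain_map X Y) i : qi f -> hfg X i -> hfg Y i.
Proof.
move=> [inj surj] [n [s [hs gs]]]; exists n, (fun j => f i (s j)); split=> [j|y cy].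
  exact: cfun_cyc.
have [x [cx bx]] := surj i y cy; have [c bc] := gs x cx; exists c.
have -> : y - \sum_j c j *: f i (s j) = f i (x - \sum_j c j *: s j) - (f i x - y).
  have -> : \sum_j c j *: f i (s j) = f i (\sum_j c j *: s j).
    by rewrite linear_sum; apply: eq_bigr => j _; rewrite linearZ_LR.
  by rewrite linearB; zmodule.
by apply: (submodB (bd_submod _ _)) => //; exact: cfun_bd.
Qed.

Lemma tens_fgp (M : lmodType R) : fgp M -> fgp (tens phi M S^o).
Proof.
move=> [J [e [p hp]]]; exists J, (fun j => tmk phi (e j) (1 : S^o)), (fun j => tens_coord phi (p j)).
exact: tens_dual.
Qed.

Lemma tens_zero (M : lmodType R) : (forall x : M, x = 0) -> forall z : tens phi M S^o, z = 0.
Proof.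
move=> h; apply: (tens_ext_add (g := fun=> 0)) => [z w //|z w|x s]; first by rewrite addr0.
by rewrite (h x) tmk0l.
Qed.

(** Everything the theorem says of [C] and [Ltensor phi C] is read on [P] and [T P]. The lift
    [P -> res C] is a homotopy equivalence of K-projective complexes, so base change keeps it a
    quasi-isomorphism. *)
Lemma model (C : complex R) (a : int) : (forall i, hfg C i) -> (forall i : int, i < a -> ex C i) ->
  exists P : complex R, [/\ forall i, fgp (P i), forall i : int, i < a -> forall x : P i, x = 0,
    (forall i, ex P i <-> ex C i) /\ (forall i, ex (T P) i <-> ex (Ltensor phi C) i),
    forall i, hfg (Ltensor phi C) i
  & (sd P <-> quasi_iso (homothety C)) /\ (sd (T P) <-> quasi_iso (homothety (Ltensor phi C)))].
Proof.
move=> hC ha; have [P [f [Pfgp P0 qf]]] := finite_resolution hR hC ha.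
have kP := K0_bounded Pfgp P0; have kC := @K0_res _ C.
have hr : qi (res_map C) by apply/qiP; exact: res_quasi_iso.
have [w hw] := lift_qi f kP hr.
have qw : qi w.
  apply/(qi_comp (h := comp_chain (res_map C) w) _ hr) => //.
  exact: homotopic_qi (homotopic_sym hw) qf.
have qt : qi (tens_map phi S^o w) := tens_map_qi phi kC kP qw.
exists P; split=> //.
- by split=> i; [exact: qi_ex qf|exact: qi_ex qt].
- by move=> i; apply: hfg_qi qt _; apply: fgp_hfg hS _; exact: tens_fgp.
- by split; [exact: sd_homothety kP qf|exact: sd_homothety (@K0_tens R S phi _ kP) qt].
Qed.

Lemma low_ascent (C : complex R) : (forall i, hfg C i) ->
  forall a : int, (forall i : int, i < a -> ex C i) -> forall i : int, i < a -> ex (Ltensor phi C) i.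
Proof.
move=> hC a ha i ia; have [P [_ P0 [_ eT] _ _]] := model hC ha; apply/eT => z _.
by rewrite (tens_zero (P0 i ia) z); exact: submod0 (bd_submod _ _).
Qed.

Lemma low_descent (C : complex R) : (forall i, hfg C i) ->
  mSpec R `<=` [set Spec_map phi Q | Q in Spec S] ->
  forall a : int, (forall i : int, i < a -> ex (Ltensor phi C) i) -> forall i : int, i < a -> ex C i.
Proof.
move=> hC hsurj a ha i ia; apply: glue_ex => m hm; have [Q [hQ n1 _] eQ] := hsurj m hm.
by subst m; exact: (inf_descent hR hQ n1 hm hC ha).
Qed.

Section Model.
Variables (P : complex R) (a : int).
Hypotheses (Pfgp : forall i, fgp (P i)) (P0 : forall i : int, i < a -> forall x : P i, x = 0).

Let TPfgp i : fgp (T P i). Proof. exact: tens_fgp. Qed.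
Let TP0 (i : int) : i < a -> forall x : T P i, x = 0. Proof. by move=> ia; apply: tens_zero; exact: P0. Qed.

Lemma Spec_preimage q : Spec S q -> Spec R (Spec_map phi q).
Proof.
move=> [hI n1 hq]; split; rewrite /Spec_map /preimage /=.
- split=> [|x y z qy qz] /=; first by rewrite rmorph0; case: hI.
  by rewrite rmorphD rmorphM; case: hI => _; exact.
- by rewrite rmorph1.
- by move=> x y; rewrite rmorphM; exact: hq.
Qed.

(** The lowest homology at a point survives base change: the functional of [theta] extends to
    [T P i], is zero modulo [q] on boundaries, and is outside [q] at the cycle [z \otimes 1]. *)
Lemma support_descent (q : set S) (i : int) : Spec S q ->
  (forall j : int, j < i -> exS (~` Spec_map phi q) P j) -> exS (~` q) (T P) i ->
  exS (~` Spec_map phi q) P i.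
Proof.
move=> hq low hT; apply: contrapT => nP.
have [f [z [cz nfz fb]]] := theta hR Pfgp P0 (Spec_preimage hq) low nP.
have cz' : cyc (tmk phi z (1 : S^o) : T P i) by move=> j; rewrite tens_cdiffE cz tmk0l.
have [s [ns b]] := hT _ cz'; have [y ey] := bd_succ b erefl.
have [hI _ hqM] := hq.
have qd (w : T P (i + 1)) : q (tens_coord phi f (cdiff (T P) (i + 1) i w)).
  move: w; apply: tens_ind => [|w w' hw hw'|x t].
  - by rewrite (linear0 (cdiff (T P) (i + 1) i)) linear0; case: hI.
  - have -> : cdiff (T P) (i + 1) i (w + w') = cdiff (T P) (i + 1) i w + cdiff (T P) (i + 1) i w'
      by exact: linearD.
    have -> : tens_coord phi f (cdiff (T P) (i + 1) i w + cdiff (T P) (i + 1) i w') =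
       tens_coord phi f (cdiff (T P) (i + 1) i w) + tens_coord phi f (cdiff (T P) (i + 1) i w')
         by exact: linearD.
    exact: idealD.
  - by rewrite tens_cdiffE tens_coordE; apply: idealZ => //; apply: fb; exact: bd_diff.
have := qd y; rewrite ey -tmk1 tens_coordE => /hqM []; first exact: ns.
exact: nfz.
Qed.

Hypothesis fdS : finite_flat_dim (restr S^o phi).
Variable t : int.
Hypothesis Pt : forall i : int, t < i -> ex P i.

Lemma tens_bounded : exists t' : int, forall i : int, t' < i -> ex (T P) i.
Proof.
have [n hn] := flat_dim_ex fdS; exists (t + 1 + n%:Z) => i it.
apply: (hn P (fun i => fgp_lfree (Pfgp i)) (t + 1)); last by lia.
by move=> j jt; apply: Pt; lia.
Qed.

(** [X_N] is exact in degrees [>= t - N], hence its base change in degrees [>= t - N + n], which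
    include [k] once [N >= t + n - k]. *)
Lemma sd_ascent : sd P -> sd (T P).
Proof.
move=> hP; have [t' ht'] := tens_bounded; have [n hn] := flat_dim_ex fdS.
apply: (XN_sd TPfgp ht') => k; exists (t + n%:Z - k) => N hN.
apply/(XN_base_change phi Pfgp P0).
apply: (hn (XN P N) (fun i => fgp_lfree (XN_fgp N i Pfgp P0)) (t - N)); last by lia.
by move=> i iN; apply: (sd_XN Pfgp Pt) => //; lia.
Qed.

(** [tens_bounded] loses the flat dimension; the sharp bound needs supports. If the top degree [u]
    at a maximal ideal of [S] were above [t], then at an associated prime [q] all homology of [T P]
    below [u] would vanish. So would that of [P] at the preimage of [q], by [support_descent], and
    above [t] it vanishes anyway, contradicting [support_full]. *)
Lemma high_ascent : sd P -> forall i : int, t < i -> ex (T P) i.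
Proof.
move=> hP j tj x cx; apply: contrapT => nbx.
have hI : is_ideal [set s | bd (s *: x)].
  split; first by rewrite /= scale0r; exact: submod0 (bd_submod _ _).
  by move=> c s s' b b'; rewrite /= scalerDl -scalerA; exact: (bd_submod _ _).2.
have [|m hm Im] := max_above hS hI; first by rewrite /= scale1r.
have nj : ~ exS (~` m) (T P) j by move=> /(_ x cx) [s [ns b]]; apply: ns; exact: Im.
have exD (A : comPzRingType) (X : complex A) (p : set A) (i : int) : Spec A p -> ex X i -> exS (~` p) X i.
  move=> hp hX y cy; exists 1; rewrite scale1r; split; [exact: prime1|exact: hX].
have pm := mSpec_prime hm.
have [t' ht'] := tens_bounded.
have [u [ju nu hu]] := local_top nj (fun i it => exD _ _ _ _ pm (ht' i it)).
have [q [z [hq qm cz annz]]] := assoc_prime hS pm nu.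
have mq : ~` m `<=` ~` q by move=> s ns /qm.
have hX n : exists N0 : int, forall N : int, N0 <= N -> exS (~` q) (XN (T P) N) n.
  exists (t' - n) => N iN; apply: exD => //; apply: (sd_XN TPfgp ht'); [exact: sd_ascent|lia].
have low := support_top hS TPfgp TP0 hq cz annz (fun i ui => exS_sub mq (hu i ui)) hX.
have hp := Spec_preimage hq.
have all i : exS (~` Spec_map phi q) P i.
  have [ti|it] := ltP t i; first by apply: exD => //; exact: Pt.
  suff h (n : nat) : forall i : int, i < a + n%:Z -> i < u -> exS (~` Spec_map phi q) P i.
    by apply: (h `|i - a|.+1); lia.
  elim: n => [|n IH] k ka ku; first by apply: (exS_zero P0); [exact: prime1|lia].
  apply: support_descent => //; last exact: low.
  by move=> l lk; apply: IH; lia.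
apply: (support_full Pfgp P0 hp (N := t) all); apply: exD => //.
by apply: (sd_XN Pfgp Pt) => //; lia.
Qed.
End Model.

(** The constant [c] depends on [m] alone, so it serves for [P] and for all [X_N] at once. As
    [X_N \otimes S] is exact in degrees [>= t - N], each fixed degree of [X_N] is exact at [m] for
    large [N]. *)
Lemma sd_descent (P : complex R) (a t : int) : (forall i, fgp (P i)) ->
  (forall i : int, i < a -> forall x : P i, x = 0) ->
  finite_flat_dim (restr S^o phi) -> mSpec R `<=` [set Spec_map phi Q | Q in Spec S] ->
  (forall i : int, t < i -> ex (T P) i) -> sd (T P) ->
  (exists b : int, forall i : int, b < i -> ex P i) /\ sd P.
Proof.
move=> Pfgp P0 fdS hsurj ht hT.
have TPfgp i : fgp (T P i) by exact: tens_fgp.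
have hTP i : hfg P i := fgp_hfg hR (Pfgp i).
have bounded m : mSpec R m -> exists c : nat, forall (X : complex R) (t : int),
    (forall i, fgp (X i)) -> K0 X -> (forall i : int, t < i -> ex (T X) i) ->
    forall i : int, t + c%:Z < i -> exS (~` m) X i.
  move=> hm; have [Q [hQ n1 _] eQ] := hsurj m hm; subst m.
  have [c hc] := bounded_descent hR hQ n1 hm fdS; exists c => X t' Xf Xk hX.
  by apply: (hc X t') => // i; [exact: fgp_lfree|exact: fgp_hfg].
have b1 m : mSpec R m -> exists t : int, forall i : int, t < i -> exS (~` m) P i.
  move=> hm; have [c hc] := bounded m hm; exists (t + c%:Z).
  by apply: hc => //; exact: K0_bounded P0.
have b2 m : mSpec R m -> forall n : int,
    exists N0 : int, forall N : int, N0 <= N -> exS (~` m) (XN P N) n.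
  move=> hm n; have [c hc] := bounded m hm; exists (t + c%:Z - n) => N hN.
  have [b X0] := XN_zero N P0; have Xf i := XN_fgp N i Pfgp P0.
  apply: (hc (XN P N) (t - N - 1)) => //; [exact: K0_bounded X0| |lia].
  by move=> i ti; apply/(XN_base_change phi Pfgp P0); apply: (sd_XN TPfgp ht) => //; lia.
have [b hb] := uniform_bound hR Pfgp P0 b1 b2.
by split; [exists b|exact: (local_sd Pfgp hb hR b2)].
Qed.
End AscentDescent.

Theorem theorem4p5 (R S : comPzRingType) (phi : {rmorphism R -> S})
    (noethR : noetherian R) (noethS : noetherian S)
    (fdS : finite_flat_dim (restr S^o phi))
    (C : complex R) (finC : hdfinite C) :
  (semidualizing C ->
     [/\ semidualizing (Ltensor phi C),
         (cinf C <= cinf (Ltensor phi C))%E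
       & (amp (Ltensor phi C) <= amp C)%E]) /\
  (semidualizing (Ltensor phi C) ->
     mSpec R `<=` [set Spec_map phi Q | Q in Spec S] ->
     semidualizing C /\ cinf (Ltensor phi C) = cinf C).
Proof.
have hC i : hfg C i by apply/hfgP.
have low := @low_ascent R S phi noethR noethS C hC.
split=> [[/hfiniteP [_ [a [b [ha hb]]]] hom]|[/hfiniteP [_ [a [b [ha hb]]]] hom] hsurj].
  have [P [Pfgp P0 [eP eT] hD [sC sD]]] := model phi noethR noethS hC ha.
  have hP : sd P by apply/sC.
  have high c : (forall i : int, c < i -> ex C i) -> forall i : int, c < i -> ex (Ltensor phi C) i.
    move=> hc i ci; apply/eT; apply: (high_ascent noethR noethS Pfgp P0 fdS _ hP ci) => j jc.
    by apply/eP; exact: hc.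
  split; first split.
  - by apply/hfiniteP; split=> //; exists a, b; split; [exact: low|exact: high].
  - by apply/sD; apply: (sd_ascent Pfgp P0 fdS (t := b)) => // i bi; apply/eP; exact: hb.
  - by apply: cinf_le low _; exists a.
  - by apply: (amp_le low high); [exists a|exists b].
(* The lower bound of [C] has to come before the model: the finite resolution starts in a degree
   below which [C] is exact. *)
have low' := low_descent noethR hC hsurj.
have ha' := low' a ha; have [P [Pfgp P0 [eP eT] hD [sC sD]]] := model phi noethR noethS hC ha'.
have [||[c hc] hP] := sd_descent noethR Pfgp P0 fdS hsurj (t := b); [|exact/sD|].
  by move=> i bi; apply/eT; exact: hb.
split; first split.
- by apply/hfiniteP; split=> //; exists a, c; split=> // i ci; apply/eP; exact: hc.
- exact/sC.
- apply/le_anti/andP; split; last by apply: (cinf_le low); exists a.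
  by apply: (cinf_le low'); exists a.
Qed.
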